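(* Let $q\in L^1[0,1]$ be real-valued and let $\lambda_j$, $j=1,2,\dots$, be the eigenvalues of the Dirichlet problem $-\varphi_j''+q(x)\varphi_j=\lambda_j\varphi_j$ on $0\le x\le 1$, $\varphi_j(0)=\varphi_j(1)=0$. Let $0<b<1$, and suppose that the following data are given: $$\{\lambda_{m(j)}\ \ \forall j;\quad q(x),\ b\le x\le 1\},$$ where $$m(j)=\frac{j}{\sigma}(1+\epsilon_j),\qquad |\epsilon_j|<1,\qquad \epsilon_j\to 0\ \text{ as } j\to\infty,\qquad \sigma=\mathrm{const},\quad 0<\sigma\le 2 .$$ Then: (i) these data determine $q(x)$ uniquely on the interval $0\le x\le b$ if $\sigma>2b$; (ii) if it is assumed additionally that $\sum_{j=1}^\infty|\epsilon_j|<\infty$, then $q$ is uniquely determined on $0\le x\le b$ if $\sigma\ge 2b$.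
   Context: The eigenvalues $\lambda_1<\lambda_2<\dots$ are numbered in increasing order, and $m(j)$ is the index of the $j$-th given eigenvalue. ''The data determine $q$ uniquely on $[0,b]$'' means: if $q_1,q_2\in L^1[0,1]$ are real-valued, coincide on $[b,1]$, and have the same $m(j)$-th Dirichlet eigenvalue for every $j$, then $q_1=q_2$ (almost everywhere) on $[0,b]$.
   Formalization: The indices m(j) are assumed pairwise distinct (the given eigenvalues are different); with repetitions allowed the claim fails, e.g. σ=1.9, b=3/4, m(j)=max(1,⌊j/1.9⌋) with a potential and its reflection about x=1/2. *)

(* Defs.v *)
From HB Require Import structures.
From mathcomp Require Export all_boot all_order all_algebra.
From mathcomp Require Export all_classical all_reals all_analysis.

Set Implicit Arguments.
Unset Strict Implicit.
Unset Printing Implicit Defensive.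

Import Order.TTheory GRing.Theory Num.Theory.
Import numFieldNormedType.Exports.

Local Open Scope classical_set_scope.
Local Open Scope ring_scope.

(* The usual epsilon-delta definition; A is meant to be an interval. *)
Definition abs_continuous_on (R : realType) (A : set R) (f : R -> R) : Prop :=
  forall e : R, 0 < e -> exists2 d : R, 0 < d &
    forall (n : nat) (u v : 'I_n -> R),
      (forall i, u i <= v i) ->
      (forall i, `[u i, v i] `<=` A) ->
      trivIset setT (fun i => `]u i, v i[%classic) ->
      \sum_(i < n) (v i - u i) < d ->
      \sum_(i < n) `|f (v i) - f (u i)| < e.

Definition L1_01 (R : realType) (q : R -> R) : Prop :=
  (@lebesgue_measure R).-integrable `[0, 1] (EFin \o q).

Definition ae_eq_on (R : realType) (A : set R) (f g : R -> R) : Prop :=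
  {ae @lebesgue_measure R, forall x, A x -> f x = g x}.

(* phi solves - phi'' + q phi = lam phi in the Caratheodory sense, the standard
   one for q in L^1: phi and phi' are absolutely continuous and the equation
   holds almost everywhere.  The two-sided derivative derive1 phi is used only on
   the open interval, so the values of phi outside [0, 1] play no role; absolute
   continuity of phi' on ]0, 1[ is the same as that of its extension to [0, 1]
   and, with continuity of phi on [0, 1], it gives that of phi. *)
Definition dirichlet_eigenfunction (R : realType) (q : R -> R) (lam : R)
    (phi : R -> R) : Prop :=
  [/\ derivable_oo_LRcontinuous phi 0 1,
      abs_continuous_on `]0, 1[ (derive1 phi),
      {ae @lebesgue_measure R, forall x, `]0, 1[%classic x ->
         derivable (derive1 phi) x 1 /\
         - derive1 (derive1 phi) x + q x * phi x = lam * phi x},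
      phi 0 = 0 /\ phi 1 = 0
    & exists2 x, `[0, 1]%classic x & phi x != 0].

(* For real q the problem is self-adjoint, so that real lam and real-valued
   eigenfunctions suffice. *)
Definition dirichlet_eigenvalue (R : realType) (q : R -> R) (lam : R) : Prop :=
  exists phi : R -> R, dirichlet_eigenfunction q lam phi.

(* lam 1 < lam 2 < ... are all the eigenvalues; lam 0 is a junk value. *)
Definition dirichlet_spectrum (R : realType) (q : R -> R) (lam : nat -> R)
    : Prop :=
  (forall i j : nat, (0 < i)%N -> (i < j)%N -> lam i < lam j) /\
  [set mu | dirichlet_eigenvalue q mu] = lam @` [set n | (0 < n)%N].

(* The indices j of the data start from 1; m 0 is a junk value. *)
Definition data_determine_potential (R : realType) (b : R) (m : nat -> nat)
    : Prop :=
  forall (q1 q2 : R -> R) (lam1 lam2 : nat -> R),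
    L1_01 q1 -> L1_01 q2 ->
    dirichlet_spectrum q1 lam1 -> dirichlet_spectrum q2 lam2 ->
    ae_eq_on `[b, 1] q1 q2 ->
    (forall j : nat, (0 < j)%N -> lam1 (m j) = lam2 (m j)) ->
    ae_eq_on `[0, b] q1 q2.

(* Main.v *)
(* Let s_1, s_2 be the solutions with s(0) = 0, s'(0) = 1 for two potentials with
   the same data.  Their Wronskian W(lam) at b is entire and O(exp(2 b |Im k|) / |k|^2)
   with lam = k^2.  It vanishes at every given eigenvalue, because s_1 and s_2 vanish
   at 1 and the potentials agree on [b, 1].  A Prufer angle shows
   lam_n <= (pi n)^2 + O(1), so W has at least as many zeros as a function of type
   sigma in k; since sigma >= 2 b, Jensen's inequality forces W = 0.

   Let c_i, d_i be the solutions with Cauchy data (1, 0) and (0, 1) at b.  Once W = 0,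
   c_1 d_2 - c_2 d_1 at a point x of [0, b] is entire in lam and tends to 0 at
   infinity (Borg's argument), hence vanishes.  At lam = 0 this identity in x yields
   c_1 = c_2 and d_1 = d_2, hence equal potentials on [0, b]. *)
Require Import Defs.
From mathcomp Require Import all_boot all_order all_algebra.
From mathcomp Require Import all_classical all_reals all_analysis.
From mathcomp Require Import measurable_realfun complex ring lra.
Import Order.TTheory GRing.Theory Num.Theory.
Import numFieldNormedType.Exports.
Set Implicit Arguments.
Unset Strict Implicit.
Unset Printing Implicit Defensive.
Local Open Scope classical_set_scope.
Local Open Scope ring_scope.

(** * Absolutely continuous functions *)

(** One monotonicity theorem for absolutely continuous functions carries the real analysis: Gronwall
    estimates, constancy of Wronskians and uniqueness of solutions all follow from it. Entire
    functions are replaced by limits of polynomials, uniform on discs, for which a mean over roots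
    of unity serves as Cauchy's formula. W is small because W(0) = 0 and W' = (q2 - q1) s_1 s_2,
    where each factor contributes 1/|k|. Only upper bounds on |lam_n| matter: a zero nearer to the
    centre enlarges Jensen's product. Since (pi m(j))^2 is at most (pi j / sigma)^2 exp(2 |eps_j|),
    it suffices that the first n numbers |eps_j| sum to at most (1 - 2 b / sigma) n + O(1). This one
    condition covers both cases: it has slack when sigma > 2 b and asks for bounded sums when sigma
    = 2 b. Borg's argument needs a lower bound for |s(b)| away from the real k-axis. It comes from
    the real quadratic forms |s' - i k s|^2 and |s' + i k s|^2, which satisfy explicit first-order
    equations up to terms in q, so that no asymptotic expansion of solutions is used. *)

Section Cousin.
Variable R : realType.
Implicit Types (a b u v w x : R).

(** Compactness of [[a, b]] as an induction over intervals: the supremum of the points reachable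
    from [a] is reachable, and local validity around it would lead further if it were below [b].
    Locally only intervals containing the tag [x] are asked for, which is what differentiability at
    [x] can serve. *)
Lemma cousin (P : R -> R -> Prop) a b : a <= b ->
  (forall u v w, a <= u -> u <= v -> v <= w -> w <= b -> P u v -> P v w -> P u w) ->
  (forall x, a <= x <= b -> exists2 d : R, 0 < d &
     forall u v, a <= u -> u <= x -> x <= v -> v <= b -> v - u < d -> P u v) ->
  P a b.
Proof.
move=> ab Ptr Ploc.
pose S := [set x : R | a <= x <= b /\ P a x].
have Sa : S a.
  have [|d d0 Pd] := Ploc a; first by rewrite lexx.
  by split; [rewrite lexx | apply: Pd; rewrite ?lexx ?subrr].
have ubS : ubound S b by move=> x [/andP[]].
have hS : has_sup S by split; [exists a | exists b].
set c := sup S.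
have ac : a <= c by apply: ub_le_sup => //; exists b.
have cb : c <= b by apply: ge_sup => //; exists a.
have [|d d0 Pd] := Ploc c; first by rewrite ac cb.
have d20 : 0 < d / 2 by lra.
have [x [/andP[ax xb] Pax] cx] := sup_adherent d20 hS.
have xc : x <= c by apply: ub_le_sup; [exists b | split; rewrite ?ax].
(* The adherent point [x] lies within [d / 2] to the left of [c], so [[x, y]] contains [c] and is
   still shorter than [d]. *)
pose y := Num.min b (c + d / 4).
have cy : c <= y by rewrite le_min cb /=; lra.
have yb : y <= b by rewrite ge_min lexx.
have yd : y <= c + d / 4 by rewrite ge_min lexx orbT.
have Pay : P a y.
  apply: (Ptr a x y) => //; first lra.
  by apply: Pd => //; rewrite -/c in cx; lra.
have yc : y <= c.
  by apply: ub_le_sup; [exists b | split => //; rewrite yb andbT; lra].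
have : b <= y by rewrite le_min lexx /=; move: yc; rewrite ge_min => /orP[|]; lra.
by move=> by_; have -> : b = y by apply/eqP; rewrite eq_le by_ yb.
Qed.

End Cousin.

(** The derivative is carried as data and pinned down only almost everywhere. A second-order
    equation with an L^1 coefficient then becomes two such statements, one for y with derivative z
    and one for z. *)
Definition ac (R : realType) (a b : R) (f f' : R -> R) : Prop :=
  abs_continuous_on `[a, b] f /\
  {ae @lebesgue_measure R, forall x, x \in `]a, b[ -> is_derive x (1 : R) f (f' x)}.

Section ACle.
Variable R : realType.
Implicit Types (a b u v w x : R) (f g : R -> R).
Local Notation mu := (@lebesgue_measure R).

Lemma ae_impl (P Q : R -> Prop) : (forall x, P x -> Q x) ->
  {ae mu, forall x, P x} -> {ae mu, forall x, Q x}.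
Proof. by move=> PQ; apply: (filterS (F := almost_everywhere mu)). Qed.

Lemma ae_impl2 (P Q S : R -> Prop) : (forall x, P x -> Q x -> S x) ->
  {ae mu, forall x, P x} -> {ae mu, forall x, Q x} -> {ae mu, forall x, S x}.
Proof. by move=> PQ; apply: (filterS2 (F := almost_everywhere mu)). Qed.

Lemma ac_sub a b c d f f' : a <= c -> d <= b -> ac a b f f' -> ac c d f f'.
Proof.
move=> ac_ db [A1 A2]; split.
  move=> e e0; have [dl dl0 H] := A1 e e0; exists dl => // n u v uv sub tr s.
  apply: H => // i; apply: subset_trans (sub i) _ => x /=.
  by rewrite !in_itv /= => /andP[? ?]; apply/andP; split; lra.
apply: ae_impl A2 => x H xcd; apply: H.
by move: xcd; rewrite !in_itv /= => /andP[? ?]; apply/andP; split; lra.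
Qed.

Lemma is_derive_local x f (d : R) : is_derive x (1 : R) f d ->
  forall e : R, 0 < e -> exists2 dl : R, 0 < dl & forall y, `|y - x| < dl ->
    `|f y - f x - d * (y - x)| <= e * `|y - x|.
Proof.
move=> [dfx <-] e e0.
have := dfx; rewrite /derivable => /cvgrPdist_le /(_ _ e0).
rewrite -[lim _]/('D_1 f x) near_withinE => -[dl /= dl0 H].
exists dl => // y yx.
have [->|yx0] := eqVneq y x; first by rewrite !subrr mulr0 subrr !normr0 mulr0.
have h0 : y - x != 0 by rewrite subr_eq0.
have := H (y - x); rewrite /= sub0r normrN => /(_ yx h0).
rewrite /GRing.scale /= mulr1 subrK => H1.
have -> : f y - f x - 'D_1 f x * (y - x) =
   - ('D_1 f x - (y - x)^-1 * (f y - f x)) * (y - x) by field.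
by rewrite normrM normrN ler_wpM2r.
Qed.

Lemma local_is_derive x f (d : R) :
  (forall e : R, 0 < e -> exists2 dl : R, 0 < dl & forall y, `|y - x| < dl ->
    `|f y - f x - d * (y - x)| <= e * `|y - x|) ->
  is_derive x (1 : R) f d.
Proof.
move=> H.
have L : h^-1 *: ((f \o shift x) (h *: (1:R)) - f x) @[h --> 0^'] --> d.
  apply/cvgrPdist_le => e e0; rewrite near_withinE.
  have [dl dl0 H1] := H e e0; exists dl => // h /=; rewrite sub0r normrN => hd h0.
  have := H1 (h + x); rewrite addrK => /(_ hd).
  rewrite /GRing.scale /= mulr1 => H2.
  have -> : d - h^-1 * (f (h + x) - f x) = - (f (h + x) - f x - d * h) * h^-1 by field.
  by rewrite normrM normrN normfV ler_pdivrMr ?normr_gt0.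
apply: DeriveDef; first by apply/cvg_ex; exists d.
exact/cvg_lim.
Qed.


Lemma le_mu (A B : set R) : measurable A -> measurable B -> A `<=` B ->
  (mu A <= mu B)%E.
Proof. by move=> mA mB AB; rewrite le_measure //; exact/mem_set. Qed.

(** The function [m] is the distribution function of the measure restricted to [U]. It turns the
    total length of intervals inside [U] into increments that telescope. *)
Lemma open_len_le (U : set R) : open U -> (mu U < +oo)%E ->
  exists m : R -> R, [/\ forall x y, x <= y -> m x <= m y,
    forall c d, c <= d -> `[c, d] `<=` U -> d - c <= m d - m c &
    forall x y, ((m y - m x)%:E <= mu U)%E].
Proof.
move=> oU Uoo.
have mU : measurable U by exact: open_measurable.
have mI x : measurable (U `&` `]-oo, x]) by exact: measurableI.
have fI x : mu (U `&` `]-oo, x]) \is a fin_num.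
  rewrite ge0_fin_numE//; apply: le_lt_trans Uoo.
  by apply: le_mu => //; exact: subIsetl.
exists (fun x => fine (mu (U `&` `]-oo, x]))); split.
- move=> x y xy; apply: fine_le => //; apply: le_mu => //.
  by move=> z /= [Uz]; rewrite !in_itv /= => zx; split => //; exact: le_trans xy.
- move=> c d cd sub; rewrite lerBrDr -lee_fin EFinD !fineK//.
  have -> : (d - c)%:E = mu `]c, d].
    rewrite lebesgue_measure_itv /= lte_fin; case: ltP => // dc.
    by rewrite (_ : d = c) ?subrr//; apply/eqP; rewrite eq_le cd dc.
  rewrite -measureU//; [|exact: mI|]; last first.
    apply/seteqP; split => // z /= []; rewrite !in_itv /= => /andP[cz _] [_].
    by rewrite leNgt cz.
  apply: le_mu => //; first exact: measurableU.
  move=> z [|[Uz]]; rewrite /= !in_itv /=.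
    move=> /andP[cz zd]; split => //; apply: sub => /=.
    by rewrite in_itv /= zd (ltW cz).
  by move=> zc; split => //; exact: le_trans zc cd.
move=> x y; apply: (@le_trans _ _ (mu (U `&` `]-oo, y]))).
  by rewrite -[leRHS]fineK// lee_fin gerBl fine_ge0.
by apply: le_mu => //; exact: subIsetl.
Qed.

(** Sorted lists replace disjoint families, so that the intervals of two adjacent pieces are joined
    by concatenation. *)
Lemma abs_cont_seq a b f e : abs_continuous_on `[a, b] f -> 0 < e ->
  exists2 d : R, 0 < d & forall s : seq (R * R),
   (forall p, p \in s -> a <= p.1 /\ p.1 <= p.2 /\ p.2 <= b) ->
   pairwise (fun p q : R * R => p.2 <= q.1) s ->
   \sum_(p <- s) (p.2 - p.1) < d ->
   \sum_(p <- s) `|f p.2 - f p.1| < e.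
Proof.
move=> A /A [d d0 H]; exists d => // s sab pw sd.
pose u (i : 'I_(size s)) := (nth (0, 0) s i).1.
pose v (i : 'I_(size s)) := (nth (0, 0) s i).2.
have := H (size s) u v; rewrite /u /v.
rewrite (big_nth (0, 0)) big_mkord in sd.
rewrite (big_nth (0, 0)) big_mkord; apply => //.
- by move=> i; have [_ []] := sab _ (mem_nth (0, 0) (ltn_ord i)).
- move=> i x /=; rewrite !in_itv /= => /andP[ux xv].
  have [? [? ?]] := sab _ (mem_nth (0, 0) (ltn_ord i)).
  by apply/andP; split; lra.
- move=> i j _ _ [x /= []]; rewrite !in_itv /= => /andP[ux xv] /andP[ux' xv'].
  apply/val_inj/eqP; rewrite /= eqn_leq.
  move/(pairwiseP (0, 0)) : pw => pw.
  by apply/andP; split; rewrite leqNgt; apply/negP => lt;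
   have := pw _ _ _ _ lt; rewrite !inE !ltn_ord => /(_ isT isT) h; lra.
Qed.

(** An interval tagged at a point of differentiability raises [f] by at most [e1] times its length.
    The other points form a null set inside an open set of small measure, where absolute continuity
    bounds the total increase. Cousin's argument assembles the two kinds of intervals. *)
Theorem ac_le_ae a b f f' : a <= b -> ac a b f f' ->
  {ae mu, forall x, x \in `]a, b[ -> f' x <= 0} -> f b <= f a.
Proof.
move=> ab [acf df] le0.
have {df le0} [N [mN N0 subN]] : {ae mu, forall x, x \in `]a, b[ ->
    exists2 d, is_derive x (1 : R) f d & d <= 0}.
  by apply: ae_impl2 df le0 => x H1 H2 xab; exists (f' x); [exact: H1 | exact: H2].
apply/ler_addgt0Pr => e e0.
(* The differentiable part costs at most [e1 * (b - a)] and the exceptional part [e1]; together this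
   is [e]. *)
pose e1 := e / (b - a + 1).
have ba1 : 0 < b - a + 1 by lra.
have e10 : 0 < e1 by rewrite divr_gt0.
have [d d0 Hd] := abs_cont_seq acf e10.
(* The end points count as exceptional, since the derivative is known only inside. *)
pose D := N `|` [set a; b].
have mD : measurable D.
  by apply: measurableU => //; apply: measurableU.
have D0 : mu D = 0%E.
  rewrite /D measureU0 //; first exact: measurableU.
  by rewrite measureU0 //; exact: lebesgue_measure_set1.
have muD : (mu D < +oo)%E by rewrite D0.
have [U [oU DU UD]] := lebesgue_regularity_outer mD muD d0.
have mU : measurable U by exact: open_measurable.
have Ud : (mu U < d%:E)%E.
  have -> : mu U = mu ((U `\` D) `|` D) by rewrite setUC setDUK.
  by rewrite measureU0 //; exact: measurableD.
have [m [mm mlen mtot]] := open_len_le oU (lt_trans Ud (ltry _)).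
pose P u v := u <= v -> exists s : seq (R * R),
  [/\ (forall p, p \in s -> u <= p.1 /\ p.1 <= p.2 /\ p.2 <= v),
     pairwise (fun p q : R * R => p.2 <= q.1) s,
     \sum_(p <- s) (p.2 - p.1) <= m v - m u &
     f v - f u <= e1 * (v - u) + \sum_(p <- s) `|f p.2 - f p.1| ].
have [|s [s1 s2 s3 s4]] : P a b; last first.
- have := Hd s s1 s2; have : \sum_(p <- s) (p.2 - p.1) < d.
    by rewrite -lte_fin; apply: le_lt_trans Ud; apply: le_trans (mtot a b); rewrite lee_fin.
  move=> sd /(_ sd) h; have : e1 * (b - a + 1) = e by rewrite /e1 divfK// gt_eqF.
  lra.
- by [].
apply: cousin => //.
- move=> u v w au uv vw wb /(_ uv) [s [s1 s2 s3 s4]] /(_ vw) [t [t1 t2 t3 t4]] _.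
  exists (s ++ t); clear -uv vw s1 s2 s3 s4 t1 t2 t3 t4; split.
  + by move=> p; rewrite mem_cat => /orP[/s1|/t1] [h1 [h2 h3]]; split; [|split| |split];
      rewrite ?(le_trans uv h1) ?(le_trans h3 vw).
  + rewrite pairwise_cat s2 t2 !andbT; apply/allrelP => p q /s1 [_ [_ h1]] /t1 [h2 _].
    exact: le_trans h1 h2.
  + by move: (lerD s3 t3); rewrite big_cat /=; clear; lra.
  + by move: (lerD s4 t4); rewrite big_cat /=; clear; lra.
- move=> x /andP[ax xb].
  have [Dx|nDx] := pselect (D x).
    have := oU; rewrite openE => /(_ x (DU _ Dx)) [r /= r0 rU].
    exists r => // u v au ux xv vb uvr uv; exists [:: (u, v)].
    clear -uv ux xv uvr rU mlen e10; split => //.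
    + by move=> p; rewrite inE => /eqP ->.
    + rewrite big_seq1 /=; apply: mlen => // z /=; rewrite in_itv /= => /andP[uz zv].
      by apply: rU => /=; rewrite ltr_norml; apply/andP; split; lra.
    + by rewrite big_seq1 /= (le_trans (ler_norm _))// lerDr mulr_ge0//; lra.
  have xab : x \in `]a, b[.
    rewrite in_itv /= !lt_neqAle ax xb !andbT; apply/andP; split; apply/eqP => h.
      by apply: nDx; right; left.
    by apply: nDx; right; right.
  have [dd dfx dle] : exists2 d, is_derive x (1 : R) f d & d <= 0.
    by move: xab; apply: contrapT => h; apply: nDx; left; apply: subN => /= h'; exact: h.
  have [r r0 Hr] := is_derive_local dfx e10.
  exists r => // u v au ux xv vb uvr uv; exists [::]; split => //.
    by rewrite big_nil; have := mm _ _ uv; lra.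
  rewrite big_nil addr0.
  clear -ux xv uvr uv Hr r0 dle e10.
  have h1 : `|u - x| < r by rewrite ler0_norm; lra.
  have h2 : `|v - x| < r by rewrite ger0_norm; lra.
  have := Hr u h1; have := Hr v h2.
  rewrite (ger0_norm (_ : 0 <= v - x)); last lra.
  rewrite (ler0_norm (_ : u - x <= 0)); last lra.
  rewrite !ler_norml => /andP[_ h3] /andP[h4 _].
  have : dd * (v - u) <= 0 by rewrite mulr_le0_ge0//; lra.
  nra.
Qed.

End ACle.

(** * Calculus rules for absolutely continuous functions *)

Section ACcalc.
Variable R : realType.
Implicit Types (a b u v w x : R) (f g : R -> R).

Lemma ac_eq_deriv a b f f' g' : (forall x, x \in `]a, b[ -> f' x = g' x) ->
  ac a b f f' -> ac a b f g'.
Proof.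
by move=> e [A1 A2]; split => //; apply: ae_impl A2 => x H xab; rewrite -e//; exact: H.
Qed.

Lemma ac_eqf a b f g f' : (forall x, a <= x -> x <= b -> f x = g x) ->
  ac a b f f' -> ac a b g f'.
Proof.
move=> e [A1 A2]; split.
  move=> eps eps0; have [d d0 H] := A1 eps eps0; exists d => // n u v uv sub tr sd.
  apply: le_lt_trans (H n u v uv sub tr sd); apply: ler_sum => i _.
  have /= := sub i (u i); have /= := sub i (v i).
  rewrite !in_itv /= !lexx (uv i) => /(_ isT) /andP[? ?] /(_ isT) /andP[? ?].
  by rewrite !e.
apply: ae_impl A2 => x H xab; apply: local_is_derive => eps eps0.
have [d d0 Hd] := is_derive_local (H xab) eps0.
move: xab; rewrite in_itv /= => /andP[ax xb].
exists (Num.min d (Num.min (x - a) (b - x))).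
  by rewrite !lt_min d0 !subr_gt0 ax xb.
move=> y; rewrite !lt_min => /andP[yd /andP[ya yb]].
have {ya} ya : a <= y by move: ya; rewrite ltr_norml => /andP[]; clear; lra.
have {yb} yb : y <= b by move: yb; rewrite ltr_norml => /andP[_]; clear; lra.
by rewrite -(e y ya yb) -(e x (ltW ax) (ltW xb)); exact: Hd.
Qed.

Lemma abs_cont_lip2 a b f g h (L : R) : 0 <= L ->
  (forall u v, a <= u -> u <= v -> v <= b ->
     `|h v - h u| <= L * (`|f v - f u| + `|g v - g u|)) ->
  abs_continuous_on `[a, b] f -> abs_continuous_on `[a, b] g ->
  abs_continuous_on `[a, b] h.
Proof.
move=> L0 H Af Ag e e0.
have e1 : 0 < e / (L + 1) / 2 by rewrite !divr_gt0// ltr_wpDl.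
have [d1 d10 H1] := Af _ e1; have [d2 d20 H2] := Ag _ e1.
exists (Num.min d1 d2); first by rewrite lt_min d10.
move=> n u v uv sub tr; rewrite lt_min => /andP[s1 s2].
have := H1 n u v uv sub tr s1; have := H2 n u v uv sub tr s2 => h2 h1.
have : \sum_(i < n) `|h (v i) - h (u i)| <=
    L * (\sum_(i < n) `|f (v i) - f (u i)| + \sum_(i < n) `|g (v i) - g (u i)|).
  rewrite -big_split mulr_sumr; apply: ler_sum => i _; apply: H => //.
    by have /= := sub i (u i); rewrite !in_itv /= lexx (uv i) => /(_ isT) /andP[].
  by have /= := sub i (v i); rewrite !in_itv /= lexx (uv i) => /(_ isT) /andP[].
move/le_lt_trans; apply; apply: (@le_lt_trans _ _ (L * (e / (L + 1)))).
  by rewrite ler_wpM2l// [leRHS](splitr (e / (L + 1))) lerD// ltW.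
by rewrite mulrCA gtr_pMr// ltr_pdivrMr ?mul1r ?ltrDl// ltr_wpDl.
Qed.

(** Sums, products and compositions are all instances: their increments are controlled linearly by
    those of [f] and [g]. *)
Lemma ac_lip2 a b f g h f' g' h' (L : R) : 0 <= L ->
  (forall u v, a <= u -> u <= v -> v <= b ->
     `|h v - h u| <= L * (`|f v - f u| + `|g v - g u|)) ->
  (forall x, is_derive x (1 : R) f (f' x) -> is_derive x (1 : R) g (g' x) ->
     is_derive x (1 : R) h (h' x)) ->
  ac a b f f' -> ac a b g g' -> ac a b h h'.
Proof.
move=> L0 H1 H2 [f1 f2] [g1 g2]; split; first exact: abs_cont_lip2 L0 H1 f1 g1.
by apply: ae_impl2 f2 g2 => x hf hg xab; apply: H2; [exact: hf | exact: hg].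
Qed.

Lemma ac_cst a b (k : R) : ac a b (fun=> k) (fun=> 0).
Proof.
split; last by apply: aeW => x _; exact: is_derive_cst.
move=> e e0; exists 1 => // n u v _ _ _ _.
by rewrite big1 // => i _; rewrite subrr normr0.
Qed.

Lemma ac_id a b : ac a b id (fun=> 1).
Proof.
split; last by apply: aeW => x _; exact: is_derive_id.
move=> e e0; exists e => // n u v uv _ _ se; apply: le_lt_trans se.
by apply: ler_sum => i _; rewrite ger0_norm// subr_ge0.
Qed.


Lemma acD a b f g f' g' : ac a b f f' -> ac a b g g' ->
  ac a b (fun x => f x + g x) (fun x => f' x + g' x).
Proof.
move=> F G; apply: (@ac_lip2 _ _ _ _ _ _ _ _ 1 _ _ _ F G) => [//|u v _ _ _].
by rewrite mul1r opprD addrACA ler_normD.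
Qed.

Lemma ac_bounded a b f f' : ac a b f f' ->
  exists2 M : R, 0 < M & forall x, a <= x -> x <= b -> `|f x| <= M.
Proof.
move=> [A _]; have [d d0 H] := abs_cont_seq A ltr01.
have [ab|ba] := leP a b; last first.
  by exists 1 => // x ax xb; move: (le_trans ax xb); rewrite leNgt ba.
suff [M HM] : exists M : R, forall x, a <= x -> x <= b -> `|f x - f a| <= M.
  have M0 : 0 <= M by apply: le_trans (HM a _ _).
  exists (M + `|f a| + 1); first by rewrite ltr_wpDl// addr_ge0.
  move=> x ax xb; rewrite -[f x](subrK (f a)) (le_trans (ler_normD _ _))//.
  by have := HM x ax xb; lra.
pose P u v := u <= v -> exists M : R, forall x, u <= x -> x <= v -> `|f x - f u| <= M.
apply: (_ : P a b) => //; apply: cousin => //.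
- move=> u v w au uv vw wb /(_ uv) [M1 H1] /(_ vw) [M2 H2] _.
  have M10 : 0 <= M1 by apply: le_trans (H1 u _ _).
  have M20 : 0 <= M2 by apply: le_trans (H2 v _ _).
  exists (M1 + M2) => x ux xw; have [xv|vx] := leP x v.
    by apply: (le_trans (H1 x ux xv)); rewrite lerDl.
  rewrite -(subrKA (f v)) addrC (le_trans (ler_normD _ _))// lerD//.
    exact: H1.
  by apply: H2 => //; exact: ltW.
move=> x0 _; exists d => // u v au ux xv vb uvd uv; exists 1 => x ux' xv'.
have := H [:: (u, x)]; rewrite !big_seq1 /= => h; apply/ltW/h => //.
  by move=> p; rewrite inE => /eqP -> /=; rewrite au ux' (le_trans xv').
by apply: le_lt_trans uvd; rewrite lerD2r.
Qed.

Lemma acM a b f g f' g' : ac a b f f' -> ac a b g g' ->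
  ac a b (fun x => f x * g x) (fun x => f' x * g x + f x * g' x).
Proof.
move=> F G; have [M1 M10 H1] := ac_bounded F; have [M2 M20 H2] := ac_bounded G.
apply: (@ac_lip2 _ _ _ _ _ _ _ _ (M1 + M2) _ _ _ F G) => [|u v au uv vb|x df dg].
- by rewrite addr_ge0// ltW.
- have -> : f v * g v - f u * g u = f v * (g v - g u) + (f v - f u) * g u by ring.
  rewrite (le_trans (ler_normD _ _))// !normrM mulrDr.
  have h1 := H1 v (le_trans au uv) vb; have h2 := H2 u au (le_trans uv vb).
  rewrite addrC lerD//.
    by rewrite [leLHS]mulrC ler_wpM2r// (le_trans h2)// lerDr ltW.
  by rewrite ler_wpM2r// (le_trans h1)// lerDl ltW.
- by apply: is_derive_eq; rewrite /GRing.scale /= addrC mulrC [f x * _]mulrC.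
Qed.

Lemma acN a b f f' : ac a b f f' -> ac a b (fun x => - f x) (fun x => - f' x).
Proof.
move=> F; have := acM (ac_cst a b (-1)) F.
have -> : (fun x => -1 * f x) = (fun x => - f x) by apply/funext => x; rewrite mulN1r.
by apply: ac_eq_deriv => x _; rewrite mul0r add0r mulN1r.
Qed.

Lemma acB a b f g f' g' : ac a b f f' -> ac a b g g' ->
  ac a b (fun x => f x - g x) (fun x => f' x - g' x).
Proof. by move=> F G; apply: acD => //; exact: acN. Qed.

Lemma acZ a b k f f' : ac a b f f' -> ac a b (fun x => k * f x) (fun x => k * f' x).
Proof.
move=> F; have := acM (ac_cst a b k) F.
by apply: ac_eq_deriv => x _; rewrite mul0r add0r.
Qed.

(** The values of [f] stay in some [[- M, M]], where the mean value theorem makes [h] Lipschitz. *)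
Lemma ac_comp a b f f' (h h' : R -> R) :
  (forall x, is_derive x (1 : R) h (h' x)) ->
  (forall M : R, exists L : R, forall x, `|x| <= M -> `|h' x| <= L) ->
  ac a b f f' -> ac a b (fun x => h (f x)) (fun x => h' (f x) * f' x).
Proof.
move=> dh bh F; have [M M0 HM] := ac_bounded F; have [L HL] := bh M.
have L0 : 0 <= L by apply: le_trans (HL 0 _) => //; rewrite normr0 ltW.
have mvt x y : `|x| <= M -> `|y| <= M -> x <= y -> `|h y - h x| <= L * `|y - x|.
  move=> xM yM xy.
  have [|c] := @MVT_segment R h h' x y xy (fun z _ => dh z).
    by apply: derivable_within_continuous => z _; have [] := dh z.
  rewrite in_itv /= => /andP[xc cy] ->; rewrite normrM ler_wpM2r// HL//.
  by move: xM yM; rewrite !ler_norml => /andP[? ?] /andP[? ?]; apply/andP; split; lra.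
apply: (@ac_lip2 _ _ _ _ _ _ _ _ L _ _ _ F F) => [//|u v au uv vb].
  apply: (@le_trans _ _ (L * `|f v - f u|)); last by rewrite ler_wpM2l// lerDl.
  have fu := HM u au (le_trans uv vb); have fv := HM v (le_trans au uv) vb.
  have [h1|h1] := leP (f u) (f v); first exact: mvt.
  by rewrite distrC [X in _ * X]distrC; apply: mvt => //; exact: ltW.
Qed.

Lemma ac_exp a b f f' : ac a b f f' ->
  ac a b (fun x => expR (f x)) (fun x => expR (f x) * f' x).
Proof.
apply: ac_comp => M.
exists (expR M) => x; rewrite ler_norml => /andP[_ h].
by rewrite ger0_norm ?expR_ge0// ler_expR.
Qed.

Lemma ac_sin a b f f' : ac a b f f' ->
  ac a b (fun x => sin (f x)) (fun x => cos (f x) * f' x).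
Proof.
apply: ac_comp => M.
by exists 1 => x _; exact: cos_max.
Qed.

Lemma ac_cos a b f f' : ac a b f f' ->
  ac a b (fun x => cos (f x)) (fun x => - sin (f x) * f' x).
Proof.
apply: ac_comp => M.
by exists 1 => x _; rewrite normrN; exact: sin_max.
Qed.

End ACcalc.

(** * Increment estimates and indefinite Lebesgue integrals *)

Section ACprim.
Variable R : realType.
Implicit Types (a b u v w x : R) (f g h : R -> R).
Local Notation mu := (@lebesgue_measure R).

Lemma ac_ge_ae a b f f' : a <= b -> ac a b f f' ->
  {ae mu, forall x, x \in `]a, b[ -> 0 <= f' x} -> f a <= f b.
Proof.
move=> ab /acN F le0; rewrite -lerN2; apply: (ac_le_ae ab F).
by apply: ae_impl le0 => x H xab; rewrite oppr_le0; exact: H.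
Qed.

Lemma ac_leD a b f g f' g' : a <= b -> ac a b f f' -> ac a b g g' ->
  {ae mu, forall x, x \in `]a, b[ -> f' x <= g' x} -> f b - f a <= g b - g a.
Proof.
move=> ab F G fg; have := ac_le_ae ab (acB F G).
have fg' : {ae mu, forall x, x \in `]a, b[ -> f' x - g' x <= 0}.
  by apply: ae_impl fg => x H xab; rewrite subr_le0; exact: H.
by move=> /(_ fg') /=; lra.
Qed.

Lemma ac_norm_leD a b f g f' g' : a <= b -> ac a b f f' -> ac a b g g' ->
  {ae mu, forall x, x \in `]a, b[ -> `|f' x| <= g' x} -> `|f b - f a| <= g b - g a.
Proof.
move=> ab F G fg; rewrite ler_norml; apply/andP; split; last first.
  apply: ac_leD ab F G _; apply: ae_impl fg => x H xab.
  exact: le_trans (ler_norm _) (H xab).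
rewrite lerNl opprB; have -> : f a - f b = (- f b) - (- f a) by rewrite opprK addrC.
apply: ac_leD ab (acN F) G _; apply: ae_impl fg => x H xab.
by apply: le_trans (ler_norm _) _; rewrite normrN; exact: H.
Qed.

Lemma ac_const_ae a b f f' : ac a b f f' ->
  {ae mu, forall x, x \in `]a, b[ -> f' x = 0} ->
  forall x y, a <= x -> x <= b -> a <= y -> y <= b -> f x = f y.
Proof.
move=> F f0; suff H x y : a <= x -> x <= y -> y <= b -> f x = f y.
  move=> x y ax xb ay yb; have [xy|/ltW yx] := leP x y; first exact: H.
  by symmetry; exact: H.
move=> ax xy yb; have {}F : ac x y f f' by exact: ac_sub F.
have s z : z \in `]x, y[ -> z \in `]a, b[.
  rewrite !in_itv /= => /andP[xz zy].
  by rewrite (le_lt_trans ax xz) (lt_le_trans zy yb).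
apply/eqP; rewrite eq_le (ac_ge_ae xy F) ?(ac_le_ae xy F)//;
by apply: ae_impl f0 => z H /s/H ->.
Qed.

Lemma ac_near a b f f' : ac a b f f' -> forall e : R, 0 < e ->
  exists2 d : R, 0 < d & forall x y, a <= x -> x <= b -> a <= y -> y <= b ->
    `|y - x| < d -> `|f y - f x| < e.
Proof.
move=> [A _] e e0; have [d d0 H] := abs_cont_seq A e0; exists d => //.
suff H1 x y : a <= x -> x <= y -> y <= b -> y - x < d -> `|f y - f x| < e.
  move=> x y ax xb ay yb; have [xy|yx] := leP x y.
    by rewrite ger0_norm ?subr_ge0//; exact: H1.
  by rewrite distrC ger0_norm ?subr_ge0 ?ltW// distrC; apply: H1 => //; exact: ltW.
move=> ax xy yb xyd; have := H [:: (x, y)]; rewrite !big_seq1 /= => h; apply/h => //.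
by move=> p; rewrite inE => /eqP -> /=; rewrite ax xy.
Qed.

Lemma ac_continuous a b f f' : ac a b f f' -> {within `[a, b], continuous f}.
Proof.
move=> F; apply/subspace_continuousP => x /=; rewrite in_itv /= => /andP[ax xb].
apply/cvgrPdist_lt => e e0; have [d d0 H] := ac_near F e0.
exists d => // y /= xy; rewrite in_itv /= => /andP[ay yb].
by rewrite distrC; apply: H => //; rewrite distrC.
Qed.

(** A continuous derivative that is valid almost everywhere is valid everywhere: near [x], [f] minus
    the linear function of slope [g x] has increments of at most [e] times the length. *)
Lemma ac_C1 a b f g g' : ac a b f g -> ac a b g g' ->
  forall x, x \in `]a, b[ -> is_derive x (1 : R) f (g x).
Proof.
move=> F G x xab; have := xab; rewrite in_itv /= => /andP[ax xb].
apply: local_is_derive => e e0.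
have [d1 d10 H] := ac_near G e0.
exists (Num.min d1 (Num.min (x - a) (b - x))).
  by rewrite !lt_min d10 !subr_gt0 ax xb.
move=> y; rewrite !lt_min => /andP[yd /andP[ya yb]].
have {ya} ya : a < y by move: ya; rewrite ltr_norml => /andP[]; clear; lra.
have {yb} yb : y < b by move: yb; rewrite ltr_norml => /andP[_]; clear; lra.
have K u v : a < u -> u <= v -> v < b -> (forall z, u <= z -> z <= v -> `|z - x| < d1) ->
    `|(f v - g x * v) - (f u - g x * u)| <= e * v - e * u.
  move=> au uv vb near.
  have Fuv : ac u v f g by apply: ac_sub F; exact: ltW.
  apply: ac_norm_leD uv (acB Fuv (acZ (g x) (ac_id u v))) (acZ e (ac_id u v)) _.
  apply: aeW => z; rewrite in_itv /= => /andP[uz zv]; rewrite !mulr1.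
  apply/ltW/H; [exact: ltW|exact: ltW| | |].
  - by rewrite (le_trans (ltW au))// ltW.
  - by rewrite (le_trans (ltW zv))// ltW.
  - by apply: near; exact: ltW.
have [xy|yx] := leP x y.
  have := K x y ax xy yb; rewrite -mulrBr => K1.
  rewrite (ger0_norm (_ : 0 <= y - x)) ?subr_ge0//.
  have -> : f y - f x - g x * (y - x) = f y - g x * y - (f x - g x * x) by ring.
  apply: K1 => z xz zy; apply: le_lt_trans yd; rewrite !ger0_norm ?subr_ge0//.
  by rewrite lerD2r.
have := K y x ya (ltW yx) xb; rewrite -mulrBr => K1.
have yx0 : y - x <= 0 by rewrite subr_le0 ltW.
rewrite (ler0_norm yx0) opprB -normrN.
have -> : - (f y - f x - g x * (y - x)) = f x - g x * x - (f y - g x * y) by ring.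
apply: K1 => z yz zx; apply: le_lt_trans yd; rewrite !ler0_norm ?subr_le0//.
  by rewrite lerN2 lerD2r.
exact: ltW.
Qed.

Definition prim h x : R := (\int[mu]_(t in `[0, x]) h t)%R.

Lemma prim0 h : prim h 0 = 0.
Proof. by rewrite /prim set_itv1 Rintegral_set1. Qed.

Lemma L1_sub (A B : set R) h : measurable A -> measurable B -> A `<=` B ->
  mu.-integrable B (EFin \o h) -> mu.-integrable A (EFin \o h).
Proof. by move=> mA mB AB; apply: integrableS. Qed.

Lemma primB h u v : L1_01 h -> 0 <= u -> u <= v -> v <= 1 ->
  prim h v - prim h u = (\int[mu]_(t in `]u, v[) h t)%R.
Proof.
move=> ih u0 uv v1; rewrite /prim Rintegral_itvB ?bnd_simp//; last first.
  by apply: L1_sub ih => // x /=; rewrite !in_itv /= => /andP[-> /le_trans]; exact.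
rewrite Rintegral_itv_bndo_bndc //.
apply: L1_sub ih => // x /=; rewrite !in_itv /= => /andP[ux xv].
by rewrite (le_trans (ltW xv) v1) (le_trans u0 (ltW ux)).
Qed.

Lemma abs_cont_prim h : L1_01 h -> abs_continuous_on `[0, 1] (prim h).
Proof.
move=> ih e e0.
have ih0 : mu.-integrable setT (EFin \o (h \_ `[0, 1])).
  by rewrite -restrict_EFin; apply/integrable_restrict => //=; rewrite setTI.
have [d [d0 H]] := integral_normr_continuous ih0 e0.
exists d => // n u v uv sub tr s.
pose F i : set R := `]u i, v i[%classic.
have mF i : measurable (F i) by exact: measurable_itv.
pose D := \big[setU/set0]_(i < n) F i.
have mD : measurable D by apply: bigsetU_measurable => i _; exact: mF.
have u0 i : 0 <= u i.
  by have /= := sub i (u i); rewrite !in_itv /= lexx (uv i) => /(_ isT) /andP[].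
have v1 i : v i <= 1.
  by have /= := sub i (v i); rewrite !in_itv /= lexx (uv i) => /(_ isT) /andP[].
have muF i : (mu (F i) <= (v i - u i)%:E)%E.
  rewrite /F lebesgue_measure_itv /= lte_fin; case: ltP => [_|]; first by rewrite EFinB.
  by rewrite lee_fin subr_ge0.
have muD : (mu D < d%:E)%E.
  rewrite /D measure_semi_additive_ord //.
  apply: le_lt_trans (_ : ((\sum_(i < n) (v i - u i))%:E < _)%E); last by rewrite lte_fin.
  by rewrite -sumEFin; apply: lee_sum => i _; exact: muF.
have iD (A : set R) : measurable A -> mu.-integrable A (EFin \o (h \_ `[0, 1])).
  by move=> mA; apply: L1_sub ih0.
apply: le_lt_trans (H D mD muD).
have -> : (\int[mu]_(x in D) `|(h \_ `[0, 1]) x|)%R =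
    \sum_(i < n) (\int[mu]_(x in F i) `|(h \_ `[0, 1]) x|)%R.
  rewrite /Rintegral /D integral_bigsetU_EFin //.
  - rewrite sum_fine //; move=> i _; apply: integrable_fin_num; first exact: mF.
    by have := integrable_norm (iD _ (mF i)).
  - exact: index_enum_uniq.
  - exact: sub_trivIset tr.
  - by have /integrableP[] := integrable_norm (iD _ mD).
apply: ler_sum => i _; rewrite primB//.
have -> : (\int[mu]_(t in `]u i, v i[) h t)%R = (\int[mu]_(t in `]u i, v i[) (h \_ `[0, 1]) t)%R.
  apply: eq_Rintegral => x; rewrite inE /= in_itv /= => /andP[ux xv].
  rewrite patchE ifT// inE /= in_itv /=.
  by rewrite (le_trans (u0 i) (ltW ux)) (le_trans (ltW xv) (v1 i)).
by apply: le_normr_Rintegral => //; exact: iD.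
Qed.

Lemma ac_prim h : L1_01 h -> ac 0 1 (prim h) h.
Proof.
move=> ih; split; first exact: abs_cont_prim.
(* Extension by zero gives local integrability on the line, as the differentiation theorem asks, and
   leaves the primitive unchanged up to 1. *)
pose h0 := h \_ `[0, 1].
have ih0 : mu.-integrable setT (EFin \o h0).
  by rewrite -restrict_EFin; apply/integrable_restrict => //=; rewrite setTI.
have locf : locally_integrable [set: R] h0.
  by apply: open_integrable_locally => //; exact: openT.
have ihy y : mu.-integrable `[0, y] (EFin \o h0) by apply: L1_sub ih0.
have := FTC1 (a := BLeft 0) ihy locf.
apply: ae_impl => x H; rewrite in_itv /= => /andP[x0 x1].
have [|d1 d2] := H; first by rewrite lte_fin.
have E y : y <= 1 -> prim h y = prim h0 y.
  move=> y1; apply: eq_Rintegral => z; rewrite inE /= in_itv /= => /andP[z0 zy].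
  by rewrite /h0 patchE ifT// inE /= in_itv /= z0 (le_trans zy).
have D0 : is_derive x (1 : R) (prim h0) (h x).
  have h0x : h0 x = h x by rewrite /h0 patchE ifT// inE /= in_itv /= !ltW.
  apply: DeriveDef; first exact: d1.
  by rewrite -derive1E -h0x; exact: d2.
apply: local_is_derive => e e0.
have [d d0 Hd] := is_derive_local D0 e0.
exists (Num.min d (1 - x)); first by rewrite lt_min d0 subr_gt0.
move=> y; rewrite lt_min => /andP[yd yx].
have y1 : y <= 1 by move: yx; rewrite ltr_norml => /andP[_]; clear; lra.
by rewrite (E y y1) (E x (ltW x1)); exact: Hd.
Qed.

End ACprim.

Section L1.
Variable R : realType.
Implicit Types (a b v w x : R) (f g h u : R -> R).
Local Notation mu := (@lebesgue_measure R).

Lemma L1_bounded_mul u h (M : R) : measurable_fun (`[0, 1] : set R) u ->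
  (forall x, 0 <= x -> x <= 1 -> `|u x| <= M) ->
  L1_01 h -> L1_01 (fun x : R => u x * h x).
Proof.
move=> mu_ bu ih; apply: (integrableMr (mu := mu) _ _ _ ih) => //.
exists M; split; first exact: num_real.
move=> N MN x /=; rewrite in_itv /= => /andP[x0 x1].
by rewrite (le_trans (bu x x0 x1))// ltW.
Qed.

Lemma ac_measurable f f' : ac 0 1 f f' -> measurable_fun (`[0, 1] : set R) f.
Proof. by move=> F; apply: subspace_continuous_measurable_fun => //; apply: ac_continuous F. Qed.

Lemma L1_acM f f' h : ac 0 1 f f' -> L1_01 h -> L1_01 (fun x : R => f x * h x).
Proof.
move=> F; have [M _ HM] := ac_bounded F.
by apply: L1_bounded_mul HM; exact: ac_measurable F.
Qed.

Lemma L1_cst (k : R) : L1_01 (fun=> k).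
Proof.
apply: (continuous_compact_integrable (A := `[0, 1])); first exact: segment_compact.
by apply: continuous_subspaceT => x; exact: cst_continuous.
Qed.

Lemma L1D f g : L1_01 f -> L1_01 g -> L1_01 (fun x : R => f x + g x).
Proof.
move=> F G; by have := integrableD (mu := mu) (measurable_itv _) F G.
Qed.

Lemma L1_norm f : L1_01 f -> L1_01 (fun x : R => `|f x|).
Proof. by move=> F; have := integrable_norm (mu := mu) F. Qed.

End L1.

(** * Solutions as entire functions of the spectral parameter *)

Section GeomSum.
Variable R : realType.
Implicit Types (f g : nat -> R).

Definition sum_series f : R := limn (series f).

(** Every series below has terms dominated by a multiple of 2^-n, so a sum can be identified by the
    rate of convergence of its partial sums. *)
Lemma sum_series_unique f (L K : R) :
  (forall N, `|L - \sum_(i < N) f i| <= K / 2 ^+ N) -> sum_series f = L.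
Proof.
move=> H; apply/cvg_lim => //; apply/cvgrPdist_le => e e0.
have K0 : 0 <= K by have := H 0%N; rewrite expr0 divr1; apply: le_trans.
have : (fun n => geometric K (2^-1 : R) n) @ \oo --> (0 : R).
  by apply: cvg_geometric; rewrite ger0_norm ?invr_ge0// invf_lt1// ltr1n.
move=> /cvgrPdist_le /(_ e e0) [N _ HN]; exists N => // n /= Nn.
rewrite seriesEord /= (le_trans (H n))//.
have := HN n Nn; rewrite /= sub0r normrN /geometric /= exprVn ger0_norm//.
by rewrite divr_ge0// exprn_ge0.
Qed.

Lemma sum_series_bound f (K : R) : (forall n, `|f n| <= K / 2 ^+ n) ->
  forall N, `|sum_series f - \sum_(i < N) f i| <= 2 * K / 2 ^+ N.
Proof.
move=> H N.
have K0 : 0 <= K by have := H 0%N; rewrite expr0 divr1; apply: le_trans.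
have cg : cvgn (series (geometric K (2^-1 : R))).
  by apply: is_cvg_geometric_series; rewrite ger0_norm ?invr_ge0// invf_lt1// ltr1n.
have cf : cvgn (series f).
  apply: normed_cvg; apply: series_le_cvg cg => [n|n|n] //=.
    by rewrite mulr_ge0// exprn_ge0// invr_ge0.
  by rewrite exprVn; exact: H.
have partial M : (N <= M)%N -> `|\sum_(i < M) f i - \sum_(i < N) f i| <= 2 * K / 2 ^+ N.
  move=> NM; apply: (@le_trans _ _ (2 * K / 2 ^+ N - 2 * K / 2 ^+ M)); last first.
    by rewrite gerBl divr_ge0// ?mulr_ge0// exprn_ge0.
  elim: M NM => [|M IH].
    by rewrite leqn0 => /eqP ->; rewrite !subrr normr0.
  rewrite leq_eqVlt => /orP[/eqP <-|]; first by rewrite !subrr normr0.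
  rewrite ltnS => /IH {}IH; rewrite big_ord_recr /= addrAC.
  rewrite (le_trans (ler_normD _ _))// (le_trans (lerD IH (H M)))//.
  rewrite exprS invfM le_eqVlt; apply/orP; left; apply/eqP.
  by field; rewrite ?pnatr_eq0 ?expf_neq0 ?pnatr_eq0.
move/cvgrPdist_le : cf => cf.
apply/ler_addgt0Pr => e e0; have [M _ HM] := cf e e0.
have h1 : `|sum_series f - \sum_(i < maxn M N) f i| <= e.
  by rewrite -(big_mkord xpredT f); exact: (HM _ (leq_maxl M N)).
rewrite -(subrKA (\sum_(i < maxn M N) f i)) (le_trans (ler_normD _ _))// addrC lerD//.
exact/partial/leq_maxr.
Qed.

End GeomSum.

(** * Perturbation series by variation of constants *)

Section Perturbation.
Variable R : realType.

Lemma ac_sum a b (F F' : nat -> R -> R) N : (forall i, ac a b (F i) (F' i)) ->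
  ac a b (fun x => \sum_(i < N) F i x) (fun x => \sum_(i < N) F' i x).
Proof.
move=> H; elim: N => [|N IH].
  have := ac_cst a b (0 : R); congr ac; apply/funext => x; rewrite big_ord0 //.
have := acD IH (H N).
by congr ac; apply/funext => x; rewrite big_ord_recr.
Qed.

Lemma prim_ge0 (h : R -> R) x : L1_01 h -> (forall x, 0 <= h x) -> 0 <= x -> x <= 1 -> 0 <= prim h x.
Proof.
move=> ih h0 x0 x1; have <- := prim0 h; apply: (ac_ge_ae x0 (ac_sub (lexx 0) x1 (ac_prim ih))).
by apply: aeW => t _; exact: h0.
Qed.

Lemma prim_le1 (h : R -> R) x : L1_01 h -> (forall x, 0 <= h x) -> 0 <= x -> x <= 1 -> prim h x <= prim h 1.
Proof.
move=> ih h0 x0 x1; apply: (ac_ge_ae x1 (ac_sub x0 (lexx 1) (ac_prim ih))).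
by apply: aeW => t _; exact: h0.
Qed.

Lemma prim_norm_le (f g : R -> R) G : L1_01 f -> ac 0 1 G g ->
  (forall x, 0 < x -> x < 1 -> `|f x| <= g x) ->
  forall x, 0 <= x -> x <= 1 -> `|prim f x| <= G x - G 0.
Proof.
move=> lf hG fg x x0 x1.
have -> : prim f x = prim f x - prim f 0 by rewrite prim0 subr0.
apply: (ac_norm_leD x0 (ac_sub (lexx 0) x1 (ac_prim lf)) (ac_sub (lexx 0) x1 hG)).
apply: aeW => t; rewrite in_itv /= => /andP[t0 tx].
by apply: fg => //; exact: lt_le_trans x1.
Qed.

Variables (c c' s s' r rho : R -> R).
Hypothesis Hc : ac 0 1 c c'.
Hypothesis Hc' : ac 0 1 c' (fun x => r x * c x).
Hypothesis Hs : ac 0 1 s s'.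
Hypothesis Hs' : ac 0 1 s' (fun x => r x * s x).
Hypothesis wr : forall x, 0 <= x -> x <= 1 -> c x * s' x - c' x * s x = 1.
Hypothesis irho : L1_01 rho.
Variables (a0 a0' : R -> R).
Hypothesis Ha : ac 0 1 a0 a0'.
Hypothesis Ha' : ac 0 1 a0' (fun x => r x * a0 x).

(* Variation of constants for y'' = r y + rho y. *)
Fixpoint pert n : R -> R := if n is n'.+1 then
    fun x => s x * prim (fun t => c t * (pert n' t * rho t)) x
           - c x * prim (fun t => s t * (pert n' t * rho t)) x
  else a0.

Definition pert' n : R -> R := if n is n'.+1 then
    fun x => s' x * prim (fun t => c t * (pert n' t * rho t)) x
           - c' x * prim (fun t => s t * (pert n' t * rho t)) x
  else a0'.

Lemma L1_pert (e f f' g : R -> R) : ac 0 1 f f' -> ac 0 1 e g ->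
  L1_01 (fun t => e t * (f t * rho t)).
Proof. by move=> F E; apply: (L1_acM E); apply: (L1_acM F). Qed.

Lemma ac_pert n : ac 0 1 (pert n) (pert' n).
Proof.
elim: n => [|n IH] //=.
have := acB (acM Hs (ac_prim (L1_pert IH Hc))) (acM Hc (ac_prim (L1_pert IH Hs))).
by apply: ac_eq_deriv => x _; ring.
Qed.

(** The terms decay faster than any geometric sequence. Relative to the weight exp (M P x), with [P]
    the primitive of |rho|, each integration gains a factor 1 / M, so that no factorials have to be
    tracked. *)
Lemma pert_bound (A : R) : 0 < A -> exists2 K : R, 0 <= K &
  forall n x, 0 <= x -> x <= 1 -> `|pert n x| <= K / A ^+ n /\ `|pert' n x| <= K / A ^+ n.
Proof.
move=> A0.
have [B1 B10 H1] := ac_bounded Hc; have [B2 B20 H2] := ac_bounded Hc'.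
have [B3 B30 H3] := ac_bounded Hs; have [B4 B40 H4] := ac_bounded Hs'.
have [B5 B50 H5] := ac_bounded Ha; have [B6 B60 H6] := ac_bounded Ha'.
pose B := B1 + B2 + B3 + B4 + B5 + B6.
have B0 : 0 < B by rewrite !addr_gt0.
have {}H1 x : 0 <= x -> x <= 1 -> `|c x| <= B.
  by move=> x0 x1; apply: le_trans (H1 x x0 x1) _; rewrite /B; lra.
have {}H2 x : 0 <= x -> x <= 1 -> `|c' x| <= B.
  by move=> x0 x1; apply: le_trans (H2 x x0 x1) _; rewrite /B; lra.
have {}H3 x : 0 <= x -> x <= 1 -> `|s x| <= B.
  by move=> x0 x1; apply: le_trans (H3 x x0 x1) _; rewrite /B; lra.
have {}H4 x : 0 <= x -> x <= 1 -> `|s' x| <= B.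
  by move=> x0 x1; apply: le_trans (H4 x x0 x1) _; rewrite /B; lra.
have {}H5 x : 0 <= x -> x <= 1 -> `|a0 x| <= B.
  by move=> x0 x1; apply: le_trans (H5 x x0 x1) _; rewrite /B; lra.
have {}H6 x : 0 <= x -> x <= 1 -> `|a0' x| <= B.
  by move=> x0 x1; apply: le_trans (H6 x x0 x1) _; rewrite /B; lra.
have inr := L1_norm irho.
pose P := prim (fun t => `|rho t|).
(* Two integrals, each with one factor bounded by [B] inside and one outside, cost 2 B^2; this [M]
   leaves a gain of [A] per step. *)
pose M := 2 * B ^+ 2 * A.
have M0 : 0 < M by rewrite /M !mulr_gt0 // exprn_gt0.
have A0' := ltW A0; have B0' := ltW B0; have M0' := ltW M0.
have P0 x : 0 <= x -> x <= 1 -> 0 <= P x by move=> *; apply: prim_ge0.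
suff H n x : 0 <= x -> x <= 1 -> `|pert n x| <= B * expR (M * P x) / A ^+ n /\
    `|pert' n x| <= B * expR (M * P x) / A ^+ n.
  exists (B * expR (M * P 1)); first by rewrite mulr_ge0 ?expR_ge0.
  move=> n x x0 x1; have [h1 h2] := H n x x0 x1.
  have h3 : B * expR (M * P x) / A ^+ n <= B * expR (M * P 1) / A ^+ n.
    apply: ler_wpM2r; first by rewrite invr_ge0 exprn_ge0.
    apply: (ler_wpM2l B0'); rewrite ler_expR; apply: (ler_wpM2l M0').
    exact: prim_le1.
  by split; [exact: le_trans h1 h3 | exact: le_trans h2 h3].
elim: n x => [|n IH] x x0 x1.
  rewrite expr0 divr1.
  have E : B <= B * expR (M * P x).
    by rewrite ler_pMr// -expR0 ler_expR mulr_ge0// P0.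
  by split; [exact: le_trans (H5 x x0 x1) E | exact: le_trans (H6 x x0 x1) E].
pose G x := B ^+ 2 / (M * A ^+ n) * expR (M * P x).
pose g x := B ^+ 2 / (M * A ^+ n) * (expR (M * P x) * (M * `|rho x|)).
have hG : ac 0 1 G g by apply: acZ; apply: ac_exp; apply: acZ; exact: ac_prim.
have key e e' : ac 0 1 e e' -> (forall x, 0 <= x -> x <= 1 -> `|e x| <= B) ->
    `|prim (fun t => e t * (pert n t * rho t)) x| <= G x.
  move=> He Be; have := prim_norm_le (L1_pert (ac_pert n) He) hG _ x0 x1.
  move/(_ _)/le_trans; apply; last first.
    by rewrite gerBl /G mulr_ge0 ?expR_ge0// divr_ge0 ?mulr_ge0 ?exprn_ge0.
  move=> t /ltW t0 /ltW t1; rewrite !normrM.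
  have -> : g t = B * ((B * expR (M * P t) / A ^+ n) * `|rho t|).
    rewrite /g; field; rewrite ?gt_eqF// ?exprn_gt0//.
  rewrite ler_pM// ?mulr_ge0//; first exact: Be.
  by rewrite ler_wpM2r//; have [] := IH t t0 t1.
have -> : B * expR (M * P x) / A ^+ n.+1 = B * G x + B * G x.
  rewrite /G; set E := expR _.
  have -> : B ^+ 2 / (M * A ^+ n) = (2 * A ^+ n.+1)^-1.
    have aux (a b : R) : a != 0 -> b != 0 ->
        b ^+ 2 / (2 * b ^+ 2 * a * a ^+ n) = (2 * (a * a ^+ n))^-1.
      by move=> u0 v0; field; rewrite u0 v0 expf_neq0.
    by rewrite [A ^+ n.+1]exprS; apply: aux; exact: lt0r_neq0.
  have aux (a b d : R) : a != 0 ->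
      b * d / a = b * ((2 * a)^-1 * d) + b * ((2 * a)^-1 * d).
    by move=> u0; field.
  by apply: aux; rewrite expf_neq0// lt0r_neq0.
have G0 : 0 <= G x by apply: le_trans (key c c' Hc H1).
split; rewrite /= (le_trans (ler_normB _ _))// !normrM lerD// ler_pM//.
- exact: H3.
- exact: key Hc H1.
- exact: H1.
- exact: key Hs H3.
- exact: H4.
- exact: key Hc H1.
- exact: H2.
- exact: key Hs H3.
Qed.

(** With w n = lam^n this would be a power series in lam. Arbitrary real weights allow the real and
    imaginary parts of lam^n to be inserted separately; all weights equal to 1 give the existence of
    real solutions. *)
Definition pert_sum (w : nat -> R) x := sum_series (fun n => w n * pert n x).
Definition pert_sum' (w : nat -> R) x := sum_series (fun n => w n * pert' n x).

(** Since [K] depends on neither [w] nor [x], weights taken from lam^n with |lam| at most [A] give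
    uniform convergence on a disc. *)
Lemma pert_sum_approx (A C : R) : 0 < A -> 0 <= C -> exists K : R, forall w,
  (forall n, `|w n| <= C * A ^+ n) -> forall x, 0 <= x -> x <= 1 -> forall N,
  `|pert_sum w x - \sum_(i < N) w i * pert i x| <= K / 2 ^+ N /\
  `|pert_sum' w x - \sum_(i < N) w i * pert' i x| <= K / 2 ^+ N.
Proof.
move=> A0 C0; have A20 : 0 < 2 * A by rewrite mulr_gt0.
(* Terms bounded by a multiple of (2 A)^-n absorb the growth A^n of the weights and leave 2^-n. *)
have [K K0 HK] := pert_bound A20.
exists (2 * (C * K)) => w Hw x x0 x1 N.
have est (f : nat -> R) : (forall n, `|f n| <= K / (2 * A) ^+ n) ->
    forall n, `|w n * f n| <= C * K / 2 ^+ n.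
  move=> hf n; rewrite normrM (le_trans (ler_pM _ _ (Hw n) (hf n)))//.
  rewrite exprMn le_eqVlt; apply/orP; left; apply/eqP.
  by field; rewrite ?expf_neq0 ?pnatr_eq0// gt_eqF.
split; apply: sum_series_bound; apply: est => n; by have [] := HK n x x0 x1.
Qed.

Section Weights.
Variables (w : nat -> R) (A C : R).
Hypothesis A0 : 0 < A.
Hypothesis C0 : 0 <= C.
Hypothesis Hw : forall n, `|w n| <= C * A ^+ n.
Let w1 n := w n.+1.
Let Y := pert_sum w1.

Lemma weight_shift n : `|w1 n| <= (C * A) * A ^+ n.
Proof. by rewrite -mulrA -exprS; exact: Hw. Qed.

Lemma pert_sum_reg : exists K : R, [/\ measurable_fun (`[0, 1] : set R) Y,
  forall x, 0 <= x -> x <= 1 -> `|Y x| <= K &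
  forall x, 0 <= x -> x <= 1 -> forall N,
   `|Y x - \sum_(i < N) w1 i * pert i x| <= K / 2 ^+ N].
Proof.
have CA0 : 0 <= C * A by rewrite mulr_ge0// ltW.
have [K HK] := pert_sum_approx A0 CA0.
have {}HK x x0 x1 N := proj1 (HK w1 weight_shift x x0 x1 N).
exists K; split => //; last first.
  by move=> x x0 x1; have := HK x x0 x1 0%N; rewrite big_ord0 subr0 divr1.
apply: (measurable_fun_cvg (h := fun N x => \sum_(i < N) w1 i * pert i x)).
  move=> N; have h i := acZ (w1 i) (ac_pert i).
  exact: ac_measurable (ac_sum N h).
move=> x /=; rewrite in_itv /= => /andP[x0 x1].
apply/cvgrPdist_le => e e0.
have K0 : 0 <= K by have := HK x x0 x1 0%N; rewrite divr1; apply: le_trans.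
have : (fun n => geometric K (2^-1 : R) n) @ \oo --> (0 : R).
  by apply: cvg_geometric; rewrite ger0_norm ?invr_ge0// invf_lt1// ltr1n.
move=> /cvgrPdist_le /(_ e e0) [N _ HN]; exists N => // n /= Nn.
apply: (le_trans (HK x x0 x1 n)); have := HN n Nn.
by rewrite /= sub0r normrN /geometric /= exprVn ger0_norm// divr_ge0// exprn_ge0.
Qed.

Lemma L1_pert_sum e e' : ac 0 1 e e' -> L1_01 (fun t => e t * (Y t * rho t)).
Proof.
move=> He; have [K [mY bY _]] := pert_sum_reg.
by apply: (L1_acM He); exact: L1_bounded_mul bY irho.
Qed.

Lemma prim_pert_sum e e' : ac 0 1 e e' -> exists K : R, forall x, 0 <= x -> x <= 1 ->
  forall N, `|prim (fun t => e t * (Y t * rho t)) x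
     - \sum_(i < N) w1 i * prim (fun t => e t * (pert i t * rho t)) x| <= K / 2 ^+ N.
Proof.
move=> He; have [K [mY bY aY]] := pert_sum_reg; have [B B0 HB] := ac_bounded He.
have irn := L1_norm irho.
have K0 : 0 <= K by apply: le_trans (bY 0 _ _).
pose P := prim (fun t => `|rho t|).
exists (B * K * P 1) => x x0 x1 N.
have HD := acB (ac_prim (L1_pert_sum He))
  (ac_sum N (fun i => acZ (w1 i) (ac_prim (L1_pert (ac_pert i) He)))).
have HG := acZ (B * (K / 2 ^+ N)) (ac_prim irn).
set D := (X in ac 0 1 X _) in HD.
have D0 : D 0 = 0.
  by rewrite /D prim0 sub0r big1 ?oppr0// => i _; rewrite prim0 mulr0.
rewrite -[X in `|X|]/(D x) -[D x]subr0 -D0.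
apply: (le_trans (ac_norm_leD x0 (ac_sub (lexx 0) x1 HD) (ac_sub (lexx 0) x1 HG) _)); last first.
  rewrite prim0 mulr0 subr0.
  have -> : B * K * P 1 / 2 ^+ N = B * (K / 2 ^+ N) * P 1 by ring.
  apply: ler_wpM2l; last exact: prim_le1.
  by rewrite mulr_ge0 ?divr_ge0 ?exprn_ge0// ltW.
apply: aeW => t; rewrite in_itv /= => /andP[/ltW t0 tx].
have t1 : t <= 1 by rewrite (le_trans (ltW tx)).
have -> : e t * (Y t * rho t) - \sum_(i < N) w1 i * (e t * (pert i t * rho t)) =
    e t * (Y t - \sum_(i < N) w1 i * pert i t) * rho t.
  rewrite mulrBr mulrBl mulr_sumr mulr_suml; congr (_ - _); first by ring.
  by apply: eq_bigr => i _; ring.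
rewrite !normrM ler_wpM2r// ler_pM//; first exact: HB.
exact: aY.
Qed.

(** Serves [pert_sum] and [pert_sum'] alike, whose terms differ only in the first one and in the
    outer factors [e1] and [e2]. *)
Lemma pert_sum_gen (F : nat -> R -> R) (f0 e1 e2 : R -> R) x :
  F 0%N = f0 -> (forall n x, F n.+1 x = e1 x * prim (fun t => c t * (pert n t * rho t)) x
     - e2 x * prim (fun t => s t * (pert n t * rho t)) x) -> 0 <= x -> x <= 1 ->
  sum_series (fun n => w n * F n x) = w 0%N * f0 x +
    (e1 x * prim (fun t => c t * (Y t * rho t)) x - e2 x * prim (fun t => s t * (Y t * rho t)) x).
Proof.
move=> F0 FS x0 x1.
have [K1 H1] := prim_pert_sum Hc; have [K2 H2] := prim_pert_sum Hs.
set S1 := prim _ x; set S2 := prim _ x.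
pose L := w 0%N * f0 x + (e1 x * S1 - e2 x * S2); rewrite -/L.
pose K := `|L| + 2 * (`|e1 x| * K1 + `|e2 x| * K2).
have {}H1 := H1 x x0 x1; have {}H2 := H2 x x0 x1.
have K10 : 0 <= K1 by have := H1 0%N; rewrite divr1; apply: le_trans.
have K20 : 0 <= K2 by have := H2 0%N; rewrite divr1; apply: le_trans.
apply: (@sum_series_unique _ _ _ K); case=> [|N].
  rewrite big_ord0 subr0 divr1 /K lerDl mulr_ge0// addr_ge0// mulr_ge0//.
rewrite big_ord_recl /= F0.
under eq_bigr => i _ do rewrite /bump /= add1n FS.
have -> : L - (w 0%N * f0 x + \sum_(i < N) w i.+1 *
    (e1 x * prim (fun t => c t * (pert i t * rho t)) x -
     e2 x * prim (fun t => s t * (pert i t * rho t)) x)) =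
   e1 x * (S1 - \sum_(i < N) w1 i * prim (fun t => c t * (pert i t * rho t)) x) -
   e2 x * (S2 - \sum_(i < N) w1 i * prim (fun t => s t * (pert i t * rho t)) x).
  rewrite (_ : \sum_(i < N) w i.+1 * _ =
     e1 x * (\sum_(i < N) w1 i * prim (fun t => c t * (pert i t * rho t)) x) -
     e2 x * (\sum_(i < N) w1 i * prim (fun t => s t * (pert i t * rho t)) x)).
    by rewrite /L; ring.
  by rewrite !mulr_sumr -sumrB; apply: eq_bigr => i _; rewrite /w1; ring.
rewrite (le_trans (ler_normB _ _))// !normrM.
apply: (@le_trans _ _ (`|e1 x| * (K1 / 2 ^+ N) + `|e2 x| * (K2 / 2 ^+ N))).
  by rewrite lerD// ler_wpM2l.
have -> : `|e1 x| * (K1 / 2 ^+ N) + `|e2 x| * (K2 / 2 ^+ N) =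
   (2 * (`|e1 x| * K1 + `|e2 x| * K2)) / 2 ^+ N.+1.
  have aux (a b d : R) : d != 0 -> a / d + b / d = 2 * (a + b) / (2 * d).
    by move=> ?; field.
  by rewrite [2 ^+ N.+1]exprS -aux ?expf_neq0// !mulrA.
by rewrite ler_wpM2r ?invr_ge0 ?exprn_ge0// /K lerDr.
Qed.

(** The equation involves the sum with the shifted weights [w1]. For powers of lam the shift is
    multiplication by lam, and the equation closes. *)
Theorem pert_solution :
  [/\ ac 0 1 (pert_sum w) (pert_sum' w),
      ac 0 1 (pert_sum' w) (fun x => r x * pert_sum w x + rho x * pert_sum w1 x),
      pert_sum w 0 = w 0%N * a0 0 & pert_sum' w 0 = w 0%N * a0' 0].
Proof.
pose P1 := prim (fun t => c t * (Y t * rho t)).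
pose P2 := prim (fun t => s t * (Y t * rho t)).
have E x : 0 <= x -> x <= 1 -> pert_sum w x = w 0%N * a0 x + (s x * P1 x - c x * P2 x).
  by move=> x0 x1; apply: (pert_sum_gen (F := pert)).
have E' x : 0 <= x -> x <= 1 -> pert_sum' w x = w 0%N * a0' x + (s' x * P1 x - c' x * P2 x).
  by move=> x0 x1; apply: (pert_sum_gen (F := pert')).
have h1 : ac 0 1 P1 (fun t => c t * (Y t * rho t)) by apply/ac_prim/(L1_pert_sum Hc).
have h2 : ac 0 1 P2 (fun t => s t * (Y t * rho t)) by apply/ac_prim/(L1_pert_sum Hs).
split.
- apply: (ac_eqf (fun x x0 x1 => esym (E x x0 x1))).
  have := acD (acZ (w 0%N) Ha) (acB (acM Hs h1) (acM Hc h2)).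
  apply: ac_eq_deriv => x; rewrite in_itv /= => /andP[/ltW x0 /ltW x1].
  by rewrite E'//; ring.
- apply: (ac_eqf (fun x x0 x1 => esym (E' x x0 x1))).
  have := acD (acZ (w 0%N) Ha') (acB (acM Hs' h1) (acM Hc' h2)).
  apply: ac_eq_deriv => x; rewrite in_itv /= => /andP[/ltW x0 /ltW x1].
  (* Differentiating the two integrals produces rho Y times the Wronskian of [c] and [s], which is
     1. *)
  rewrite E// -/Y -[rho x * Y x]mul1r -(wr x0 x1); ring.
- by rewrite E// /P1 /P2 !prim0 !mulr0 subrr addr0.
- by rewrite E'// /P1 /P2 !prim0 !mulr0 subrr addr0.
Qed.

End Weights.
End Perturbation.

Import Normc.
Local Notation Re := (@complex.Re _).
Local Notation Im := (@complex.Im _).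

(** * Complex solutions and their dependence on the spectral parameter *)

Section ComplexSolutions.
Variable R : realType.
Local Notation C := R[i]%C.
Local Notation "x %:C" := (Complex x 0 : C).

Lemma norm_Re_le (z : C) : `|Re z| <= normc z.
Proof.
case: z => a b /=; rewrite -sqrtr_sqr ler_sqrt ?sqr_ge0 ?addr_ge0 ?sqr_ge0//.
by rewrite lerDl sqr_ge0.
Qed.

Lemma norm_Im_le (z : C) : `|Im z| <= normc z.
Proof.
case: z => a b /=; rewrite -sqrtr_sqr ler_sqrt ?sqr_ge0 ?addr_ge0 ?sqr_ge0//.
by rewrite lerDr sqr_ge0.
Qed.

Lemma normc_le (z : C) : normc z <= `|Re z| + `|Im z|.
Proof.
case: z => a b /=; rewrite -[leRHS]ger0_norm ?addr_ge0// -sqrtr_sqr ler_sqrt ?sqr_ge0//.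
rewrite sqrrD !real_normK ?num_real// addrAC lerDl mulrn_wge0// mulr_ge0//.
Qed.

Lemma normc_ge0 (z : C) : 0 <= normc z.
Proof. by case: z => a b; exact: sqrtr_ge0. Qed.

Lemma normcX (z : C) n : normc (z ^+ n) = normc z ^+ n.
Proof. by elim: n => [|n IH]; rewrite ?expr0 ?normc1// !exprS normcM IH. Qed.

Lemma normc_real (x : R) : normc x%:C = `|x|.
Proof. by rewrite /= expr0n /= addr0 sqrtr_sqr. Qed.

Lemma normc_sum (I : Type) (r : seq I) (F : I -> C) :
  normc (\sum_(i <- r) F i) <= \sum_(i <- r) normc (F i).
Proof.
elim: r => [|i r IH]; first by rewrite !big_nil normc0.
by rewrite !big_cons (le_trans (le_normcD _ _))// lerD2l.
Qed.

Lemma normc_prod (I : Type) (r : seq I) (P : pred I) (F : I -> C) :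
  normc (\prod_(i <- r | P i) F i) = \prod_(i <- r | P i) normc (F i).
Proof. by apply: (big_morph (@normc R)) => [x y|]; rewrite ?normcM ?normc1. Qed.

Lemma normc_eq0 (z : C) : (normc z == 0) = (z == 0).
Proof. by apply/eqP/eqP => [/eq0_normc|->]; rewrite ?normc0. Qed.

Definition cac (a b : R) (f f' : R -> C) : Prop :=
  ac a b (fun x => Re (f x)) (fun x => Re (f' x)) /\
  ac a b (fun x => Im (f x)) (fun x => Im (f' x)).

Definition csol (q : R -> R) (lam : C) (y z : R -> C) : Prop :=
  cac 0 1 y z /\ cac 0 1 z (fun x => ((q x)%:C - lam) * y x).

(* Stands in for entire functions: locally uniform limits of polynomials. *)
Definition poly_approx (f : C -> C) : Prop :=
  forall rho e : R, 0 < e -> exists P : {poly C}, forall lam : C,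
    normc lam <= rho -> normc (f lam - P.[lam]) <= e.

Lemma cac_eq_deriv a b f f' g' : (forall x, x \in `]a, b[ -> f' x = g' x) ->
  cac a b f f' -> cac a b f g'.
Proof. by move=> e [A B]; split; [move: A|move: B]; apply: ac_eq_deriv => x /e ->. Qed.

Lemma cacD a b f g f' g' : cac a b f f' -> cac a b g g' ->
  cac a b (fun x => f x + g x) (fun x => f' x + g' x).
Proof.
move=> [F1 F2] [G1 G2]; split.
  have := acD F1 G1; congr ac; apply/funext => x; first by case: (f x); case: (g x).
  by case: (f' x); case: (g' x).
have := acD F2 G2; congr ac; apply/funext => x; first by case: (f x); case: (g x).
by case: (f' x); case: (g' x).
Qed.

Lemma cacN a b f f' : cac a b f f' -> cac a b (fun x => - f x) (fun x => - f' x).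
Proof.
move=> [F1 F2]; split.
  by have := acN F1; congr ac; apply/funext => x; [case: (f x)|case: (f' x)].
by have := acN F2; congr ac; apply/funext => x; [case: (f x)|case: (f' x)].
Qed.

Lemma cacB a b f g f' g' : cac a b f f' -> cac a b g g' ->
  cac a b (fun x => f x - g x) (fun x => f' x - g' x).
Proof. by move=> F G; apply: cacD => //; exact: cacN. Qed.

Lemma cacM a b f g f' g' : cac a b f f' -> cac a b g g' ->
  cac a b (fun x => f x * g x) (fun x => f' x * g x + f x * g' x).
Proof.
move=> [F1 F2] [G1 G2]; split.
  have := acB (acM F1 G1) (acM F2 G2); congr ac; apply/funext => x.
    by case: (f x); case: (g x).
  by case: (f x); case: (g x); case: (f' x); case: (g' x) => * /=; ring.
have := acD (acM F1 G2) (acM F2 G1); congr ac; apply/funext => x.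
  by case: (f x) => ? ?; case: (g x) => ? ? /=; ring.
by case: (f x); case: (g x); case: (f' x); case: (g' x) => * /=; ring.
Qed.

Lemma cac_cst a b (k : C) : cac a b (fun=> k) (fun=> 0).
Proof. by split; exact: ac_cst. Qed.

Lemma cacZ a b (k : C) f f' : cac a b f f' -> cac a b (fun x => k * f x) (fun x => k * f' x).
Proof.
move=> F; have := cacM (cac_cst a b k) F.
by apply: cac_eq_deriv => x _; rewrite mul0r add0r.
Qed.

Lemma cac_sub a b c d f f' : a <= c -> d <= b -> cac a b f f' -> cac c d f f'.
Proof. by move=> h1 h2 [A B]; split; [exact: ac_sub A|exact: ac_sub B]. Qed.

Lemma exists_half_pow (K e : R) : 0 < e -> exists N, K / 2 ^+ N <= e.
Proof.
move=> e0.
have : (fun n => geometric `|K| (2^-1 : R) n) @ \oo --> (0 : R).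
  by apply: cvg_geometric; rewrite ger0_norm ?invr_ge0// invf_lt1// ltr1n.
move=> /cvgrPdist_le /(_ e e0) [N _ HN]; exists N.
have := HN N (leqnn N); rewrite /= sub0r normrN /geometric /= exprVn => h.
apply: le_trans h; apply: le_trans (ler_norm _).
by rewrite ler_wpM2r ?invr_ge0 ?exprn_ge0// ler_norm.
Qed.

Lemma horner_real_coef (f : nat -> R) (lam : C) (u v b : R) N :
  `|u - \sum_(i < N) Re (lam ^+ i) * f i| <= b ->
  `|v - \sum_(i < N) Im (lam ^+ i) * f i| <= b ->
  normc (Complex u v - (\sum_(i < N) (f i)%:C *: 'X^i).[lam]) <= 2 * b.
Proof.
move=> h1 h2; rewrite horner_sum; under eq_bigr => i _ do rewrite hornerZ hornerXn.
have -> : \sum_(i < N) (f i)%:C * lam ^+ i =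
    Complex (\sum_(i < N) Re (lam ^+ i) * f i) (\sum_(i < N) Im (lam ^+ i) * f i).
  elim: N {h1 h2} => [|M IH]; first by rewrite !big_ord0.
  rewrite !big_ord_recr IH /=; case: (_ ^+ M) => x y /=.
  by apply/eqP; rewrite eq_complex /=; apply/andP; split; apply/eqP; ring.
by apply: le_trans (normc_le _) _; rewrite mulr_natl mulr2n; exact: lerD h1 h2.
Qed.

(* The two real power series below are the real and imaginary parts of a single
   power series in lam with real coefficients. *)
Lemma csol_family (q c c' s s' a0 a0' : R -> R) : L1_01 q ->
  ac 0 1 c c' -> ac 0 1 c' (fun x => q x * c x) ->
  ac 0 1 s s' -> ac 0 1 s' (fun x => q x * s x) ->
  (forall x, 0 <= x -> x <= 1 -> c x * s' x - c' x * s x = 1) ->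
  ac 0 1 a0 a0' -> ac 0 1 a0' (fun x => q x * a0 x) ->
  exists Y Z : C -> R -> C, [/\
    forall lam, csol q lam (Y lam) (Z lam),
    forall lam, Y lam 0 = (a0 0)%:C /\ Z lam 0 = (a0' 0)%:C,
    forall x, 0 <= x -> x <= 1 -> poly_approx (Y ^~ x) &
    forall x, 0 <= x -> x <= 1 -> poly_approx (Z ^~ x)].
Proof.
move=> iq Hc Hc' Hs Hs' wr Ha Ha'.
have irho := L1_cst (-1 : R).
pose wre (lam : C) n := Re (lam ^+ n); pose wim (lam : C) n := Im (lam ^+ n).
have wreb lam A : normc lam <= A -> forall n, `|wre lam n| <= 1 * A ^+ n.
  move=> lA n; rewrite mul1r (le_trans (norm_Re_le _))// normcX.
  by rewrite lerXn2r// ?nnegrE ?normc_ge0// (le_trans (normc_ge0 _) lA).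
have wimb lam A : normc lam <= A -> forall n, `|wim lam n| <= 1 * A ^+ n.
  move=> lA n; rewrite mul1r (le_trans (norm_Im_le _))// normcX.
  by rewrite lerXn2r// ?nnegrE ?normc_ge0// (le_trans (normc_ge0 _) lA).
have A0 lam : 0 < normc lam + 1 :> R by rewrite ltr_wpDl// normc_ge0.
have lA lam : normc lam <= normc lam + 1 :> R by rewrite lerDl.
pose ps := pert_sum c s (fun=> -1) a0.
pose ps' := pert_sum' c c' s s' (fun=> -1) a0 a0'.
pose Y (lam : C) x := Complex (ps (wre lam) x) (ps (wim lam) x).
pose Z (lam : C) x := Complex (ps' (wre lam) x) (ps' (wim lam) x).
have solre lam := pert_solution Hc Hc' Hs Hs' wr irho Ha Ha' (A0 lam) ler01 (wreb _ _ (lA lam)).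
have solim lam := pert_solution Hc Hc' Hs Hs' wr irho Ha Ha' (A0 lam) ler01 (wimb _ _ (lA lam)).
have approx (A : R) : 0 < A -> _ := fun h => pert_sum_approx Hc Hc' Hs Hs' irho Ha Ha' h ler01.
(* Multiplication by lam acts on the real and imaginary parts of lam^n as a real 2 by 2 matrix,
   which expresses the shifted sums through the unshifted ones. *)
have lin lam x : 0 <= x -> x <= 1 ->
  ps (fun n => wre lam n.+1) x = Re lam * ps (wre lam) x - Im lam * ps (wim lam) x /\
  ps (fun n => wim lam n.+1) x = Im lam * ps (wre lam) x + Re lam * ps (wim lam) x.
  move=> x0 x1; have [K HK] := approx _ (A0 lam).
  have h1 N := proj1 (HK _ (wreb _ _ (lA lam)) x x0 x1 N).
  have h2 N := proj1 (HK _ (wimb _ _ (lA lam)) x x0 x1 N).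
  have S1 n : wre lam n.+1 = Re lam * wre lam n - Im lam * wim lam n.
    by rewrite /wre /wim exprS; case: (lam) => a b; case: (_ ^+ n).
  have S2 n : wim lam n.+1 = Im lam * wre lam n + Re lam * wim lam n.
    by rewrite /wre /wim exprS; case: (lam) => a b; case: (_ ^+ n) => * /=; rewrite addrC.
  split; apply: (@sum_series_unique _ _ _ (`|Re lam| * K + `|Im lam| * K)) => N.
    under eq_bigr => i _ do rewrite S1 mulrBl -!mulrA.
    rewrite sumrB -!mulr_sumr; set u := \sum_(_ < _) _; set v := \sum_(_ < _) _.
    have -> : forall a b y z : R, a * y - b * z - (a * u - b * v) = a * (y - u) - b * (z - v).
      by move=> a b y z; ring.
    rewrite (le_trans (ler_normB _ _))// !normrM mulrDl -!mulrA.
    by apply: lerD; apply: ler_wpM2l => //; [exact: h1 | exact: h2].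
  under eq_bigr => i _ do rewrite S2 mulrDl -!mulrA.
  rewrite big_split -!mulr_sumr /=; set u := \sum_(_ < _) _; set v := \sum_(_ < _) _.
  have -> : forall a b y z : R, b * y + a * z - (b * u + a * v) = a * (z - v) + b * (y - u).
    by move=> a b y z; ring.
  rewrite (le_trans (ler_normD _ _))// !normrM mulrDl -!mulrA.
  by apply: lerD; apply: ler_wpM2l => //; [exact: h2 | exact: h1].
exists Y, Z; split.
- move=> lam; have [r1 r2 _ _] := solre lam; have [i1 i2 _ _] := solim lam.
  split; first by split.
  split.
    apply: ac_eq_deriv r2 => x; rewrite in_itv /= => /andP[/ltW x0 /ltW x1].
    have [E _] := lin lam x x0 x1; rewrite /ps in E; rewrite E /Y /ps /=.
    by move: (pert_sum _ _ _ _ _ _) (pert_sum _ _ _ _ _ _); case: (lam) => a b y z /=; ring.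
  apply: ac_eq_deriv i2 => x; rewrite in_itv /= => /andP[/ltW x0 /ltW x1].
  have [_ E] := lin lam x x0 x1; rewrite /ps in E; rewrite E /Y /ps /=.
  by move: (pert_sum _ _ _ _ _ _) (pert_sum _ _ _ _ _ _); case: (lam) => a b y z /=; ring.
- move=> lam; have [_ _ r3 r4] := solre lam; have [_ _ i3 i4] := solim lam.
  rewrite /Y /Z /ps /ps' r3 r4 i3 i4 /wre /wim expr0 /=.
  by rewrite !mul1r !mul0r.
- move=> x x0 x1 rho e e0.
  have Ar : 0 < `|rho| + 1 by rewrite ltr_wpDl.
  have [K HK] := approx _ Ar; have [N HN] := exists_half_pow (2 * K) e0.
  exists (\sum_(i < N) (pert c s (fun=> -1) a0 i x)%:C *: 'X^i) => lam lrho.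
  have lb : normc lam <= `|rho| + 1.
    by rewrite (le_trans lrho)// (le_trans (ler_norm _))// lerDl.
  have h1 := proj1 (HK _ (wreb _ _ lb) x x0 x1 N).
  have h2 := proj1 (HK _ (wimb _ _ lb) x x0 x1 N).
  rewrite -mulrA in HN; apply: le_trans HN.
  exact: (@horner_real_coef (fun i => pert c s (fun=> -1) a0 i x) lam _ _ _ N h1 h2).
- move=> x x0 x1 rho e e0.
  have Ar : 0 < `|rho| + 1 by rewrite ltr_wpDl.
  have [K HK] := approx _ Ar; have [N HN] := exists_half_pow (2 * K) e0.
  exists (\sum_(i < N) (pert' c c' s s' (fun=> -1) a0 a0' i x)%:C *: 'X^i) => lam lrho.
  have lb : normc lam <= `|rho| + 1.
    by rewrite (le_trans lrho)// (le_trans (ler_norm _))// lerDl.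
  have h1 := proj2 (HK _ (wreb _ _ lb) x x0 x1 N).
  have h2 := proj2 (HK _ (wimb _ _ lb) x x0 x1 N).
  rewrite -mulrA in HN; apply: le_trans HN.
  exact: (@horner_real_coef (fun i => pert' c c' s s' (fun=> -1) a0 a0' i x) lam _ _ _ N h1 h2).
Qed.

(** The same series with y'' = 0 as the unperturbed equation, [q] as the perturbation and all
    weights 1. *)
Lemma real_solution (q : R -> R) (al be : R) : L1_01 q -> exists y z : R -> R,
  [/\ ac 0 1 y z, ac 0 1 z (fun x => q x * y x), y 0 = al & z 0 = be].
Proof.
move=> iq.
have H0 : ac 0 1 (fun=> 0) (fun x : R => 0 * 1) by apply: ac_eq_deriv (ac_cst 0 1 0) => x; rewrite mul0r.
have H1 (k : R) : ac 0 1 (fun=> k) (fun x : R => 0 * id x).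
  by apply: ac_eq_deriv (ac_cst 0 1 k) => x; rewrite mul0r.
have wr (x : R) : 0 <= x -> x <= 1 -> 1 * 1 - 0 * id x = 1 by rewrite mul0r subr0 mulr1.
have Ha : ac 0 1 (fun x => al + be * x) (fun=> be).
  by apply: ac_eq_deriv (acD (ac_cst 0 1 al) (acZ be (ac_id 0 1))) => x _; rewrite mulr1 add0r.
have Ha' : ac 0 1 (fun=> be) (fun x => 0 * (al + be * x)).
  by apply: ac_eq_deriv (ac_cst 0 1 be) => x; rewrite mul0r.
have w1 n : `|(1 : R)| <= 1 * 1 ^+ n by rewrite expr1n mulr1 normr1.
have [h1 h2 h3 h4] := pert_solution (ac_cst 0 1 1) H0 (ac_id 0 1) (H1 1) wr iq Ha Ha' ltr01 ler01 w1.
eexists; eexists; split; [exact: h1| |by rewrite h3 mul1r mulr0 addr0|by rewrite h4 mul1r].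
by apply: ac_eq_deriv h2 => x _; rewrite mul0r add0r.
Qed.

(** The real solutions at lam = 0, of Wronskian 1, are the starting terms of the expansion in
    lam. *)
Theorem fundamental_system (q : R -> R) : L1_01 q ->
  exists c c' s s' : C -> R -> C, [/\
    forall lam, csol q lam (c lam) (c' lam),
    forall lam, csol q lam (s lam) (s' lam),
    forall lam, [/\ c lam 0 = 1, c' lam 0 = 0, s lam 0 = 0 & s' lam 0 = 1] &
    forall x, 0 <= x -> x <= 1 -> [/\ poly_approx (c ^~ x), poly_approx (c' ^~ x),
       poly_approx (s ^~ x) & poly_approx (s' ^~ x)]].
Proof.
move=> iq.
have [c [c' [c1 c2 c3 c4]]] := real_solution 1 0 iq.
have [s [s' [s1 s2 s3 s4]]] := real_solution 0 1 iq.
have wr x : 0 <= x -> x <= 1 -> c x * s' x - c' x * s x = 1.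
  move=> x0 x1.
  have := acB (acM c1 s2) (acM c2 s1) => /ac_const_ae H.
  rewrite (H _ x 0)// ?c3 ?s3 ?c4 ?s4 ?mul1r ?mul0r ?subr0//.
  by apply: aeW => t _; ring.
have [Y [Z [h1 h2 h3 h4]]] := csol_family iq c1 c2 s1 s2 wr c1 c2.
have [Y' [Z' [g1 g2 g3 g4]]] := csol_family iq c1 c2 s1 s2 wr s1 s2.
exists Y, Z, Y', Z'; split => //.
- by move=> lam; have [-> ->] := h2 lam; have [-> ->] := g2 lam; rewrite c3 c4 s3 s4.
- by move=> x x0 x1; split; auto.
Qed.

End ComplexSolutions.

(** * Growth of solutions *)

Lemma norm_le_sumdiff (R : realType) (a b : R) : 0 <= b + a -> 0 <= b - a -> `|a| <= b.
Proof. by move=> h1 h2; rewrite ler_norml; apply/andP; split; lra. Qed.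

Section Energy.
Variable R : realType.
Variables (q yr yi zr zi : R -> R) (k t m : R).
Hypothesis iq : L1_01 q.
Hypothesis Hyr : ac 0 1 yr zr.
Hypothesis Hyi : ac 0 1 yi zi.
Hypothesis Hzr : ac 0 1 zr (fun x => (q x - (k ^+ 2 - t ^+ 2)) * yr x + 2 * k * t * yi x).
Hypothesis Hzi : ac 0 1 zi (fun x => (q x - (k ^+ 2 - t ^+ 2)) * yi x - 2 * k * t * yr x).
Hypothesis t0 : 0 <= t.
Hypothesis m0 : 0 < m.
Hypothesis m2 : m ^+ 2 = k ^+ 2 + t ^+ 2.

Definition energy x := zr x ^+ 2 + zi x ^+ 2 + m ^+ 2 * (yr x ^+ 2 + yi x ^+ 2).
(* 2 Im (conj z * (k + i t) * y): its derivative is 2 t energy up to terms in q. *)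
Definition flux x := 2 * (zr x * (k * yi x + t * yr x) - zi x * (k * yr x - t * yi x)).

Let denergy x := 2 * t * flux x + 2 * q x * (zr x * yr x + zi x * yi x).
Let dflux x := 2 * t * energy x + 2 * q x * t * (yr x ^+ 2 + yi x ^+ 2).

Lemma ac_energy : ac 0 1 energy denergy.
Proof.
have := acD (acD (acM Hzr Hzr) (acM Hzi Hzi)) (acZ (m ^+ 2) (acD (acM Hyr Hyr) (acM Hyi Hyi))).
have -> : (fun x => zr x * zr x + zi x * zi x + m ^+ 2 * (yr x * yr x + yi x * yi x)) = energy.
  by apply/funext => x; rewrite /energy !expr2.
apply: ac_eq_deriv => x _; rewrite /denergy /flux m2; ring.
Qed.

Lemma ac_flux : ac 0 1 flux dflux.
Proof.
have := acZ 2 (acB (acM Hzr (acD (acZ k Hyi) (acZ t Hyr))) (acM Hzi (acB (acZ k Hyr) (acZ t Hyi)))).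
apply: ac_eq_deriv => x _; rewrite /dflux /energy m2; ring.
Qed.

Lemma energy_ge0 x : 0 <= energy x.
Proof.
apply: addr_ge0; first by apply: addr_ge0; exact: sqr_ge0.
by apply: mulr_ge0; [exact: sqr_ge0 | apply: addr_ge0; exact: sqr_ge0].
Qed.

(** With K = k + i t, [energy] plus and minus [flux] are |z - i K y|^2 and |z + i K y|^2. For q = 0
    these belong to the exponentials of modulus exp (t x) and exp (- t x). *)
Lemma flux_le x : `|flux x| <= energy x.
Proof.
have h1 : energy x + flux x = (zr x + (k * yi x + t * yr x)) ^+ 2 + (zi x - (k * yr x - t * yi x)) ^+ 2.
  by rewrite /energy /flux m2; ring.
have h2 : energy x - flux x = (zr x - (k * yi x + t * yr x)) ^+ 2 + (zi x + (k * yr x - t * yi x)) ^+ 2.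
  by rewrite /energy /flux m2; ring.
by apply: norm_le_sumdiff; rewrite ?h1 ?h2; apply: addr_ge0; exact: sqr_ge0.
Qed.

Lemma cross_le x : `|2 * (zr x * yr x + zi x * yi x)| <= energy x / m.
Proof.
rewrite ler_pdivlMr// -[X in _ * X <= _](gtr0_norm m0) -normrM.
have h1 : energy x + 2 * (zr x * yr x + zi x * yi x) * m =
   (zr x + m * yr x) ^+ 2 + (zi x + m * yi x) ^+ 2 by rewrite /energy; ring.
have h2 : energy x - 2 * (zr x * yr x + zi x * yi x) * m =
   (zr x - m * yr x) ^+ 2 + (zi x - m * yi x) ^+ 2 by rewrite /energy; ring.
by apply: norm_le_sumdiff; rewrite ?h1 ?h2; apply: addr_ge0; exact: sqr_ge0.
Qed.

Lemma denergy_le x : `|denergy x| <= (2 * t + `|q x| / m) * energy x.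
Proof.
rewrite /denergy (le_trans (ler_normD _ _))// [leRHS]mulrDl lerD//.
  by rewrite normrM ger0_norm ?mulr_ge0// ler_wpM2l ?mulr_ge0 ?flux_le.
have -> : 2 * q x * (zr x * yr x + zi x * yi x) = q x * (2 * (zr x * yr x + zi x * yi x)) by ring.
rewrite normrM -[leRHS]mulrA; apply: ler_wpM2l => //.
by rewrite [leRHS]mulrC; exact: cross_le.
Qed.

Let P := prim (fun x => `|q x|).
Let HP : ac 0 1 P (fun x => `|q x|) := ac_prim (L1_norm iq).

(** Gronwall's argument: the energy times the integrating factor decreases. The potential enters
    only with the factor 1 / m. *)
Lemma energy_up x0 x : 0 <= x0 -> x0 <= x -> x <= 1 ->
  energy x <= energy x0 * expR (2 * t * (x - x0) + (P x - P x0) / m).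
Proof.
move=> x00 x0x x1.
have HG : ac 0 1 (fun x => - (2 * t * x + m^-1 * P x)) (fun x => - (2 * t * 1 + m^-1 * `|q x|)).
  by apply: acN; apply: acD; [apply: acZ; exact: ac_id | exact: acZ].
have := ac_le_ae x0x (ac_sub x00 x1 (acM ac_energy (ac_exp HG))).
move/(_ _) => H.
have {H} : energy x * expR (- (2 * t * x + m^-1 * P x)) <= energy x0 * expR (- (2 * t * x0 + m^-1 * P x0)).
  apply: H; apply: aeW => s _.
  have -> : denergy s * expR (- (2 * t * s + m^-1 * P s)) + energy s *
     (expR (- (2 * t * s + m^-1 * P s)) * - (2 * t * 1 + m^-1 * `|q s|)) =
     expR (- (2 * t * s + m^-1 * P s)) * (denergy s - (2 * t + `|q s| / m) * energy s) by ring.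
  rewrite mulr_ge0_le0 ?expR_ge0// subr_le0.
  exact: le_trans (ler_norm _) (denergy_le s).
rewrite [X in _ <= _ * expR X -> _](_ : _ = (2 * t * (x - x0) + (P x - P x0) / m) +
   (- (2 * t * x + m^-1 * P x))); last by ring.
by rewrite expRD mulrA ler_pM2r ?expR_gt0.
Qed.

Lemma energy_down x x0 : 0 <= x -> x <= x0 -> x0 <= 1 ->
  energy x <= energy x0 * expR (2 * t * (x0 - x) + (P x0 - P x) / m).
Proof.
move=> x00 x0x x1.
have HG : ac 0 1 (fun x => (2 * t * x + m^-1 * P x)) (fun x => (2 * t * 1 + m^-1 * `|q x|)).
  by apply: acD; [apply: acZ; exact: ac_id | exact: acZ].
have := ac_ge_ae x0x (ac_sub x00 x1 (acM ac_energy (ac_exp HG))).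
move/(_ _) => H.
have {H} : energy x * expR (2 * t * x + m^-1 * P x) <= energy x0 * expR (2 * t * x0 + m^-1 * P x0).
  apply: H; apply: aeW => s _.
  have -> : denergy s * expR (2 * t * s + m^-1 * P s) + energy s *
     (expR (2 * t * s + m^-1 * P s) * (2 * t * 1 + m^-1 * `|q s|)) =
     expR (2 * t * s + m^-1 * P s) * (denergy s + (2 * t + `|q s| / m) * energy s) by ring.
  rewrite mulr_ge0 ?expR_ge0// -lerBlDr sub0r.
  by have := denergy_le s; rewrite ler_norml => /andP[].
rewrite [X in _ <= _ * expR X -> _](_ : _ = (2 * t * (x0 - x) + (P x0 - P x) / m) +
   (2 * t * x + m^-1 * P x)); last by ring.
by rewrite (expRD (2 * t * (x0 - x) + _)) mulrA ler_pM2r ?expR_gt0.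
Qed.

Hypothesis m1 : 1 <= m.
Hypothesis (yr0 : yr 0 = 0) (yi0 : yi 0 = 0) (zr0 : zr 0 = 1) (zi0 : zi 0 = 0).
Let N := P 1.

Lemma energy0 : energy 0 = 1.
Proof. by rewrite /energy yr0 yi0 zr0 zi0; ring. Qed.

Lemma flux0 : flux 0 = 0.
Proof. by rewrite /flux yr0 yi0 zr0 zi0; ring. Qed.

Let P0 : P 0 = 0 := prim0 _.

Lemma energy_from0 x : 0 <= x -> x <= 1 -> energy x <= expR (2 * t * x + N).
Proof.
move=> x0 x1; apply: le_trans (energy_up (lexx 0) x0 x1) _.
rewrite energy0 mul1r subr0 P0 subr0.
rewrite ler_expR lerD2l ler_pdivrMr//.
have Px0 : 0 <= P x by apply: prim_ge0 => //; exact: L1_norm.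
have PN : P x <= N by apply: prim_le1 => //; exact: L1_norm.
by rewrite (le_trans PN)// ler_peMr// (le_trans Px0).
Qed.

(** These are the terms in q of the equations for [energy] and [flux]. In units of |q| energy / m
    the cross term counts once and 2 t |y|^2 twice, whence the 3. *)
Lemma perturb_le x : 0 <= x -> x <= 1 ->
  `|2 * q x * (zr x * yr x + zi x * yi x)| + `|2 * q x * t * (yr x ^+ 2 + yi x ^+ 2)|
  <= 3 * expR N / m * (`|q x| * expR (2 * t * x)).
Proof.
move=> x0 x1; have En := energy_from0 x0 x1.
have tm : t <= m.
  rewrite -(ler_pXn2r (n := 2)) ?nnegrE//; last exact: ltW.
  by rewrite m2 lerDr sqr_ge0.
have -> : 2 * q x * (zr x * yr x + zi x * yi x) = q x * (2 * (zr x * yr x + zi x * yi x)) by ring.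
have -> : 2 * q x * t * (yr x ^+ 2 + yi x ^+ 2) = q x * (2 * t * (yr x ^+ 2 + yi x ^+ 2)) by ring.
have h1 := cross_le x.
have h2 : `|2 * t * (yr x ^+ 2 + yi x ^+ 2)| <= 2 * (energy x / m).
  rewrite ger0_norm ?mulr_ge0 ?addr_ge0 ?sqr_ge0// -mulrA ler_wpM2l//.
  rewrite ler_pdivlMr// /energy.
  apply: (@le_trans _ _ (m ^+ 2 * (yr x ^+ 2 + yi x ^+ 2))); last first.
    by rewrite lerDr addr_ge0 ?sqr_ge0.
  rewrite mulrAC ler_wpM2r ?addr_ge0 ?sqr_ge0// expr2 ler_wpM2r// ltW//.
rewrite !(normrM (q x)) -mulrDr.
have -> : 3 * expR N / m * (`|q x| * expR (2 * t * x)) =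
   `|q x| * (3 * (expR (2 * t * x + N) / m)) by rewrite expRD; ring.
apply: ler_wpM2l => //.
have h3 : energy x / m <= expR (2 * t * x + N) / m by rewrite ler_wpM2r// invr_ge0 ltW.
have aux (a b c d : R) : a <= c -> b <= 2 * c -> c <= d -> a + b <= 3 * d by lra.
exact: aux h1 h2 h3.
Qed.

Let eps := 3 * N * expR N / m.

(** The sum u = energy + flux satisfies u' = 2 t u up to the perturbation and starts at 1, so it
    keeps the growth exp (2 t x) up to the relative error [eps]. *)
Lemma energy_flux_lower x : 0 <= x -> x <= 1 ->
  expR (2 * t * x) * (1 - eps) <= energy x + flux x.
Proof.
move=> x0 x1.
have H2t : ac 0 1 (fun x => - (2 * t * x)) (fun x => - (2 * t * 1)).
  by apply: acN; apply: acZ; exact: ac_id.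
have H1 := acM (acD ac_energy ac_flux) (ac_exp H2t).
have H3 := acZ (- (3 * expR N / m)) HP.
have := ac_leD x0 (ac_sub (lexx 0) x1 H3) (ac_sub (lexx 0) x1 H1).
rewrite /= energy0 flux0 P0 !mulr0 oppr0 expR0 !addr0 !mulr1.
move=> H; have {}H : - (3 * expR N / m) * P x <= (energy x + flux x) * expR (- (2 * t * x)) - 1.
  apply: H; apply: aeW => s; rewrite in_itv /= => /andP[s0 sx].
  have s1 : s <= 1 by rewrite (le_trans (ltW sx)).
  have h := perturb_le (ltW s0) s1.
  rewrite /denergy /dflux.
  set p1 := 2 * q s * (_ + _) in h *; set p2 := 2 * q s * t * _ in h *.
  have -> : (2 * t * flux s + p1 + (2 * t * energy s + p2)) * expR (- (2 * t * s)) +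
    (energy s + flux s) * (expR (- (2 * t * s)) * - (2 * t)) = (p1 + p2) * expR (- (2 * t * s)) by ring.
  have e1 : expR (2 * t * s) * expR (- (2 * t * s)) = 1 by rewrite -expRD subrr expR0.
  have -> : - (3 * expR N / m) * `|q s| = - (3 * expR N / m * (`|q s| * expR (2 * t * s))) * expR (- (2 * t * s)).
    have aux (a b c d : R) : c * d = 1 -> - a * b = - (a * (b * c)) * d.
      by move=> cd; rewrite -[LHS]mulr1 -cd; ring.
    exact: aux e1.
  rewrite ler_wpM2r ?expR_ge0//.
  have := ler_norm (- p1); have := ler_norm (- p2); rewrite !normrN; move: h; lra.
have PN : P x <= N by apply: prim_le1 => //; exact: L1_norm.
have h2 : 1 - eps <= (energy x + flux x) * expR (- (2 * t * x)).
  have : 3 * expR N / m * P x <= eps.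
    by rewrite /eps (_ : 3 * N * expR N / m = 3 * expR N / m * N); [rewrite ler_wpM2l// divr_ge0 ?mulr_ge0 ?expR_ge0// ltW|ring].
  by move: H; lra.
have := ler_wpM2l (expR_ge0 (2 * t * x)) h2.
by rewrite mulrCA -expRD subrr expR0 mulr1.
Qed.

(** The difference energy - flux would decay like exp (- 2 t x); the perturbation feeds back at most
    [eps] times the growing exponential. *)
Lemma energy_flux_upper x : 0 <= x -> x <= 1 ->
  energy x - flux x <= expR (- (2 * t * x)) + eps * expR (2 * t * x).
Proof.
move=> x0 x1.
have H2t : ac 0 1 (fun x => 2 * t * x) (fun x => 2 * t * 1).
  by apply: acZ; exact: ac_id.
have H1 := acM (acB ac_energy ac_flux) (ac_exp H2t).
have H3 := acZ (3 * expR N / m * expR (4 * t * x)) HP.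
have := ac_leD x0 (ac_sub (lexx 0) x1 H1) (ac_sub (lexx 0) x1 H3).
rewrite /= energy0 flux0 P0 !mulr0 expR0 !subr0 !mulr1.
move=> H; have {}H : (energy x - flux x) * expR (2 * t * x) - 1 <= 3 * expR N / m * expR (4 * t * x) * P x.
  apply: H; apply: aeW => s; rewrite in_itv /= => /andP[s0 sx].
  have s1 : s <= 1 by rewrite (le_trans (ltW sx)).
  have h := perturb_le (ltW s0) s1.
  rewrite /denergy /dflux.
  set p1 := 2 * q s * (_ + _) in h *; set p2 := 2 * q s * t * _ in h *.
  have -> : (2 * t * flux s + p1 - (2 * t * energy s + p2)) * expR (2 * t * s) +
    (energy s - flux s) * (expR (2 * t * s) * (2 * t)) = (p1 - p2) * expR (2 * t * s) by ring.
  have h1 : p1 - p2 <= 3 * expR N / m * (`|q s| * expR (2 * t * s)).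
    have := ler_norm p1; have := ler_norm (- p2); rewrite !normrN; move: h; lra.
  apply: le_trans (ler_wpM2r (expR_ge0 _) h1) _.
  have -> : 3 * expR N / m * (`|q s| * expR (2 * t * s)) * expR (2 * t * s) =
    3 * expR N / m * `|q s| * expR (4 * t * s).
    have -> : 4 * t * s = 2 * t * s + 2 * t * s by ring.
    by rewrite expRD; ring.
  rewrite [leRHS]mulrAC; apply: ler_wpM2l.
    by rewrite mulr_ge0// divr_ge0 ?mulr_ge0 ?expR_ge0// ltW.
  by rewrite ler_expR; apply: ler_wpM2l; [rewrite mulr_ge0 | exact: ltW].
have PN : P x <= N by apply: prim_le1 => //; exact: L1_norm.
have h2 : (energy x - flux x) * expR (2 * t * x) <= 1 + eps * expR (4 * t * x).
  have : 3 * expR N / m * expR (4 * t * x) * P x <= eps * expR (4 * t * x).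
    rewrite /eps (_ : 3 * N * expR N / m * expR (4 * t * x) = 3 * expR N / m * expR (4 * t * x) * N); last by ring.
    by rewrite ler_wpM2l// mulr_ge0 ?expR_ge0// divr_ge0 ?mulr_ge0 ?expR_ge0// ltW.
  by move: H; lra.
have := ler_wpM2r (expR_ge0 (- (2 * t * x))) h2.
have -> : (energy x - flux x) * expR (2 * t * x) * expR (- (2 * t * x)) = energy x - flux x.
  by rewrite -mulrA -expRD subrr expR0 mulr1.
have -> : (1 + eps * expR (4 * t * x)) * expR (- (2 * t * x)) =
    expR (- (2 * t * x)) + eps * expR (2 * t * x).
  have -> : 4 * t * x = 2 * t * x + 2 * t * x by ring.
  have aux (a b c d : R) : b * c = d -> (1 + a * b) * c = c + a * d.
    by move=> <-; ring.
  by apply: aux; rewrite -expRD addrK.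
by [].
Qed.

(** Half the difference of the two preceding estimates: 1 - 1/8 - 1/4 - 1/8 = 1/2. *)
Lemma flux_lower x : 0 <= x -> x <= 1 -> expR (- (4 * t * x)) <= 4^-1 -> eps <= 8^-1 ->
  expR (2 * t * x) / 4 <= flux x.
Proof.
move=> x0 x1 e4 e8; have h1 := energy_flux_lower x0 x1; have h2 := energy_flux_upper x0 x1.
have e0 := expR_ge0 (2 * t * x).
have h3 : expR (- (2 * t * x)) <= expR (2 * t * x) / 4.
  have -> : - (2 * t * x) = 2 * t * x + - (4 * t * x) by ring.
  by rewrite expRD ler_wpM2l.
have h4 : eps * expR (2 * t * x) <= expR (2 * t * x) / 8.
  by rewrite mulrC; apply: ler_wpM2l.
move: h1 h2 h3 h4; rewrite mulrBr mulr1 [_ * eps]mulrC; lra.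
Qed.

End Energy.

(** * Exponential bounds for complex solutions and their Wronskian *)

Section Growth.
Variable R : realType.
Local Notation mu := (@lebesgue_measure R).
Local Notation C := R[i]%C.
Local Notation "x %:C" := (Complex x 0 : C).

Definition L1norm (q : R -> R) : R := prim (fun x => `|q x|) 1.

Lemma L1norm_ge0 q : L1_01 q -> 0 <= L1norm q.
Proof. by move=> iq; apply: prim_ge0 => //; exact: L1_norm. Qed.

Lemma sqr_normc (z : C) : normc z ^+ 2 = Re z ^+ 2 + Im z ^+ 2.
Proof. by case: z => a b /=; rewrite sqr_sqrtr// addr_ge0 ?sqr_ge0. Qed.

Section OneSolution.
Variables (q : R -> R) (k : C) (y z : R -> C).
Hypothesis iq : L1_01 q.
Hypothesis sol : csol q (k ^+ 2) y z.
Hypothesis k0 : 0 < normc k.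
Hypothesis t0 : 0 <= Im k.
Let yr x := Re (y x).
Let yi x := Im (y x).
Let zr x := Re (z x).
Let zi x := Im (z x).
Let t := Im k.
Let m := normc k.
Let N := L1norm q.

Let Hyr : ac 0 1 yr zr. Proof. by case: sol => -[]. Qed.
Let Hyi : ac 0 1 yi zi. Proof. by case: sol => -[]. Qed.
Let Hzr : ac 0 1 zr (fun x => (q x - (Re k ^+ 2 - t ^+ 2)) * yr x + 2 * Re k * t * yi x).
Proof.
case: sol => _ [+ _]; apply: ac_eq_deriv => x _; rewrite /yr /yi /t expr2.
by case: (k) => a b; case: (y x) => c d /=; ring.
Qed.
Let Hzi : ac 0 1 zi (fun x => (q x - (Re k ^+ 2 - t ^+ 2)) * yi x - 2 * Re k * t * yr x).
Proof.
case: sol => _ [_ +]; apply: ac_eq_deriv => x _; rewrite /yr /yi /t expr2.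
by case: (k) => a b; case: (y x) => c d /=; ring.
Qed.
Let m2 : m ^+ 2 = Re k ^+ 2 + t ^+ 2 := sqr_normc k.

Definition cenergy x := normc (z x) ^+ 2 + normc k ^+ 2 * normc (y x) ^+ 2.

Lemma cenergyE x : cenergy x = energy yr yi zr zi m x.
Proof. by rewrite /cenergy /energy !sqr_normc. Qed.

Let Pdiff x0 x : 0 <= x0 -> x0 <= x -> x <= 1 ->
  (prim (fun x => `|q x|) x - prim (fun x => `|q x|) x0) / m <= N / m.
Proof.
move=> x00 x0x x1; rewrite ler_wpM2r// ?invr_ge0 ?(ltW k0)// lerBlDr.
apply: (@le_trans _ _ N); first by apply: prim_le1 => //; [exact: L1_norm|exact: le_trans x0x].
by rewrite lerDl; apply: prim_ge0 => //; [exact: L1_norm | exact: le_trans x1].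
Qed.

Lemma cenergy_up x0 x : 0 <= x0 -> x0 <= x -> x <= 1 ->
  cenergy x <= cenergy x0 * expR (2 * t * (x - x0) + N / m).
Proof.
move=> x00 x0x x1; rewrite !cenergyE.
apply: le_trans (energy_up iq Hyr Hyi Hzr Hzi t0 k0 m2 x00 x0x x1) _.
by apply: ler_wpM2l; [exact: energy_ge0 | rewrite ler_expR lerD2l; exact: Pdiff].
Qed.

Lemma cenergy_down x x0 : 0 <= x -> x <= x0 -> x0 <= 1 ->
  cenergy x <= cenergy x0 * expR (2 * t * (x0 - x) + N / m).
Proof.
move=> x00 x0x x1; rewrite !cenergyE.
apply: le_trans (energy_down iq Hyr Hyi Hzr Hzi t0 k0 m2 x00 x0x x1) _.
by apply: ler_wpM2l; [exact: energy_ge0 | rewrite ler_expR lerD2l; exact: Pdiff].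
Qed.

Hypothesis m1 : 1 <= m.

Lemma expR_sqr (a : R) : expR (2 * a + N / m) <= expR (a + N) ^+ 2.
Proof.
rewrite expr2 -expRD ler_expR.
have N0 := L1norm_ge0 iq.
have : N / m <= N by rewrite ler_pdivrMr// ler_peMr.
by rewrite -/N in N0 *; lra.
Qed.

Lemma le_of_sqr (a b : R) : 0 <= a -> 0 <= b -> a ^+ 2 <= b ^+ 2 -> a <= b.
Proof. by move=> a0 b0; rewrite ler_pXn2r. Qed.

Lemma y_le_energy x (A B : R) : 0 <= A -> cenergy x <= A ^+ 2 * expR (2 * B + N / m) ->
  m * normc (y x) <= A * expR (B + N) /\ normc (z x) <= A * expR (B + N).
Proof.
move=> A0 h; have h2 : cenergy x <= (A * expR (B + N)) ^+ 2.
  by apply: le_trans h _; rewrite exprMn; apply: ler_wpM2l; [exact: sqr_ge0 | exact: expR_sqr].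
have AE : 0 <= A * expR (B + N) by rewrite mulr_ge0// expR_ge0.
split; apply: le_of_sqr => //.
- by rewrite mulr_ge0 ?normc_ge0// ltW.
- by rewrite exprMn; apply: le_trans h2; rewrite /cenergy lerDr sqr_ge0.
- exact: normc_ge0.
- by apply: le_trans h2; rewrite /cenergy lerDl mulr_ge0// sqr_ge0.
Qed.

Lemma sol_from_bound b x : 0 <= b -> b <= x -> x <= 1 -> y b = 0 -> z b = 1 ->
  m * normc (y x) <= expR (t * (x - b) + N) /\ normc (z x) <= expR (t * (x - b) + N).
Proof.
move=> b0 bx x1 yb zb; have := cenergy_up b0 bx x1.
rewrite {2}/cenergy yb zb normc0 normc1 expr0n /= mulr0 addr0 -[2 * t * _]mulrA.
by move=> /(y_le_energy ler01); rewrite mul1r.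
Qed.

Lemma sol_to_bound b x : 0 <= x -> x <= b -> b <= 1 -> y b = 0 -> z b = 1 ->
  m * normc (y x) <= expR (t * (b - x) + N) /\ normc (z x) <= expR (t * (b - x) + N).
Proof.
move=> b0 bx x1 yb zb; have := cenergy_down b0 bx x1.
rewrite {2}/cenergy yb zb normc0 normc1 expr0n /= mulr0 addr0 -[2 * t * _]mulrA.
by move=> /(y_le_energy ler01); rewrite mul1r.
Qed.

Lemma cosol_to_bound b x : 0 <= x -> x <= b -> b <= 1 -> y b = 1 -> z b = 0 ->
  normc (y x) <= expR (t * (b - x) + N).
Proof.
move=> b0 bx x1 yb zb; have := cenergy_down b0 bx x1.
rewrite {2}/cenergy yb zb normc0 normc1 expr0n /= add0r expr1n mulr1 -[2 * t * _]mulrA.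
by move=> /(y_le_energy (ltW k0)) [+ _]; rewrite ler_pM2l.
Qed.

(** The flux is at most 2 |z| |k y|, and |z| is at most exp (t x + N), so the lower bound of the
    flux passes to |k y|. The two smallness conditions hold once t x and |k| are large. *)
Lemma sol_from0_lower x : 0 <= x -> x <= 1 -> y 0 = 0 -> z 0 = 1 ->
  expR (- (4 * t * x)) <= 4^-1 -> 3 * N * expR N / m <= 8^-1 ->
  expR (t * x - N) / 8 <= m * normc (y x).
Proof.
move=> x0 x1 y0 z0 e4 e8.
have yr0 : yr 0 = 0 by rewrite /yr y0.
have yi0 : yi 0 = 0 by rewrite /yi y0.
have zr0 : zr 0 = 1 by rewrite /zr z0.
have zi0 : zi 0 = 0 by rewrite /zi z0.
have := flux_lower iq Hyr Hyi Hzr Hzi t0 k0 m2 m1 yr0 yi0 zr0 zi0 x0 x1 e4 e8.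
have [_ zb] := sol_from_bound (lexx 0) x0 x1 y0 z0.
have fl : flux yr yi zr zi (Re k) t x <= 2 * (normc (z x) * (m * normc (y x))).
  rewrite /flux; apply: ler_wpM2l => //; apply: le_trans (ler_norm _) _.
  apply: le_of_sqr => //; first by rewrite !mulr_ge0 ?normc_ge0.
  rewrite real_normK ?num_real// !exprMn m2 !sqr_normc -/(yr x) -/(yi x) -/(zr x) -/(zi x).
  have -> : (zr x ^+ 2 + zi x ^+ 2) * ((Re k ^+ 2 + t ^+ 2) * (yr x ^+ 2 + yi x ^+ 2)) =
     (zr x * (Re k * yi x + t * yr x) - zi x * (Re k * yr x - t * yi x)) ^+ 2 +
     (zr x * (Re k * yr x - t * yi x) + zi x * (Re k * yi x + t * yr x)) ^+ 2 by ring.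
  by rewrite lerDl sqr_ge0.
move=> /le_trans/(_ fl) h.
have my0 : 0 <= m * normc (y x) by rewrite mulr_ge0// ?normc_ge0// ltW.
have {}h : expR (2 * t * x) / 4 <= 2 * (expR (t * x + N) * (m * normc (y x))).
  by apply: le_trans h _; apply: ler_wpM2l => //; apply: ler_wpM2r => //; rewrite subr0 in zb.
have e2 : expR (2 * t * x) = expR (t * x + N) * expR (t * x - N).
  by rewrite -expRD; congr expR; ring.
move: h; rewrite e2.
have E0 := expR_gt0 (t * x + N).
have -> : expR (t * x + N) * expR (t * x - N) / 4 = expR (t * x + N) * (expR (t * x - N) / 4) by ring.
have -> : 2 * (expR (t * x + N) * (m * normc (y x))) = expR (t * x + N) * (2 * (m * normc (y x))) by ring.
by rewrite ler_pM2l//; lra.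
Qed.

End OneSolution.

Lemma wronskian_deriv q1 q2 lam y1 z1 y2 z2 : csol q1 lam y1 z1 -> csol q2 lam y2 z2 ->
  cac 0 1 (fun x => y1 x * z2 x - z1 x * y2 x) (fun x => (q2 x - q1 x)%:C * (y1 x * y2 x)).
Proof.
move=> [h1 h2] [g1 g2]; have := cacB (cacM h1 g2) (cacM h2 g1).
apply: cac_eq_deriv => x _; have -> : (q2 x - q1 x)%:C = (q2 x)%:C - (q1 x)%:C.
  by apply/eqP; rewrite eq_complex /= subrr !eqxx.
ring.
Qed.

Lemma cac_const a b f f' : cac a b f f' ->
  {ae mu, forall x, x \in `]a, b[ -> f' x = 0} ->
  forall x y, a <= x -> x <= b -> a <= y -> y <= b -> f x = f y.
Proof.
move=> [F1 F2] f0 x y ax xb ay yb; apply/eqP; rewrite eq_complex; apply/andP; split; apply/eqP.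
  by apply: (ac_const_ae F1) => //; apply: ae_impl f0 => t H /H ->.
by apply: (ac_const_ae F2) => //; apply: ae_impl f0 => t H /H ->.
Qed.

Lemma wronskian_const q lam y1 z1 y2 z2 : csol q lam y1 z1 -> csol q lam y2 z2 ->
  forall x x' : R, 0 <= x -> x <= 1 -> 0 <= x' -> x' <= 1 ->
  y1 x * z2 x - z1 x * y2 x = y1 x' * z2 x' - z1 x' * y2 x'.
Proof.
move=> h1 h2; apply: (cac_const (wronskian_deriv h1 h2)).
by apply: aeW => x _; rewrite subrr mul0r.
Qed.

(** The Wronskian is the integral of (q2 - q1) y1 y2 from 0, each solution being O(exp (t x) / |k|).
    Bounding its two products directly would lose a factor |k|, which the case sigma = 2 b cannot
    spare in the Jensen argument. *)
Lemma wronskian_bound q1 q2 : L1_01 q1 -> L1_01 q2 -> exists K : R, 0 < K /\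
  forall (k : C) y1 z1 y2 z2 b, 1 <= normc k -> 0 <= Im k -> 0 <= b -> b <= 1 ->
  csol q1 (k ^+ 2) y1 z1 -> csol q2 (k ^+ 2) y2 z2 ->
  y1 0 = 0 -> z1 0 = 1 -> y2 0 = 0 -> z2 0 = 1 ->
  normc (y1 b * z2 b - z1 b * y2 b) <= K * expR (2 * Im k * b) / normc k ^+ 2.
Proof.
move=> i1 i2.
pose M := expR (L1norm q1) * expR (L1norm q2).
have i12 := L1D (L1_norm i1) (L1_norm i2).
have M0 : 0 < M by rewrite mulr_gt0// expR_gt0.
have L0 : 0 <= prim (fun x => `|q1 x| + `|q2 x|) 1.
  by apply: prim_ge0 => // x; rewrite addr_ge0.
(* Real and imaginary parts are estimated separately, whence the 2; the added 1 keeps the constant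
   positive. *)
exists (2 * M * (prim (fun x => `|q1 x| + `|q2 x|) 1 + 1)); split.
  by apply: mulr_gt0; [exact: mulr_gt0 | rewrite ltr_wpDl].
move=> k y1 z1 y2 z2 b m1 t0 b0 b1 s1 s2 y10 z10 y20 z20.
have m0 : 0 < normc k by apply: lt_le_trans m1.
have HW := wronskian_deriv s1 s2.
pose A := M * expR (2 * Im k * b) / normc k ^+ 2.
have A0 : 0 <= A by rewrite divr_ge0 ?sqr_ge0// mulr_ge0 ?expR_ge0// ltW.
have HG := acZ A (ac_prim i12).
have est x : 0 < x -> x < b -> normc ((q2 x - q1 x)%:C * (y1 x * y2 x)) <= A * (`|q1 x| + `|q2 x|).
  move=> x0 xb; have x1 : x <= 1 by rewrite (le_trans (ltW xb)).
  rewrite !normcM normc_real mulrC; apply: ler_pM => //.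
  - by rewrite mulr_ge0// normc_ge0.
  - have [h1 _] := sol_from_bound i1 s1 m0 t0 m1 (lexx 0) (ltW x0) x1 y10 z10.
    have [h2 _] := sol_from_bound i2 s2 m0 t0 m1 (lexx 0) (ltW x0) x1 y20 z20.
    rewrite /A ler_pdivlMr ?exprn_gt0//.
    have -> : normc (y1 x) * normc (y2 x) * normc k ^+ 2 =
      (normc k * normc (y1 x)) * (normc k * normc (y2 x)) by ring.
    apply: (@le_trans _ _ (expR (Im k * (x - 0) + L1norm q1) * expR (Im k * (x - 0) + L1norm q2))).
      by apply: ler_pM => //; rewrite mulr_ge0 ?normc_ge0.
    rewrite /M -!expRD ler_expR subr0.
    have : Im k * x <= Im k * b by apply: ler_wpM2l => //; exact: ltW.
    lra.
  - by rewrite [leRHS]addrC; apply: ler_normB.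
have W0 : y1 0 * z2 0 - z1 0 * y2 0 = 0 by rewrite y10 y20 mul0r mulr0 subr0.
have fin (f f' : R -> R) : ac 0 1 f f' -> f 0 = 0 ->
    (forall x, 0 < x -> x < b -> `|f' x| <= A * (`|q1 x| + `|q2 x|)) ->
    `|f b| <= A * prim (fun x => `|q1 x| + `|q2 x|) 1.
  move=> F f0 H; have -> : f b = f b - f 0 by rewrite f0 subr0.
  apply: le_trans (ac_norm_leD b0 (ac_sub (lexx 0) b1 F) (ac_sub (lexx 0) b1 HG) _) _.
    by apply: aeW => x; rewrite in_itv /= => /andP[]; exact: H.
  rewrite prim0 mulr0 subr0; apply: ler_wpM2l => //.
  by apply: prim_le1 => // x; rewrite addr_ge0.
case: HW => HW1 HW2.
have r1 := fin _ _ HW1 (f_equal (@complex.Re _) W0) (fun x x0 xb => le_trans (norm_Re_le _) (est x x0 xb)).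
have r2 := fin _ _ HW2 (f_equal (@complex.Im _) W0) (fun x x0 xb => le_trans (norm_Im_le _) (est x x0 xb)).
apply: le_trans (normc_le _) _; apply: le_trans (lerD r1 r2) _.
have -> : 2 * M * (prim (fun x => `|q1 x| + `|q2 x|) 1 + 1) * expR (2 * Im k * b) / normc k ^+ 2 =
   2 * A * (prim (fun x => `|q1 x| + `|q2 x|) 1 + 1) by rewrite /A; ring.
have aux (a p : R) : 0 <= a -> a * p + a * p <= 2 * a * (p + 1) by lra.
exact: aux.
Qed.

End Growth.

(** * Jensen's inequality and zero counting *)

Section Jensen.
Variable R : realType.
Local Notation C := R[i]%C.
Local Notation "x %:C" := (Complex x 0 : C).

Definition cis (a : R) : C := Complex (cos a) (sin a).

Lemma cisD a b : cis (a + b) = cis a * cis b.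
Proof. by apply/eqP; rewrite eq_complex /= cosD sinD addrC eqxx [sin a * _ + _]addrC eqxx. Qed.

Lemma cisX a n : cis a ^+ n = cis (n%:R * a).
Proof.
elim: n => [|n IH]; first by rewrite expr0 mul0r /cis cos0 sin0.
by rewrite exprS IH -cisD -natr1 mulrDl mul1r addrC.
Qed.

Lemma normc_cis a : normc (cis a) = 1.
Proof. by rewrite /= cos2Dsin2 sqrtr1. Qed.

Lemma cis2pi : cis (2 * pi) = 1.
Proof. by rewrite /cis mulr_natl cos2pi sin2pi. Qed.

Lemma normc_cisB1 a : normc (cis a - 1) = 2 * `|sin (a / 2)|.
Proof.
have -> : normc (cis a - 1) = Num.sqrt ((2 * sin (a / 2)) ^+ 2).
  have e : a = a / 2 + a / 2 by rewrite -splitr.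
  rewrite /= subr0; congr Num.sqrt; rewrite {1 2}e cosD sinD.
  have := cos2Dsin2 (a / 2); set c := cos _; set s := sin _; move=> h.
  have {h} h : c ^+ 2 = 1 - s ^+ 2 by rewrite -h addrK.
  rewrite -!expr2 h; have -> : (s * c + c * s) ^+ 2 = 4 * s ^+ 2 * c ^+ 2 by ring.
  by rewrite h; ring.
by rewrite sqrtr_sqr normrM ger0_norm.
Qed.

Lemma cis_neq1 a : 0 < a -> a < 2 * pi -> cis a != 1.
Proof.
move=> a0 a1; rewrite -subr_eq0 -normc_eq0 normc_cisB1 mulf_neq0// normr_eq0.
by rewrite gt_eqF// sin_gt0_pi// divr_gt0//= ltr_pdivrMr// mulrC.
Qed.

(** Averaging over the N-th roots of unity, with N above the degree, kills every coefficient but the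
    constant one. *)
Lemma poly_center (P : {poly C}) (rho M : R) :
  (forall a, normc P.[rho%:C * cis a] <= M) -> normc P.[0] <= M.
Proof.
move=> H; pose N := (size P).+1; pose w := cis (2 * pi / N%:R).
have N0 : (0 : R) < N%:R by rewrite ltr0n.
have wN : w ^+ N = 1 by rewrite /w cisX mulrC divfK ?cis2pi// gt_eqF.
have key : \sum_(l < N) P.[rho%:C * w ^+ l] = N%:R * P.[0].
  under eq_bigr => l _ do rewrite horner_coef.
  rewrite exchange_big /= horner_coef0.
  have [P0|/negP] := boolP (size P == 0)%N.
    rewrite (eqP P0) big_ord0 nth_default ?mulr0//; by rewrite (eqP P0).
  move=> /negP; rewrite -lt0n => P0.
  rewrite (bigD1 (Ordinal P0)) //= [X in _ + X]big1 ?addr0.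
    under eq_bigr => l _ do rewrite expr0 mulr1.
    by rewrite sumr_const card_ord mulr_natl.
  move=> i i0; under eq_bigr => l _ do rewrite exprMn mulrA -exprM mulnC exprM.
  rewrite -mulr_sumr.
  have wi : w ^+ i != 1.
    rewrite /w cisX cis_neq1//.
      by rewrite mulr_gt0 ?divr_gt0 ?mulr_gt0 ?pi_gt0// ltr0n lt0n.
    rewrite mulrCA gtr_pMr ?mulr_gt0 ?pi_gt0// ltr_pdivrMr// mul1r ltr_nat.
    exact: leqW.
  have : (w ^+ i - 1) * (\sum_(l < N) (w ^+ i) ^+ l) = 0.
    by rewrite -subrX1 -exprM mulnC exprM wN expr1n subrr.
  by move/eqP; rewrite mulf_eq0 subr_eq0 (negbTE wi) => /eqP ->; rewrite mulr0.
have : normc (N%:R * P.[0]) <= N%:R * M.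
  rewrite -key; apply: le_trans (normc_sum _ _) _.
  rewrite mulr_natl -[in leRHS](card_ord N) -sumr_const.
  by apply: ler_sum => l _; rewrite /w cisX.
have -> : (N%:R : C) = (N%:R : R)%:C by rewrite -(rmorph_nat (real_complex R)).
by rewrite normcM normc_real ger0_norm ?ler0n// ler_pM2l.
Qed.

(** Reflecting the root [z] in the circle keeps the modulus on the circle and changes the modulus at
    0 from |z| to [rho]. In this form the Blaschke factor amounts to replacing one linear polynomial
    by another. *)
Lemma blaschke_factor (rho a : R) (z : C) : 0 < rho ->
  normc (rho%:C - (z^*)%C / rho%:C * (rho%:C * cis a)) = normc (rho%:C * cis a - z).
Proof.
move=> r0.
have r0C : rho%:C != 0 :> C by rewrite eq_complex /= gt_eqF.
have -> : rho%:C - (z^*)%C / rho%:C * (rho%:C * cis a) = rho%:C - (z^*)%C * cis a.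
  by field.
have -> : rho%:C - (z^*)%C * cis a = cis a * ((rho%:C * cis a - z)^*)%C.
  case: z => x y; apply/eqP; rewrite eq_complex /=; have := cos2Dsin2 a.
  set c := cos a; set s := sin a => h.
  apply/andP; split; apply/eqP.
    transitivity (rho * (c ^+ 2 + s ^+ 2) - c * x - s * y); last by ring.
    by rewrite h; ring.
  by ring.
rewrite normcM normc_cis mul1r.
by case: (_ - z) => u v /=; rewrite sqrrN.
Qed.

(** Reflecting all roots in [zs] multiplies the modulus at 0 by the product of the rho / |z|. The
    mean value bound is applied to the product of N rotated copies, whose value at 0 is an N-th
    power. The roots may lie on either side of the circle. *)
Lemma jensen_poly (P : {poly C}) (zs : seq C) (rho mu : R) (h : R -> R) (N : nat) :
  0 < rho -> (0 < N)%N -> 0 <= mu -> uniq zs -> 0 \notin zs -> all (root P) zs ->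
  (forall a, normc P.[rho%:C * cis a] <= h a) ->
  (forall a, \prod_(l < N) h (a + 2 * pi * l%:R / N%:R) <= mu ^+ N) ->
  normc P.[0] * \prod_(z <- zs) (rho / normc z) <= mu.
Proof.
move=> r0 N0 mu0 uz nz rt Ph hmu.
have [Q PQ] : exists Q, P = Q * \prod_(z <- zs) ('X - z%:P).
  by apply: uniq_roots_prod_XsubC => //; rewrite uniq_rootsE.
pose F := Q * \prod_(z <- zs) (rho%:C%:P - ((z^*)%C / rho%:C)%:P * 'X).
have FP a : normc F.[rho%:C * cis a] = normc P.[rho%:C * cis a].
  rewrite /F PQ !hornerM !horner_prod !normcM !normc_prod; congr (_ * _).
  apply: eq_bigr => z _; rewrite !(hornerD, hornerN, hornerM, hornerC, hornerX).
  exact: blaschke_factor.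
have F0 : normc F.[0] = normc P.[0] * \prod_(z <- zs) (rho / normc z).
  rewrite /F PQ !hornerM !horner_prod !normcM !normc_prod -mulrA; congr (_ * _).
  rewrite -big_split /=; apply: eq_big_seq => z zz.
  rewrite !(hornerD, hornerN, hornerM, hornerC, hornerX) mulr0 subr0 sub0r.
  rewrite normcN normc_real gtr0_norm// mulrC divfK// normc_eq0.
  by apply: contraNneq nz => <-.
rewrite -F0.
pose G := \prod_(l < N) (F \Po ((cis (2 * pi * l%:R / N%:R))%:P * 'X)).
have GE z : G.[z] = \prod_(l < N) F.[cis (2 * pi * l%:R / N%:R) * z].
  by rewrite /G horner_prod; apply: eq_bigr => l _; rewrite horner_comp !hornerE.
have : normc G.[0] <= mu ^+ N.
  apply: (poly_center (rho := rho)) => a; apply: le_trans (hmu a).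
  rewrite GE normc_prod; apply: ler_prod => l _; rewrite normc_ge0 /=.
  by rewrite mulrCA -cisD FP addrC; exact: Ph.
rewrite GE normc_prod; under eq_bigr => l _ do rewrite mulr0.
rewrite prodr_const card_ord ler_pXn2r// nnegrE ?normc_ge0//.
Qed.

Lemma poly_bounded (P : {poly C}) (rho : R) : exists2 K : R, 0 <= K &
  forall z, normc z <= rho -> normc P.[z] <= K.
Proof.
exists (\sum_(i < size P) normc P`_i * `|rho| ^+ i).
  by apply: sumr_ge0 => i _; rewrite mulr_ge0 ?normc_ge0// exprn_ge0.
move=> z zr; rewrite horner_coef; apply: le_trans (normc_sum _ _) _.
apply: ler_sum => i _; rewrite normcM normcX ler_wpM2l ?normc_ge0//.
by rewrite lerXn2r ?nnegrE ?normc_ge0// (le_trans zr)// ler_norm.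
Qed.

Lemma polys_bounded (L : C -> {poly C}) (s : seq C) (rho : R) : exists2 K : R, 0 <= K &
  forall z w, z \in s -> normc w <= rho -> normc (L z).[w] <= K.
Proof.
elim: s => [|z s [K K0 HK]]; first by exists 0.
have [K' K'0 HK'] := poly_bounded (L z) rho.
exists (K + K') => [|u w]; first exact: addr_ge0.
rewrite inE => /orP[/eqP ->|us] wr.
  by apply: le_trans (HK' w wr) _; rewrite lerDr.
by apply: le_trans (HK u w us wr) _; rewrite lerDl.
Qed.

(** An approximating polynomial is nearly zero on [zs]; subtracting its Lagrange interpolant there
    makes it vanish exactly, at a cost proportional to the error. *)
Lemma poly_approx_zeros (f : C -> C) (zs : seq C) (rho eta : R) : poly_approx f ->
  uniq zs -> (forall z, z \in zs -> f z = 0) -> 0 < eta ->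
  exists2 P : {poly C}, all (root P) zs &
    forall z, normc z <= rho -> normc (f z - P.[z]) <= eta.
Proof.
move=> fa uz fz eta0.
pose L z : {poly C} := ((\prod_(w <- rem z zs) (z - w))^-1)%:P * \prod_(w <- rem z zs) ('X - w%:P).
have Lz z : z \in zs -> (L z).[z] = 1.
  move=> zz; rewrite /L hornerM hornerC horner_prod.
  under [X in _ * X]eq_bigr => w _ do rewrite !hornerE.
  rewrite mulVf// prodf_seq_neq0; apply/allP => w wz /=.
  by rewrite subr_eq0 eq_sym; apply: contraTneq wz => ->; rewrite mem_rem_uniqF.
have Lw z w : z \in zs -> w \in zs -> w != z -> (L z).[w] = 0.
  move=> zz wz wnz; apply/eqP; rewrite /L hornerM horner_prod mulf_eq0; apply/orP; right.
  rewrite prodf_seq_eq0; apply/hasP; exists w; first by rewrite mem_rem_uniq// inE wnz.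
  by rewrite /= hornerXsubC subrr.
have [K K0 HK] := polys_bounded L zs rho.
pose n : R := (size zs)%:R.
(* The first approximation must also be good at the zeros, which may lie outside the disc of radius
   [rho]. *)
pose rho' := `|rho| + \sum_(z <- zs) normc z.
pose d := eta / (1 + n * K).
have nK0 : 0 < 1 + n * K by rewrite ltr_pwDl// mulr_ge0// ler0n.
have d0 : 0 < d by rewrite divr_gt0.
have [P HP] := fa rho' d d0.
have zr' z : z \in zs -> normc z <= rho'.
  move=> zz; rewrite /rho' (big_rem z)//= addrCA lerDl addr_ge0// sumr_ge0// => w _.
  exact: normc_ge0.
have Pz z : z \in zs -> normc P.[z] <= d.
  by move=> zz; have := HP z (zr' z zz); rewrite fz// sub0r normcN.
exists (P - \sum_(z <- zs) (P.[z])%:P * L z).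
  apply/allP => w wz; rewrite /root hornerD hornerN horner_sum (big_rem w)//=.
  rewrite big_seq big1 => [|z]; first by rewrite hornerM hornerC Lz// mulr1 addr0 subrr.
  rewrite mem_rem_uniq// inE => /andP[zw zz].
  by rewrite hornerM hornerC Lw ?mulr0// eq_sym.
move=> z zr; rewrite hornerD hornerN opprB addrCA addrC.
apply: le_trans (le_normcD _ _) _.
have -> : eta = d + n * (d * K) by rewrite /d; field; rewrite gt_eqF.
apply: lerD.
  apply: HP; apply: le_trans zr _; apply: le_trans (ler_norm _) _.
  by rewrite lerDl sumr_ge0// => w _; exact: normc_ge0.
rewrite horner_sum; apply: le_trans (normc_sum _ _) _.
rewrite /n -sum1_size natr_sum mulr_suml big_seq [leRHS]big_seq; apply: ler_sum => w wz.
rewrite mul1r hornerM hornerC normcM; apply: ler_pM; rewrite ?normc_ge0 ?Pz//.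
exact: HK.
Qed.

(* Jensen's inequality with the mean of log |f| over the circle replaced by
   products over the vertices of the rotated regular N-gons. *)
Theorem jensen (f : C -> C) (zs : seq C) (rho mu h0 : R) (h : R -> R) (N : nat) :
  poly_approx f -> 0 < rho -> (0 < N)%N -> 0 <= mu -> uniq zs -> 0 \notin zs ->
  (forall z, z \in zs -> f z = 0) -> 0 < h0 -> (forall a, h0 <= h a) ->
  (forall a, normc (f (rho%:C * cis a)) <= h a) ->
  (forall a, \prod_(l < N) h (a + 2 * pi * l%:R / N%:R) <= mu ^+ N) ->
  normc (f 0) * \prod_(z <- zs) (rho / normc z) <= mu.
Proof.
move=> fa r0 N0 mu0 uz nz fz h00 hh fh hmu.
set kap := \prod_(z <- zs) _.
have kap0 : 0 <= kap.
  by apply: prodr_ge0 => z _; rewrite divr_ge0 ?normc_ge0// ltW.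
apply/ler_addgt0Pr => e e0.
(* The errors are [eta * kap] from the value at 0 and [eta * (mu / h0)] from the circle, where the
   lower bound [h0] makes the additive error relative; with this [D] they sum to at most [e]. *)
pose D := kap + mu / h0 + 1.
have D0 : 0 < D by rewrite ltr_wpDl// addr_ge0// divr_ge0// ltW.
pose eta := e / D.
have eta0 : 0 < eta by rewrite divr_gt0.
have [P rt Pf] := poly_approx_zeros rho fa uz fz eta0.
have e10 : 0 <= 1 + eta / h0 by rewrite addr_ge0// divr_ge0// ltW.
have nr a : normc (rho%:C * cis a) <= rho.
  by rewrite normcM normc_real normc_cis mulr1 gtr0_norm.
have Ph a : normc P.[rho%:C * cis a] <= (1 + eta / h0) * h a.
  have -> : P.[rho%:C * cis a] = f (rho%:C * cis a) - (f (rho%:C * cis a) - P.[rho%:C * cis a]).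
    by rewrite subKr.
  apply: le_trans (le_normcD _ _) _; rewrite normcN mulrDl mul1r; apply: lerD; first exact: fh.
  apply: le_trans (Pf _ (nr a)) _; rewrite mulrAC ler_pdivlMr// ler_wpM2l//.
  exact: ltW.
have Ppr a : \prod_(l < N) ((1 + eta / h0) * h (a + 2 * pi * l%:R / N%:R)) <= ((1 + eta / h0) * mu) ^+ N.
  rewrite big_split /= prodr_const card_ord exprMn.
  by apply: ler_wpM2l; [exact: exprn_ge0 | exact: hmu].
have := jensen_poly r0 N0 (mulr_ge0 e10 mu0) uz nz rt Ph Ppr.
rewrite -/kap => J.
have f0 : normc (f 0) <= normc P.[0] + eta.
  have -> : f 0 = P.[0] + (f 0 - P.[0]) by rewrite addrC subrK.
  apply: le_trans (le_normcD _ _) _; rewrite lerD2l; apply: Pf.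
  by rewrite normc0 ltW.
apply: le_trans (ler_wpM2r kap0 f0) _; rewrite mulrDl.
have De : eta * D = e by rewrite /eta divfK// gt_eqF.
have E : (1 + eta / h0) * mu = mu + eta * (mu / h0) by ring.
rewrite E in J; apply: le_trans (lerD J (lexx _)) _.
rewrite -addrA -mulrDr lerD2l -De ler_pM2l// /D addrC -addrA [X in _ <= X]addrA lerDl//.
Qed.

(* Both the shift invariance and the telescoping with 2 sin (pi / 2N) come from
   |sin| having period pi. *)
Lemma sum_abs_sin (N : nat) (x : R) : (0 < N)%N ->
  \sum_(l < N) `|sin (x + pi * l%:R / N%:R)| <= (sin (pi / (2 * N%:R)))^-1.
Proof.
move=> N0; have NR0 : (0 : R) < N%:R by rewrite ltr0n.
have Nn0 : (N%:R : R) != 0 by rewrite gt_eqF.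
pose S (x : R) : R := \sum_(l < N) `|sin (x + pi * l%:R / N%:R)|.
rewrite -/(S x).
have shift1 (y : R) : S (y + pi / N%:R) = S y.
  pose g (l : nat) : R := `|sin (y + pi * l%:R / N%:R)|.
  have -> : S (y + pi / N%:R) = \sum_(l < N) g l.+1.
    by apply: eq_bigr => l _; rewrite /g -natr1; congr (`|sin _|); ring.
  have -> : S y = \sum_(l < N) g l by [].
  apply/eqP; rewrite -subr_eq0 -sumrB -(big_mkord xpredT (fun l => g l.+1 - g l)) telescope_sumr//.
  rewrite /g mulr0 mul0r addr0 mulfK//.
  by rewrite sinDpi normrN subrr.
have shiftn n (y : R) : S (y + n%:R * (pi / N%:R)) = S y.
  elim: n => [|n IH]; first by rewrite mul0r addr0.
  by rewrite -natr1 mulrDl mul1r addrA shift1.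
have pN0 : 0 < pi / N%:R :> R by rewrite divr_gt0// pi_gt0.
have sN : 0 < sin (pi / (2 * N%:R)) :> R.
  apply: sin_gt0_pi; rewrite divr_gt0 ?mulr_gt0 ?pi_gt0//=.
  rewrite ltr_pdivrMr ?mulr_gt0// ltr_pMr ?pi_gt0//.
  by rewrite -natrM ltr1n mul2n -addnn; case: (N) N0 => // n _; rewrite addSn addnS.
(* x is moved into [0, pi/N] by first adding a large multiple of pi/N *)
suff base (y : R) : 0 <= y -> y <= pi / N%:R -> S y <= (sin (pi / (2 * N%:R)))^-1.
  pose j := (Num.truncn (`|x| / (pi / N%:R))).+1.
  pose x' := x + j%:R * (pi / N%:R).
  have x'0 : 0 <= x'.
    have : `|x| / (pi / N%:R) < j%:R by rewrite /j truncnS_gt.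
    rewrite ltr_pdivrMr// => h; rewrite /x'.
    by have := ler_norm (- x); rewrite normrN; lra.
  pose i := Num.truncn (x' / (pi / N%:R)).
  have xi0 : 0 <= x' / (pi / N%:R) by rewrite divr_ge0// ltW.
  have /andP[i1 i2] := truncn_itv xi0.
  have e : x' = (x' - i%:R * (pi / N%:R)) + i%:R * (pi / N%:R) by rewrite subrK.
  have : S x' <= (sin (pi / (2 * N%:R)))^-1.
    rewrite e shiftn; apply: base.
      by rewrite subr_ge0 -ler_pdivlMr.
    by rewrite lerBlDl -{2}[pi / N%:R]mul1r -mulrDl natr1 -ler_pdivrMr// ltW.
  by rewrite /x' shiftn.
move=> y0 yN; set s := sin _ in sN *; rewrite -[leRHS]mul1r ler_pdivlMr//.
have -> : S y = \sum_(l < N) sin (y + pi * l%:R / N%:R).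
  apply: eq_bigr => l _; rewrite ger0_norm//; apply: sin_ge0_pi.
  rewrite addr_ge0 ?divr_ge0 ?mulr_ge0 ?pi_ge0 ?ler0n//=.
  have e : pi / N%:R + pi * (N%:R - 1) / N%:R = pi :> R by field.
  rewrite -[leRHS]e; apply: lerD => //; rewrite ler_pM2r ?invr_gt0// ler_pM2l ?pi_gt0//.
  by rewrite lerBrDr natr1 ler_nat.
pose G (l : nat) : R := - cos (y + pi * l%:R / N%:R - pi / (2 * N%:R)) / 2.
have tel (l : nat) : sin (y + pi * l%:R / N%:R) * s = G l.+1 - G l.
  rewrite /G /s; set u := y + _; set v := pi / (2 * N%:R).
  have -> : y + pi * l.+1%:R / N%:R - v = u + v.
    by rewrite /u /v -natr1; field; rewrite gt_eqF.
  by rewrite cosB cosD; field.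
rewrite mulr_suml; under eq_bigr => l _ do rewrite tel.
rewrite -(big_mkord xpredT (fun l => G l.+1 - G l)) telescope_sumr// /G.
rewrite mulr0 mul0r addr0 mulfK//.
have -> : y + pi - pi / (2 * N%:R) = (y - pi / (2 * N%:R)) + pi by ring.
rewrite cosDpi; have := cos_le1 (y - pi / (2 * N%:R)); lra.
Qed.

(** The bound of [sum_abs_sin] divided by N tends to 2 / pi, the mean of |sin|; in the limit the
    polygons lose nothing against the integral. *)
Lemma roots_sin_limit (d : R) : 0 < d -> exists2 N : nat, (0 < N)%N &
  (N%:R * sin (pi / (2 * N%:R)))^-1 <= 2 / pi + d.
Proof.
move=> d0; have p0 := pi_gt0 R.
pose D := 2 / pi + d; have D0 : 0 < D by rewrite addr_gt0// divr_gt0.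
pose e := d / D; have e0 : 0 < e by rewrite divr_gt0.
have [r r0 H] := is_derive_local (is_derive_sin 0) e0.
pose N := (Num.truncn (pi / (2 * r))).+1.
exists N => //.
have NR0 : (0 : R) < N%:R by rewrite ltr0n.
set y := pi / (2 * N%:R).
have y0 : 0 < y by rewrite divr_gt0// mulr_gt0.
have yr : y < r.
  have : pi / (2 * r) < N%:R by rewrite /N truncnS_gt.
  rewrite ltr_pdivrMr ?mulr_gt0// /y ltr_pdivrMr ?mulr_gt0//.
  by have -> : r * (2 * N%:R) = N%:R * (2 * r) by ring.
have := H y; rewrite subr0 (gtr0_norm y0) => /(_ yr).
rewrite sin0 cos0 subr0 mul1r ler_norml => /andP[h _].
have h1 : (1 - e) * y <= sin y by lra.
have e1 : 1 - e = 2 / pi / D.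
  have aux (a b : R) : a + b != 0 -> 1 - b / (a + b) = a / (a + b) by move=> ?; field.
  by apply: aux; rewrite gt_eqF.
have e10 : 0 < 1 - e by rewrite e1 !divr_gt0.
have s0 : 0 < sin y by apply: lt_le_trans h1; rewrite mulr_gt0.
rewrite -[leRHS]invrK lef_pV2 ?posrE ?mulr_gt0 ?invr_gt0//.
apply: le_trans (ler_wpM2l (ltW NR0) h1).
rewrite e1 /y.
have aux (a b n : R) : a != 0 -> b != 0 -> n != 0 -> b^-1 = n * (2 / a / b * (a / (2 * n))).
  by move=> ? ? ?; field; do !(apply/andP; split).
by rewrite -aux// gt_eqF.
Qed.

End Jensen.

(** * Zeros that are too dense for the exponential type *)

Section Vanishing.
Variable R : realType.
Local Notation C := R[i]%C.
Local Notation "x %:C" := (Complex x 0 : C).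

(** The function (1 + x) exp (- x) - (1 - x) exp x increases from 0. At y = 1 / (2 N + 1) the
    right-hand side is (N + 1) / N, the ratio met in the induction for Stirling's bound. *)
Lemma expR_ratio (y : R) : 0 <= y -> y < 1 -> expR (2 * y) <= (1 + y) / (1 - y).
Proof.
move=> y0 y1.
have H : ac 0 y (fun x => (1 + x) * expR (- x) - (1 - x) * expR x)
   (fun x => x * (expR x - expR (- x))).
  have h1 := acM (acD (ac_cst 0 y 1) (ac_id 0 y)) (ac_exp (acN (ac_id 0 y))).
  have h2 := acM (acB (ac_cst 0 y 1) (ac_id 0 y)) (ac_exp (ac_id 0 y)).
  by apply: ac_eq_deriv (acB h1 h2) => x _; rewrite /=; ring.
have : (1 + 0) * expR (- 0) - (1 - 0) * expR 0 <= (1 + y) * expR (- y) - (1 - y) * expR y :> R.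
  apply: (ac_ge_ae y0 H); apply: aeW => x; rewrite in_itv /= => /andP[x0 _].
  by rewrite mulr_ge0 ?(ltW x0)// subr_ge0 ler_expR; lra.
rewrite oppr0 !addr0 expR0 !mulr1 subrr subr_ge0 => h.
rewrite ler_pdivlMr ?subr_gt0//.
have -> : expR (2 * y) * (1 - y) = (1 - y) * expR y * expR y.
  have -> : 2 * y = y + y by ring.
  by rewrite expRD; ring.
apply: le_trans (ler_wpM2r (expR_ge0 y) h) _.
by rewrite -mulrA -expRD addNr expR0 mulr1.
Qed.

(** The estimate n! <= e sqrt n (n / e)^n, squared to avoid the root. The induction step is e^2 <=
    ((N + 1) / N)^(2 N + 1). *)
Lemma stirling_lower (n : nat) : (0 < n)%N ->
  (n`!%:R) ^+ 2 * expR (2 * n%:R) <= expR 2 * n%:R * n%:R ^+ (2 * n) :> R.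
Proof.
case: n => // n _; elim: n => [|n IH].
  by rewrite (_ : 1`!%N = 1%N)// !expr1n mul1r !mulr1.
rewrite factS natrM exprMn -natr1 mulrDr mulr1 expRD.
set N : R := n.+1%:R in IH *.
have N0 : 0 < N by rewrite ltr0n.
have -> : (N + 1) ^+ 2 * (n.+1)`!%:R ^+ 2 * (expR (2 * N) * expR 2) =
  (N + 1) ^+ 2 * expR 2 * ((n.+1)`!%:R ^+ 2 * expR (2 * N)) by ring.
have p0 : 0 <= (N + 1) ^+ 2 * expR 2 by rewrite mulr_ge0 ?sqr_ge0 ?expR_ge0.
apply: le_trans (ler_wpM2l p0 IH) _.
have y0 : 0 <= (2 * N + 1)^-1 by rewrite invr_ge0; lra.
have y1 : (2 * N + 1)^-1 < 1 by rewrite invf_lt1; lra.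
have := expR_ratio y0 y1.
have -> : (1 + (2 * N + 1)^-1) / (1 - (2 * N + 1)^-1) = (N + 1) / N.
  by field; rewrite !gt_eqF//; lra.
move=> h.
have h2 : expR 2 <= ((N + 1) / N) ^+ (2 * n.+1).+1.
  have -> : expR 2 = expR (2 * (2 * N + 1)^-1) ^+ (2 * n.+1).+1 :> R.
    have eN : (2 * n.+1).+1%:R = 2 * N + 1 :> R by rewrite -[LHS]natr1 natrM.
    have N1 : 2 * N + 1 != 0 by rewrite gt_eqF//; lra.
    by rewrite -expRM_natl eN mulrC divfK.
  by rewrite lerXn2r ?nnegrE ?expR_ge0// divr_ge0//; lra.
have p1 : 0 <= (N + 1) ^+ 2 * expR 2 * N ^+ (2 * n.+1).+1.
  by rewrite mulr_ge0// exprn_ge0// ltW.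
have -> : (N + 1) ^+ 2 * expR 2 * (expR 2 * N * N ^+ (2 * n.+1)) =
   (N + 1) ^+ 2 * expR 2 * N ^+ (2 * n.+1).+1 * expR 2 by rewrite [N ^+ _.+1]exprS; ring.
apply: le_trans (ler_wpM2l p1 h2) _.
rewrite expr_div_n.
have aux (x e y z : R) : y != 0 -> x * e * y * (z / y) = e * (x * z) by move=> ?; field.
rewrite aux ?expf_neq0 ?gt_eqF// -exprD -mulrA -exprS.
by have -> : (2 + (2 * n.+1).+1 = (2 * n.+2).+1)%N by rewrite [(2 * n.+2)%N]mulnS addnS.
Qed.

Lemma sum_inv_sqr (n : nat) : \sum_(j < n) (j.+1%:R ^- 2) <= 2 :> R.
Proof.
case: n => [|n]; first by rewrite big_ord0.
suff : \sum_(j < n.+1) (j.+1%:R ^- 2) <= 2 - n.+1%:R^-1 :> R.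
  by move/le_trans; apply; rewrite gerBl invr_ge0 ler0n.
elim: n => [|n IH]; first by rewrite big_ord_recr big_ord0 /= add0r expr1n invr1; lra.
rewrite big_ord_recr /=; apply: le_trans (lerD IH (lexx _)) _.
rewrite -[n.+2%:R]natr1; set N : R := n.+1%:R.
have N0 : 0 < N by rewrite ltr0n.
rewrite -subr_ge0.
have -> : 2 - (N + 1)^-1 - (2 - N^-1 + (N + 1) ^- 2) = (N * (N + 1) ^+ 2)^-1.
  by field; rewrite !gt_eqF//; lra.
by rewrite invr_ge0 mulr_ge0 ?sqr_ge0// ltW.
Qed.

Lemma csqrt_exists (lam : C) : exists k : C, k ^+ 2 = lam /\ 0 <= Im k.
Proof.
have [h|h] := leP 0 (Im (sqrtc lam)).
  by exists (sqrtc lam); split => //; exact: sqr_sqrtc.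
exists (- sqrtc lam); rewrite sqrrN sqr_sqrtc; split => //.
by move: h; case: (sqrtc lam) => u v /= h; rewrite oppr_ge0 ltW.
Qed.

(** From k^2 - |k|^2 = k (k - conj k) = 2 i k Im k. It gives Im k in terms of lam = k^2 without a
    branch of the root. *)
Lemma im_normc (k : C) : 0 <= Im k ->
  2 * Im k * normc k = normc ((normc k ^+ 2)%:C - k ^+ 2).
Proof.
move=> t0; apply/eqP; rewrite -(eqrXn2 (n := 2)) ?normc_ge0 ?mulr_ge0 ?normc_ge0//.
rewrite exprMn !sqr_normc; apply/eqP.
by move: t0; case: k => u v /= _; rewrite expr2 /=; ring.
Qed.

Section Circle.
Variables (f : C -> C) (K b : R).
Hypothesis K0 : 0 < K.
Hypothesis b0 : 0 <= b.
Hypothesis fgrowth : forall k : C, 1 <= normc k -> 0 <= Im k ->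
  normc (f (k ^+ 2)) <= K * expR (2 * Im k * b) / normc k ^+ 2.

Lemma circle_bound (lam0 : C) : exists2 H : R, 0 < H & exists r0 : R, forall r a : R,
  r0 <= r -> 0 < r /\
  normc (f (lam0 + (r ^+ 2)%:C * cis a)) <= H / r ^+ 2 * expR (2 * b * r * `|sin (a / 2)|).
Proof.
pose L := normc lam0; have L0 : 0 <= L := normc_ge0 _.
(* The 2 bounds r^2 / |k|^2, and the exponential absorbs the increase of Im k by 3 L. *)
exists (2 * K * expR (6 * b * L)); first by rewrite !mulr_gt0// expR_gt0.
exists (2 * L + 2) => r a rr.
have r1 : 1 <= r by lra.
have rp : 0 < r by lra.
split=> //.
have rL : 2 * L + 2 <= r ^+ 2.
  by apply: le_trans rr _; rewrite expr2 ler_peMl// ltW.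
set lam := lam0 + _.
have [k [k2 t0]] := csqrt_exists lam.
set u := `|sin (a / 2)|; have u0 : 0 <= u by exact: normr_ge0.
pose m := normc k; pose t := Im k.
have m0 : 0 <= m := normc_ge0 _.
have nR : normc ((r ^+ 2)%:C * cis a) = r ^+ 2.
  by rewrite normcM normc_cis mulr1 normc_real ger0_norm ?sqr_ge0.
have mlam : m ^+ 2 = normc lam by rewrite -normcX k2.
have m2up : m ^+ 2 <= r ^+ 2 + L.
  by rewrite mlam; apply: le_trans (le_normcD _ _) _; rewrite nR addrC.
have m2lo : r ^+ 2 - L <= m ^+ 2.
  rewrite mlam lerBlDr -[X in X <= _]nR.
  have -> : (r ^+ 2)%:C * cis a = lam - lam0 by rewrite /lam addrC addKr.
  by apply: le_trans (le_normcD _ _) _; rewrite normcN.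
have m1 : 1 <= m by apply: le_of_sqr => //; rewrite expr1n; lra.
have tm : t <= m by apply: le_trans (ler_norm _) (norm_Im_le _).
have h1 : 2 * t * m <= 2 * L + 2 * r ^+ 2 * u.
  rewrite /t /m (im_normc t0) -/m k2.
  have -> : (m ^+ 2)%:C - lam = (m ^+ 2 - r ^+ 2)%:C + ((r ^+ 2)%:C * (1 - cis a) - lam0).
    rewrite /lam mulrBr mulr1.
    have -> : (m ^+ 2 - r ^+ 2)%:C = (m ^+ 2)%:C - (r ^+ 2)%:C.
      by apply/eqP; rewrite eq_complex /= subrr !eqxx.
    ring.
  apply: le_trans (le_normcD _ _) _; apply: le_trans (lerD (lexx _) (le_normcD _ _)) _.
  rewrite normcN -/L normcM !normc_real (ger0_norm (sqr_ge0 r)).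
  rewrite -normcN opprB normc_cisB1 -/u.
  have : `|m ^+ 2 - r ^+ 2| <= L by rewrite ler_norml; apply/andP; split; lra.
  have -> : r ^+ 2 * (2 * u) = 2 * r ^+ 2 * u by ring.
  lra.
have rLr : L / r * r = L by rewrite divfK// gt_eqF.
have Lr0 : 0 <= L / r by rewrite divr_ge0// ltW.
have h2 : r - L / r <= m.
  have s0 : 0 <= r - L / r.
    by rewrite subr_ge0 ler_pdivrMr// -expr2; lra.
  apply: le_of_sqr => //; apply: le_trans m2lo.
  have -> : (r - L / r) ^+ 2 = r ^+ 2 - 2 * (L / r * r) + (L / r) * (L / r) by ring.
  rewrite rLr.
  have : L / r * (L / r) <= L.
    rewrite -[leRHS]rLr; apply: ler_wpM2l => //.
    by rewrite ler_pdivrMr// -expr2; lra.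
  lra.
have h3 : m <= 2 * r.
  apply: le_of_sqr => //; first by lra.
  by rewrite exprMn; lra.
have h4 : t * r <= r ^+ 2 * u + 3 * L.
  have e1 : t * (r - L / r) <= t * m by apply: ler_wpM2l.
  have e2 : t * (L / r) <= 2 * L.
    apply: (@le_trans _ _ (2 * r * (L / r))); last by rewrite -mulrA [r * _]mulrC rLr.
    by apply: ler_wpM2r => //; exact: le_trans h3.
  have -> : t * r = t * (r - L / r) + t * (L / r) by ring.
  lra.
have h5 : t <= r * u + 3 * L.
  rewrite -(ler_pM2r rp); apply: le_trans h4 _.
  have -> : (r * u + 3 * L) * r = r ^+ 2 * u + 3 * L * r by ring.
  by rewrite lerD2l ler_peMr// mulr_ge0.
rewrite -k2; apply: le_trans (fgrowth m1 t0) _; rewrite -/m -/t.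
have h6 : expR (2 * t * b) <= expR (6 * b * L) * expR (2 * b * r * u).
  rewrite -expRD ler_expR.
  have := ler_wpM2l b0 h5.
  have -> : 2 * t * b = 2 * (b * t) by ring.
  have -> : 6 * b * L + 2 * b * r * u = 2 * (b * (r * u + 3 * L)) by ring.
  lra.
have m2p : 0 < m ^+ 2 by rewrite exprn_gt0// (lt_le_trans ltr01).
rewrite ler_pdivrMr//.
apply: le_trans (ler_wpM2l (ltW K0) h6) _.
have -> : 2 * K * expR (6 * b * L) / r ^+ 2 * expR (2 * b * r * u) * m ^+ 2 =
   (K * (expR (6 * b * L) * expR (2 * b * r * u))) * (2 * m ^+ 2 / r ^+ 2) by ring.
have K0' := ltW K0; rewrite ler_peMr ?mulr_ge0 ?expR_ge0//.
by rewrite ler_pdivlMr ?exprn_gt0// mul1r; lra.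
Qed.

End Circle.

Lemma poly_approx_shift (f : C -> C) (c : C) : poly_approx f -> poly_approx (fun z => f (c + z)).
Proof.
move=> fa rho e e0; have [P HP] := fa (normc c + rho) e e0.
exists (P \Po ('X + c%:P)) => z zr.
rewrite horner_comp hornerD hornerX hornerC addrC [z + c]addrC.
rewrite addrC; apply: HP; apply: le_trans (le_normcD _ _) _.
by rewrite lerD2l.
Qed.

Lemma expR_sum (N : nat) (F : 'I_N -> R) : \prod_(l < N) expR (F l) = expR (\sum_(l < N) F l).
Proof.
by apply/esym; apply: (big_morph (@expR R)) => [x y|]; [exact: expRD | exact: expR0].
Qed.

(** The main part (n^n / n!)^2 is bounded below by Stirling's formula. The shift [c] costs at most a
    factor 1 + D / J^2 for the zero of number J, and the product of these factors is bounded because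
    the 1 / J^2 are summable. *)
Lemma prod_zeros_lower (n : nat) (A c : R) (z : nat -> C) (e : nat -> R) :
  (0 < n)%N -> 0 < A -> 0 <= c -> (forall j, z j != 0) -> (forall j, 0 <= e j) ->
  (forall j, normc (z j) <= (A * j.+1%:R) ^+ 2 * expR (2 * e j) + c) ->
  expR (2 * n%:R - 2 * (\sum_(j < n) e j) - 2 * (c / A ^+ 2)) / (expR 2 * n%:R) <=
  \prod_(j < n) ((A * n%:R) ^+ 2 / normc (z j)).
Proof.
move=> n0 A0 c0 z0 e0 zle.
have nR0 : (0 : R) < n%:R by rewrite ltr0n.
have A2 : 0 < A ^+ 2 by rewrite exprn_gt0.
pose D := c / A ^+ 2; have D0 : 0 <= D by rewrite divr_ge0// ltW.
have step (j : nat) : (n%:R / j.+1%:R) ^+ 2 * expR (- (2 * e j + D * j.+1%:R ^- 2)) <=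
    (A * n%:R) ^+ 2 / normc (z j).
  have J0 : (0 : R) < j.+1%:R by rewrite ltr0n.
  set J : R := j.+1%:R in J0 *.
  have zp : 0 < normc (z j) by rewrite lt_neqAle normc_ge0 andbT eq_sym normc_eq0.
  rewrite ler_pdivlMr// expRN mulrAC ler_pdivrMr ?expR_gt0//.
  rewrite expr_div_n mulrAC ler_pdivrMr ?exprn_gt0//.
  have h : normc (z j) <= (A * J) ^+ 2 * expR (2 * e j + D * J ^- 2).
    apply: le_trans (zle j) _; rewrite -/J expRD.
    have E1 : 1 <= expR (2 * e j) by rewrite -expR0 ler_expR mulr_ge0.
    have E2 : 1 + D * J ^- 2 <= expR (D * J ^- 2) by exact: expR_ge1Dx.
    have p1 : 0 <= (A * J) ^+ 2 * expR (2 * e j) by rewrite mulr_ge0 ?sqr_ge0 ?expR_ge0.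
    rewrite [leRHS]mulrA; apply: le_trans (ler_wpM2l p1 E2).
    rewrite mulrDr mulr1 lerD2l.
    have -> : (A * J) ^+ 2 * expR (2 * e j) * (D * J ^- 2) = c * expR (2 * e j).
      by rewrite /D; field; rewrite !gt_eqF.
    by rewrite ler_peMr.
  have := ler_wpM2l (sqr_ge0 (n%:R : R)) h.
  by move/le_trans; apply; rewrite le_eqVlt; apply/orP; left; apply/eqP; ring.
apply: le_trans (_ : \prod_(j < n) ((n%:R / j.+1%:R) ^+ 2 * expR (- (2 * e j + D * j.+1%:R ^- 2))) <= _); last first.
  apply: ler_prod => j _; rewrite step andbT mulr_ge0 ?sqr_ge0 ?expR_ge0//.
rewrite big_split /= expR_sum prodrXl.
have -> : \prod_(j < n) (n%:R / j.+1%:R) = n%:R ^+ n / n`!%:R :> R.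
  rewrite big_split /= prodr_const card_ord prodfV; congr (_ / _).
  elim: (n) => [|k IH]; first by rewrite big_ord0 fact0.
  by rewrite big_ord_recr /= IH factS natrM mulrC.
have st := stirling_lower n0.
have F0 : (0 : R) < n`!%:R by rewrite ltr0n fact_gt0.
have st2 : expR (2 * n%:R) / (expR 2 * n%:R) <= (n%:R ^+ n / n`!%:R) ^+ 2 :> R.
  rewrite expr_div_n -exprM mulnC ler_pdivrMr ?mulr_gt0 ?expR_gt0// mulrAC ler_pdivlMr ?exprn_gt0//.
  by move: st; rewrite mulrC [_ * n%:R ^+ _]mulrC.
rewrite -addrA expRD mulrAC.
have e1 : expR (- (2 * \sum_(j < n) e j) - 2 * (c / A ^+ 2)) <=
    expR (\sum_(j < n) - (2 * e j + D * j.+1%:R ^- 2)).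
  rewrite ler_expR sumrN big_split /= -!mulr_sumr opprD lerD2l lerN2 -/D mulrC.
  by apply: ler_wpM2r => //; exact: sum_inv_sqr.
apply: ler_pM => //; rewrite ?expR_ge0// divr_ge0 ?expR_ge0// mulr_ge0 ?expR_ge0// ltW//.
Qed.

(* The zeros mu j are at least as dense as those of a function of type sg in
   sqrt lam.  When sg = 2 b the exponentials in Jensen's inequality cancel, and
   the decay 1 / |k|^2 beats the factor n that is lost in Stirling's formula. *)
Theorem jensen_vanish (f : C -> C) (b sg K C0 C1 : R) (mu eps : nat -> R) :
  poly_approx f -> 0 < b -> 0 < sg -> 0 < K -> 0 <= C0 ->
  (forall k : C, 1 <= normc k -> 0 <= Im k ->
     normc (f (k ^+ 2)) <= K * expR (2 * Im k * b) / normc k ^+ 2) ->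
  injective mu ->
  (forall j, f (mu j)%:C = 0) ->
  (forall j, `|mu j| <= (pi / sg * j.+1%:R) ^+ 2 * expR (2 * `|eps j|) + C0) ->
  (forall n, \sum_(j < n) `|eps j| <= (1 - 2 * b / sg) * n%:R + C1) ->
  forall lam, f lam = 0.
Proof.
move=> fa b0 sg0 K0 C00 fg muI fmu mub epsb lam0.
apply/eqP; apply: contraT => f0.
have [H H0 [r0 Hc]] := circle_bound K0 (ltW b0) fg lam0.
pose A := pi / sg; have A0 : 0 < A by rewrite divr_gt0// pi_gt0.
pose c := C0 + normc lam0; have c0 : 0 <= c by rewrite addr_ge0// normc_ge0.
pose z j : C := (mu j)%:C - lam0.
have z0 j : z j != 0.
  by rewrite subr_eq0; apply: contraNneq f0 => <-; rewrite fmu.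
have zI : injective z by move=> i j /addIr [] /muI.
have zb j : normc (z j) <= (A * j.+1%:R) ^+ 2 * expR (2 * `|eps j|) + c.
  apply: le_trans (le_normcD _ _) _; rewrite normcN normc_real /c addrA lerD2r.
  exact: mub.
(* In the exponent, 2 is the loss in Stirling's bound and 1 that of the polygonal mean; the other
   terms account for the perturbation of the zeros. *)
pose M := H / A ^+ 2 * expR (3 + 2 * C1 + 2 * (c / A ^+ 2)).
have key n : (0 < n)%N -> r0 <= A * n%:R -> normc (f lam0) * n%:R <= M.
  move=> n0 rn; have [r_gt0 _] := Hc _ 0 rn.
  (* In the variable k this is the n-th unperturbed zero pi n / sg, so that the main part of
     Jensen's product becomes (n^n / n!)^2. *)
  set r := A * n%:R in rn r_gt0 *.
  have nR0 : (0 : R) < n%:R by rewrite ltr0n.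
  have b2r : 0 < 2 * b * r by apply: mulr_gt0 => //; exact: mulr_gt0.
  (* With this tolerance the polygonal mean of the exponent exceeds 4 b n / sg by at most 1. *)
  have d0 : 0 < (2 * b * r)^-1 by rewrite invr_gt0.
  have [N N0 HN] := roots_sin_limit d0.
  set sN := sin _ in HN.
  have NR0 : (0 : R) < N%:R by rewrite ltr0n.
  have r2 : 0 < r ^+ 2 by rewrite exprn_gt0.
  pose h a := H / r ^+ 2 * expR (2 * b * r * `|sin (a / 2)|).
  pose m := H / r ^+ 2 * expR (2 * b * r * (N%:R * sN)^-1).
  have Hr0 : 0 < H / r ^+ 2 by rewrite divr_gt0.
  have m0 : 0 <= m by rewrite mulr_ge0 ?expR_ge0// ltW.
  have hh a : H / r ^+ 2 <= h a.
    rewrite /h -[leLHS]mulr1; apply: ler_wpM2l; first exact: ltW.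
    by rewrite -[leLHS]expR0 ler_expR; apply: mulr_ge0 => //; exact: ltW.
  have fh a : normc (f (lam0 + (r ^+ 2)%:C * cis a)) <= h a by have [_] := Hc r a rn.
  have prodh a : \prod_(l < N) h (a + 2 * pi * l%:R / N%:R) <= m ^+ N.
    rewrite big_split /= expR_sum prodr_const card_ord (exprMn N (H / r ^+ 2)); apply: ler_wpM2l.
      by rewrite exprn_ge0// ltW.
    rewrite -mulr_sumr -expRM_natl ler_expR.
    have -> : N%:R * (2 * b * r / (N%:R * sN)) = 2 * b * r * sN^-1.
      by rewrite invfM mulrCA (mulrA N%:R) divff ?mul1r// gt_eqF.
    apply: ler_wpM2l; first exact: ltW.
    apply: le_trans (sum_abs_sin (a / 2) N0); apply: ler_sum => l _.
    by rewrite le_eqVlt; apply/orP; left; apply/eqP; congr (`|sin _|); field; rewrite gt_eqF.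
  pose zs := [seq z j | j <- iota 0 n].
  have := @jensen R _ zs (r ^+ 2) m (H / r ^+ 2) h N (poly_approx_shift lam0 fa) r2 N0 m0.
  move=> /(_ _ _ _ Hr0 hh fh prodh) J.
  have {J} : normc (f lam0) * \prod_(z <- zs) (r ^+ 2 / normc z) <= m.
    rewrite -{1}[lam0]addr0; apply: J.
    - by rewrite map_inj_uniq// iota_uniq.
    - by apply/mapP => -[j _ zj]; move: (z0 j); rewrite -zj eqxx.
    - by move=> _ /mapP [j _ ->]; rewrite /z addrC subrK.
  rewrite big_map (_ : iota 0 n = index_iota 0 n); last by rewrite /index_iota subn0.
  rewrite big_mkord => J.
  have low := @prod_zeros_lower n A c z (fun j => `|eps j|) n0 A0 c0 z0 (fun j => normr_ge0 _) zb.
  have {}J := le_trans (ler_wpM2l (normc_ge0 (f lam0)) low) J.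
  have mle : m <= H / r ^+ 2 * expR (4 * b * n%:R / sg + 1).
    rewrite /m; apply: ler_wpM2l; first exact: ltW.
    rewrite ler_expR; apply: le_trans (ler_wpM2l (ltW b2r) HN) _.
    rewrite mulrDr divff ?gt_eqF// lerD2r /r /A le_eqVlt; apply/orP; left; apply/eqP.
    have pin : (pi : R) != 0 by rewrite gt_eqF// pi_gt0.
    have sgn : sg != 0 by rewrite gt_eqF.
    clear -pin sgn; move: (pi : R) pin => p pn; field; by apply/andP; split.
  have {}J := le_trans J mle.
  have Sn := epsb n.
  set S := \sum_(j < n) _ in J Sn.
  have {}J : normc (f lam0) * expR (2 * n%:R - 2 * S - 2 * (c / A ^+ 2)) * (r ^+ 2) <=
      H * expR (4 * b * n%:R / sg + 1) * (expR 2 * n%:R).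
    have aux (x e w G rr y : R) : 0 < w -> 0 < rr -> x * (e / w) <= G / rr * y -> x * e * rr <= G * y * w.
      move=> w0 rr0 le; rewrite -(ler_pM2r w0) -(ler_pM2r rr0) in le.
      move: le; have -> : x * (e / w) * w * rr = x * e * rr by field; rewrite gt_eqF.
      by have -> : G / rr * y * w * rr = G * y * w by field; rewrite gt_eqF.
    by apply: aux J => //; apply: mulr_gt0 => //; exact: expR_gt0.
  (* Here the condition on [eps] enters: 2 n - 2 S is at least 4 b n / sg - 2 C1, which matches the
     growth on the circle. *)
  have low2 : expR (4 * b * n%:R / sg - 2 * C1 - 2 * (c / A ^+ 2)) <=
      expR (2 * n%:R - 2 * S - 2 * (c / A ^+ 2)).
    rewrite ler_expR lerD2r.
    have -> : 4 * b * n%:R / sg = 2 * n%:R - 2 * ((1 - 2 * b / sg) * n%:R).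
      by field; rewrite gt_eqF.
    lra.
  have {}J : normc (f lam0) * expR (4 * b * n%:R / sg - 2 * C1 - 2 * (c / A ^+ 2)) * (r ^+ 2) <=
      H * expR (4 * b * n%:R / sg + 1) * (expR 2 * n%:R).
    apply: le_trans J; rewrite ler_pM2r//; apply: ler_wpM2l => //; exact: normc_ge0.
  have E0 : 0 < expR (4 * b * n%:R / sg - 2 * C1 - 2 * (c / A ^+ 2)) * (A ^+ 2 * n%:R).
    by apply: mulr_gt0; [exact: expR_gt0|apply: mulr_gt0 => //; exact: exprn_gt0].
  rewrite -(ler_pM2r E0); apply: le_trans (_ : H * expR (4 * b * n%:R / sg + 1) * (expR 2 * n%:R) <= _).
    apply: le_trans J; rewrite /r le_eqVlt; apply/orP; left; apply/eqP; ring.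
  rewrite /M le_eqVlt; apply/orP; left; apply/eqP.
  transitivity (H * (expR (4 * b * n%:R / sg + 1) * expR 2) * n%:R); first by ring.
  transitivity (H * (expR (3 + 2 * C1 + 2 * (c / A ^+ 2)) *
     expR (4 * b * n%:R / sg - 2 * C1 - 2 * (c / A ^+ 2))) * n%:R).
    by rewrite -!expRD; congr (_ * expR _ * _); ring.
  have An : A != 0 by rewrite gt_eqF.
  move: (expR _) (expR _) => E1 E2; clear -An; field; exact: An.
have fp : 0 < normc (f lam0) by rewrite lt_neqAle normc_ge0 andbT eq_sym normc_eq0.
pose n := (Num.truncn (`|M| / normc (f lam0)) + Num.truncn (`|r0| / A)).+1.
have n1 : `|M| / normc (f lam0) < n%:R.
  apply: lt_le_trans (truncnS_gt _) _; by rewrite ler_nat ltnS leq_addr.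
have n2 : `|r0| / A < n%:R.
  apply: lt_le_trans (truncnS_gt _) _; by rewrite ler_nat ltnS leq_addl.
have : M < M.
  apply: (le_lt_trans (ler_norm M)); move: n1; rewrite ltr_pdivrMr// => n1.
  apply: lt_le_trans n1 _; rewrite mulrC; apply: key => //.
  by apply: le_trans (ler_norm _) _; move: n2; rewrite ltr_pdivrMr// mulrC => /ltW.
by rewrite ltxx.
Qed.

End Vanishing.

(** * Eigenvalue asymptotics from above *)

Section Prufer.
Variable R : realType.
Implicit Types (q y z : R -> R) (x la ka : R).

Lemma ac_pos f f' : ac 0 1 f f' -> 0 < f 0 ->
  (forall x : R, 0 <= x -> x <= 1 -> f x != 0) -> forall x, 0 <= x -> x <= 1 -> 0 < f x.
Proof.
move=> F f0 nz x x0 x1; rewrite ltNge; apply/negP => fx.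
have := ac_continuous (ac_sub (lexx 0) x1 F) => cf.
have [|c] := IVT x0 cf (v := 0).
  by rewrite ge_min le_max fx (ltW f0) orbT.
rewrite in_itv /= => /andP[c0 cx] fc.
by have := nz c c0 (le_trans cx x1); rewrite fc eqxx.
Qed.

(* The speed of the angle theta with tan theta = ka y / y', defined as an integral
   so that no branch of the arctangent has to be chosen; ka need not be tied to
   la, and ka = sqrt la gives the sharp lower bound for the angle at 1. *)
Definition prufer_speed q y z la ka x : R :=
  ka * (z x ^+ 2 + (la - q x) * y x ^+ 2) / (ka ^+ 2 * y x ^+ 2 + z x ^+ 2).

Definition prufer_angle q y z la ka x : R := prim (prufer_speed q y z la ka) x.

Variables (q y z : R -> R) (la ka : R).
Hypothesis iq : L1_01 q.
Hypothesis Hy : ac 0 1 y z.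
Hypothesis Hz : ac 0 1 z (fun x => (q x - la) * y x).
Hypothesis ka1 : 1 <= ka.
Let r2 x := ka ^+ 2 * y x ^+ 2 + z x ^+ 2.
Hypothesis r2_gt0 : forall x : R, 0 <= x -> x <= 1 -> 0 < r2 x.
Hypotheses (y0 : y 0 = 0) (z0 : z 0 = 1).

Let ka0 : 0 < ka. Proof. exact: lt_le_trans ka1. Qed.

Lemma L1_div_radius w w' M : ac 0 1 w w' ->
  (forall x, 0 <= x -> x <= 1 -> `|w x| <= M * r2 x) ->
  forall h, L1_01 h -> L1_01 (fun x => w x / r2 x * h x).
Proof.
move=> W bw h ih.
(* This form of the quotient makes its measurability evident. *)
have Er x : 0 <= x -> x <= 1 -> w x / r2 x = w x * expR (- ln (r2 x)).
  by move=> x0 x1; rewrite expRN lnK// posrE; exact: r2_gt0.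
apply: (L1_bounded_mul (M := M)) ih.
- apply: (eq_measurable_fun (fun x => w x * expR (- ln (r2 x)))).
    by move=> x; rewrite inE /= in_itv /= => /andP[x0 x1]; rewrite -Er.
  apply: measurable_funM; first exact: ac_measurable W.
  apply: (measurableT_comp (measurable_expR (R := R))).
  apply: measurableT_comp => //.
  apply: (measurableT_comp (measurable_ln (R := R))).
  exact: ac_measurable (acD (acZ (ka ^+ 2) (acM Hy Hy)) (acM Hz Hz)).
- by move=> x x0 x1; rewrite normrM normfV (gtr0_norm (r2_gt0 x0 x1)) ler_pdivrMr ?r2_gt0// bw.
Qed.

Let y2_le x : ka ^+ 2 * y x ^+ 2 <= r2 x. Proof. by rewrite lerDl sqr_ge0. Qed.
Let z2_le x : z x ^+ 2 <= r2 x. Proof. by rewrite lerDr; apply: mulr_ge0; exact: sqr_ge0. Qed.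
Let y2_le1 x : y x ^+ 2 <= r2 x.
Proof.
apply: le_trans (y2_le x); rewrite ler_peMl ?sqr_ge0//; exact: exprn_ege1.
Qed.

Lemma L1_prufer_speed : L1_01 (prufer_speed q y z la ka).
Proof.
have Wy := acM Hy Hy; have Wz := acM Hz Hz.
have I1 : L1_01 (fun x => (z x * z x + la * (y x * y x)) / r2 x * ka).
  apply: (L1_div_radius (M := 1 + `|la|) (acD Wz (acZ la Wy))); last exact: L1_cst.
  move=> x x0 x1; apply: le_trans (ler_normD _ _) _; rewrite mulrDl mul1r -!expr2.
  apply: lerD; first by rewrite ger0_norm ?sqr_ge0.
  by rewrite normrM; apply: ler_wpM2l => //; rewrite ger0_norm ?sqr_ge0.
have I2 : L1_01 (fun x => (- ka * (y x * y x)) / r2 x * q x).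
  apply: (L1_div_radius (M := ka) (acZ (- ka) Wy)) => // x x0 x1.
  by rewrite normrM normrN (gtr0_norm ka0) ler_pM2l// -expr2 ger0_norm ?sqr_ge0.
have := L1D I1 I2; congr (L1_01 _); apply/funext => x; rewrite /prufer_speed /r2.
by move: (_^-1) => w; ring.
Qed.

Let theta := prufer_angle q y z la ka.

Lemma ac_prufer_angle : ac 0 1 theta (prufer_speed q y z la ka).
Proof. exact: ac_prim L1_prufer_speed. Qed.

Lemma prufer_angle0 : theta 0 = 0. Proof. exact: prim0. Qed.

(** The difference of the two sides solves a homogeneous linear equation with the integrable
    coefficient [g] and vanishes at 0. *)
Lemma prufer_tangent x : 0 <= x -> x <= 1 ->
  ka * y x * cos (theta x) = z x * sin (theta x).
Proof.
move=> x0 x1; apply/eqP; rewrite -subr_eq0; apply/eqP.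
have Ht := ac_prufer_angle.
have Hf := acB (acM (acZ ka Hy) (ac_cos Ht)) (acM Hz (ac_sin Ht)).
pose g x := y x * z x / r2 x * (ka ^+ 2 - la + q x).
have ig : L1_01 g.
  apply: (L1_div_radius (M := 1) (acM Hy Hz)); last exact: L1D (L1_cst _) iq.
  move=> t t0 t1; rewrite normrM mul1r.
  have h1 : `|y t| ^+ 2 <= ka ^+ 2 * y t ^+ 2.
    by rewrite real_normK ?num_real// ler_peMl ?sqr_ge0//; exact: exprn_ege1.
  have h2 : `|z t| ^+ 2 = z t ^+ 2 by rewrite real_normK ?num_real.
  have h3 : 0 <= (`|y t| - `|z t|) ^+ 2 by exact: sqr_ge0.
  have h4 := normr_ge0 (y t); have h5 := normr_ge0 (z t).
  rewrite /r2; nra.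
have := ac_const_ae (acM Hf (ac_exp (acN (ac_prim ig)))) => H.
have {}H : (ka * y x * cos (theta x) - z x * sin (theta x)) * expR (- prim g x) =
   (ka * y 0 * cos (theta 0) - z 0 * sin (theta 0)) * expR (- prim g 0).
  apply: H => //; apply: aeW => t; rewrite in_itv /= => /andP[/ltW t0 /ltW t1].
  have r0 : r2 t != 0 by rewrite gt_eqF// r2_gt0.
  rewrite /prufer_speed /g -/(r2 t); move: r0; rewrite /r2.
  move: (cos (theta t)) (sin (theta t)) (expR (- prim _ t)) (y t) (z t) (q t) => c s E a b d r0.
  by field; rewrite exprMn.
move: H; rewrite y0 prufer_angle0 sin0 !mulr0 mul0r subrr mul0r => /eqP.
by rewrite mulf_eq0 => /orP[/eqP //|]; rewrite gt_eqF ?expR_gt0.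
Qed.

(** The tangent fixes the angle only modulo pi. This quantity p satisfies (ka y, z) = p (sin theta,
    cos theta) and never vanishes, and its value 1 at 0 decides the sign. *)
Lemma prufer_radius_gt0 x : 0 <= x -> x <= 1 ->
  0 < ka * y x * sin (theta x) + z x * cos (theta x).
Proof.
have Ht := ac_prufer_angle.
apply: (ac_pos (acD (acM (acZ ka Hy) (ac_sin Ht)) (acM Hz (ac_cos Ht)))).
  by rewrite y0 prufer_angle0 cos0 z0 mulr0 mul0r add0r mul1r.
move=> t t0 t1; apply/negP => /eqP p0.
have := r2_gt0 t0 t1; suff -> : r2 t = 0 by rewrite ltxx.
have f0 := prufer_tangent t0 t1; have cs := cos2Dsin2 (theta t).
have -> : r2 t = (ka * y t * sin (theta t) + z t * cos (theta t)) ^+ 2 +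
    (ka * y t * cos (theta t) - z t * sin (theta t)) ^+ 2.
  transitivity ((ka ^+ 2 * y t ^+ 2 + z t ^+ 2) * (cos (theta t) ^+ 2 + sin (theta t) ^+ 2)).
    by rewrite cs mulr1.
  ring.
by rewrite p0 f0 subrr !expr0n addr0.
Qed.

Lemma prufer_zero x : 0 <= x -> x <= 1 -> sin (theta x) = 0 -> y x = 0.
Proof.
move=> x0 x1 s0; have := prufer_tangent x0 x1; rewrite s0 mulr0 => /eqP.
rewrite mulf_eq0 mulf_eq0 gt_eqF//= => /orP[/eqP //|/eqP c0].
by have := cos2Dsin2 (theta x); rewrite s0 c0 !expr0n addr0 => /eqP; rewrite eq_sym oner_eq0.
Qed.

(** For la = ka^2 the speed is ka - ka q y^2 / r2, and y^2 / r2 is at most 1 / ka^2. *)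
Lemma prufer_angle_lower : la = ka ^+ 2 -> ka - L1norm q / ka <= theta 1.
Proof.
move=> lak.
have H := acB (acZ ka (ac_id 0 1)) (acZ ka^-1 (ac_prim (L1_norm iq))).
have := ac_leD ler01 H ac_prufer_angle; rewrite prufer_angle0 !prim0 !mulr0 !subr0 mulr1.
rewrite (mulrC ka^-1) => -> //; apply: aeW => x; rewrite in_itv /= => /andP[/ltW x0 /ltW x1].
rewrite /prufer_speed -/(r2 x) lak ler_pdivlMr ?r2_gt0//.
have kk : ka * ka^-1 = 1 by rewrite divff ?gt_eqF.
have h1 : q x * (ka * y x ^+ 2) <= `|q x| * (ka * y x ^+ 2).
  apply: ler_wpM2r; [by apply: mulr_ge0; [exact: ltW|exact: sqr_ge0]|exact: ler_norm].
have h2 : 0 <= ka^-1 * `|q x| * z x ^+ 2.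
  by apply: mulr_ge0; [apply: mulr_ge0 => //; rewrite invr_ge0 ltW|exact: sqr_ge0].
have -> : (ka - ka^-1 * `|q x|) * r2 x =
   ka * r2 x - `|q x| * (ka * y x ^+ 2) * (ka * ka^-1) - ka^-1 * `|q x| * z x ^+ 2.
  by rewrite /r2; ring.
rewrite kk; move: h1 h2; rewrite /r2; lra.
Qed.

(** Where the angle equals pi, y vanishes and z is negative, against the positivity of z + t y. *)
Lemma prufer_angle_upper t : 0 < t ->
  (forall x, 0 <= x -> x <= 1 -> 0 < z x + t * y x) -> theta 1 < pi.
Proof.
move=> t0 pos; rewrite ltNge; apply/negP => th.
have ct := ac_continuous ac_prufer_angle.
have [|x] := IVT ler01 ct (v := pi).
  by rewrite ge_min le_max th -/theta prufer_angle0 pi_ge0 orbT.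
rewrite in_itv /= -/theta => /andP[x0 x1] thx.
have yx : y x = 0 by apply: prufer_zero => //; rewrite thx sinpi.
have := pos x x0 x1; have := prufer_radius_gt0 x0 x1.
rewrite thx cospi yx; lra.
Qed.

End Prufer.

(** * Real solutions from 0 and their continuity in the spectral parameter *)

Section Shooting.
Variable R : realType.
Implicit Types (q : R -> R).
Local Notation C := R[i]%C.
Local Notation "x %:C" := (Complex x 0 : C).

(** The Wronskians with the fundamental system are constant, and together they express y and z at
    [x] through the data at 0. *)
Lemma csol_unique q lam y1 z1 y2 z2 : L1_01 q -> csol q lam y1 z1 -> csol q lam y2 z2 ->
  y1 0 = y2 0 -> z1 0 = z2 0 -> forall x : R, 0 <= x -> x <= 1 -> y1 x = y2 x /\ z1 x = z2 x.
Proof.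
move=> iq h1 h2 ey ez x x0 x1.
have [c [c' [s [s' [hc hs h0 _]]]]] := fundamental_system iq.
have [c0 c0' s0 s0'] := h0 lam.
have wc y z : csol q lam y z -> c lam x * z x - c' lam x * y x = z 0.
  by move=> h; rewrite (wronskian_const (hc lam) h x0 x1 (lexx 0) ler01) c0 c0' mul1r mul0r subr0.
have ws y z : csol q lam y z -> s lam x * z x - s' lam x * y x = - y 0.
  by move=> h; rewrite (wronskian_const (hs lam) h x0 x1 (lexx 0) ler01) s0 s0' mul1r mul0r sub0r.
have w1 : c lam x * s' lam x - c' lam x * s lam x = 1 by rewrite (wc _ _ (hs lam)).
have yE y z : csol q lam y z -> y x = s lam x * z 0 + c lam x * y 0.
  move=> h; rewrite -[LHS](mulr1 (y x)) -w1 -(wc _ _ h) -[y 0]opprK -(ws _ _ h); ring.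
have zE y z : csol q lam y z -> z x = s' lam x * z 0 + c' lam x * y 0.
  move=> h; rewrite -[LHS](mulr1 (z x)) -w1 -(wc _ _ h) -[y 0]opprK -(ws _ _ h); ring.
by rewrite (yE _ _ h1) (yE _ _ h2) (zE _ _ h1) (zE _ _ h2) ey ez.
Qed.

Lemma csol_real q (la : R) (y z : R -> R) : ac 0 1 y z -> ac 0 1 z (fun x => (q x - la) * y x) ->
  csol q la%:C (fun x => (y x)%:C) (fun x => (z x)%:C).
Proof.
move=> hy hz; split; split => //=; try exact: ac_cst.
- by apply: ac_eq_deriv hz => x _; rewrite /=; ring.
- by apply: ac_eq_deriv (ac_cst 0 1 (0 : R)) => x _; rewrite /=; ring.
Qed.

Lemma csol_Re q (la : R) y z : csol q la%:C y z ->
  ac 0 1 (fun x => Re (y x)) (fun x => Re (z x)) /\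
  ac 0 1 (fun x => Re (z x)) (fun x => (q x - la) * Re (y x)).
Proof.
move=> [[hy _] [hz _]]; split => //; apply: ac_eq_deriv hz => x _.
by case: (y x) => a b /=; ring.
Qed.

Lemma poly_approx_continuous_Re (f : C -> C) : poly_approx f ->
  continuous (fun a : R => Re (f a%:C)).
Proof.
move=> fa a; apply/cvgrPdist_le => e e0.
have e3 : 0 < e / 3 by rewrite divr_gt0.
have [P HP] := fa (`|a| + 1) _ e3.
pose p := \poly_(i < size P) Re P`_i.
have pE x : Re P.[x%:C] = p.[x].
  rewrite horner_poly horner_coef.
  rewrite (big_morph Re (id1 := 0) (op1 := +%R)) //; last by move=> [u v] [u' v'].
  apply: eq_bigr => i _; have -> : x%:C ^+ i = (x ^+ i)%:C.
    elim: {i}(nat_of_ord i) => [|i IH]; first by rewrite !expr0.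
    by rewrite !exprS IH; apply/eqP; rewrite eq_complex /=; apply/andP; split; apply/eqP; ring.
  by case: (P`_i) => u v /=; ring.
have cp : {for a, continuous (horner p)} by exact: continuous_horner.
have /cvgrPdist_le /(_ _ e3) H := cp.
have near1 : \forall x \near a, `|a - x| <= 1 by move/cvgrPdist_le : (@cvg_id _ (nbhs a)) => /(_ 1 ltr01).
have close x : `|x| <= `|a| + 1 -> `|Re (f x%:C) - p.[x]| <= e / 3.
  move=> xa; rewrite -pE; have := HP x%:C; rewrite normc_real => /(_ xa).
  apply: le_trans; apply: le_trans (norm_Re_le _).
  by case: (f _) => ? ?; case: (P.[_]).
near=> x.
have hx : `|x| <= `|a| + 1.
  rewrite -[x in `|x|](subKr a); apply: le_trans (ler_normB _ _) _; rewrite lerD2l.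
  by near: x.
have hp : `|p.[a] - p.[x]| <= e / 3 by near: x.
have := close x hx; have := close a (ler_wpDr ler01 (lexx _)); move: hp.
rewrite !ler_norml => /andP[? ?] /andP[? ?] /andP[? ?]; apply/andP; split; lra.
Unshelve. all: by end_near.
Qed.

Lemma real_shooting q : L1_01 q -> exists y z : R -> R -> R, [/\
  forall la, ac 0 1 (y la) (z la),
  forall la, ac 0 1 (z la) (fun x => (q x - la) * y la x),
  forall la, y la 0 = 0 /\ z la 0 = 1,
  forall la x, 0 <= x -> x <= 1 -> 0 < y la x ^+ 2 + z la x ^+ 2 &
  forall x, 0 <= x -> x <= 1 -> continuous (y ^~ x) /\ continuous (z ^~ x)].
Proof.
move=> iq; have [c [c' [s [s' [hc hs h0 hp]]]]] := fundamental_system iq.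
pose y la x := Re (s la%:C x); pose z la x := Re (s' la%:C x).
have hyz la := csol_Re (hs la%:C).
exists y, z; split.
- by move=> la; have [] := hyz la.
- by move=> la; have [] := hyz la.
- by move=> la; rewrite /y /z; have [_ _ -> ->] := h0 la%:C.
- move=> la x x0 x1; rewrite lt_neqAle addr_ge0 ?sqr_ge0// andbT eq_sym.
  apply/negP; rewrite paddr_eq0 ?sqr_ge0// !sqrf_eq0 => /andP[/eqP y0 /eqP z0].
  have [h1 h2] := hyz la.
  have := wronskian_const (hc la%:C) (csol_real h1 h2) x0 x1 (lexx 0) ler01.
  have [-> -> s0 s0'] := h0 la%:C; rewrite -/(y la x) -/(z la x) y0 z0 s0 s0' /=.
  rewrite -[Complex 0 0]/(0 : C) -[Complex 1 0]/(1 : C).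
  by rewrite !mulr0 mulr1 !subr0 => /eqP; rewrite eq_sym oner_eq0.
- move=> x x0 x1; have [_ _ p1 p2] := hp x x0 x1.
  by split; [exact: (poly_approx_continuous_Re p1)|exact: (poly_approx_continuous_Re p2)].
Qed.

End Shooting.

Section Counting.
Variable R : realType.
Implicit Types (q : R -> R).
Local Notation mu := (@lebesgue_measure R).

(** Dominated convergence, with [ka] fixed while la varies; [ka] being at least 1, the denominator
    dominates y^2 and z^2. *)
Lemma prufer_angle_continuous q (y z : R -> R -> R) (ka : R) : L1_01 q -> 1 <= ka ->
  (forall la, ac 0 1 (y la) (z la)) ->
  (forall la, ac 0 1 (z la) (fun x => (q x - la) * y la x)) ->
  (forall la x, 0 <= x -> x <= 1 -> 0 < ka ^+ 2 * y la x ^+ 2 + z la x ^+ 2) ->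
  (forall x, 0 <= x -> x <= 1 -> continuous (y ^~ x) /\ continuous (z ^~ x)) ->
  continuous (fun la => prufer_angle q (y la) (z la) la ka 1).
Proof.
move=> iq ka1 hy hz r0 cyz la0.
have ka0 : 0 < ka by exact: lt_le_trans ka1.
pose L := `|la0| + 1.
pose g x := ka * (1 + L + `|q x|).
have ig : L1_01 g.
  have := L1D (L1_cst (ka * (1 + L))) (L1_bounded_mul (u := fun=> ka) (M := `|ka|)
    (measurable_cst _) (fun _ _ _ => lexx _) (L1_norm iq)).
  by congr (L1_01 _); apply/funext => x; rewrite /g [RHS]mulrDr.
have := @continuity_under_integral R _ _ mu
  (fun la x => prufer_speed q (y la) (z la) la ka x) `[0, 1] (measurable_itv _)
  (la0 - 1) (la0 + 1) _ _ g ig.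
have inI : la0 \in (`]la0 - 1, la0 + 1[%classic : set R).
  by rewrite inE /= in_itv /=; apply/andP; split; lra.
move=> H; apply: (H _ _ _ la0 inI) => {H}.
  - by move=> la _; apply: (L1_prufer_speed iq (hy la) (hz la) ka1 (r0 la)).
  - apply: aeW => x /=; rewrite in_itv /= => /andP[x0 x1] la _.
    have [cy cz] := cyz x x0 x1.
    have cy2 := continuousM (cy la) (cy la); have cz2 := continuousM (cz la) (cz la).
    have cl : {for la, continuous (fun l : R => l)} by exact: cvg_id.
    rewrite /prufer_speed.
    apply: (@continuousM _ _ (fun l => ka * (z l x ^+ 2 + (l - q x) * y l x ^+ 2))
       (fun l => (ka ^+ 2 * y l x ^+ 2 + z l x ^+ 2)^-1)).
      apply: (@continuousM _ _ (fun=> ka)); first exact: cst_continuous.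
      apply: (@continuousD _ _ _ (fun l => z l x ^+ 2)); first exact: cz2.
      apply: (@continuousM _ _ (fun l => l - q x)); last exact: cy2.
      apply: (@continuousB _ _ _ (fun l => l)) => //; exact: cst_continuous.
    apply: continuousV; first by rewrite gt_eqF// r0.
    apply: (@continuousD _ _ _ (fun l => ka ^+ 2 * y l x ^+ 2)); last exact: cz2.
    by apply: (@continuousM _ _ (fun=> ka ^+ 2)); [exact: cst_continuous|exact: cy2].
  - move=> la /=; rewrite in_itv /= => /andP[l1 l2].
    apply: aeW => x /=; rewrite in_itv /= => /andP[x0 x1].
    have r := r0 la x x0 x1.
    have laL : `|la| <= L.
      rewrite -[la](subrK la0) addrC; apply: le_trans (ler_normD _ _) _; rewrite lerD2l.
      by rewrite ler_norml; apply/andP; split; lra.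
    rewrite /prufer_speed normrM normfV (gtr0_norm r) ler_pdivrMr// normrM (gtr0_norm ka0).
    rewrite /g -mulrA; apply: ler_wpM2l; first exact: ltW.
    have y2 : 0 <= y la x ^+ 2 by exact: sqr_ge0.
    have z2 : 0 <= z la x ^+ 2 by exact: sqr_ge0.
    have k2 : 1 <= ka ^+ 2 by exact: exprn_ege1.
    have ry : y la x ^+ 2 <= ka ^+ 2 * y la x ^+ 2 + z la x ^+ 2 by nra.
    have rz : z la x ^+ 2 <= ka ^+ 2 * y la x ^+ 2 + z la x ^+ 2 by nra.
    apply: le_trans (ler_normD _ _) _; rewrite (normrM (la - q x)) !(ger0_norm y2) (ger0_norm z2).
    rewrite -addrA mulrDl mul1r; apply: lerD => //.
    apply: ler_pM => //; apply: le_trans (ler_normB _ _) _; exact: lerD.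
Qed.

End Counting.

Section Eigenvalues.
Variable R : realType.
Implicit Types (q : R -> R).
Local Notation mu := (@lebesgue_measure R).

Lemma shooting_eigenfunction q (la : R) (y z : R -> R) : ac 0 1 y z ->
  ac 0 1 z (fun x => (q x - la) * y x) -> y 0 = 0 ->
  (forall x, 0 <= x -> x <= 1 -> 0 < y x ^+ 2 + z x ^+ 2) -> y 1 = 0 ->
  dirichlet_eigenfunction q la y.
Proof.
move=> hy hz y0 r0 y1.
have dy := ac_C1 hy hz.
have d1 x : x \in `]0, 1[ -> derive1 y x = z x.
  by move=> /dy h; rewrite derive1E; exact: derive_val.
have nearI (x : R) : x \in `]0, 1[ -> \forall t \near x, t \in `]0, 1[%R by exact: near_in_itvoo.
have /continuous_within_itvP := ac_continuous hy => /(_ ltr01) [_ cy0 cy1].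
split => //.
- by split => // x /dy [].
- move=> e e0; have [d d0 H] := hz.1 e e0; exists d => // n u v uv sub tri len.
  have inI i t : t \in `[u i, v i] -> t \in `]0, 1[%R by move=> ti; apply: (sub i).
  rewrite (eq_bigr (fun i => `|z (v i) - z (u i)|)).
    apply: H => // i t ti; have := inI i t ti; rewrite /= !in_itv /= => /andP[/ltW-> /ltW->] //.
  move=> i _; rewrite !d1//; apply: (inI i); rewrite in_itv /= lexx (uv i)//.
- apply: ae_impl hz.2 => x h /= xI; have hx := h xI.
  have hx' : is_derive x (1 : R) (derive1 y) ((q x - la) * y x).
    apply: (near_eq_is_derive (f := z)) hx.
    by near=> t; rewrite d1//; near: t; exact: nearI.
  split; first by case: hx'.
  by rewrite [derive1 (derive1 y) x]derive1E (@derive_val _ _ _ _ _ _ _ hx'); ring.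
- apply: contrapT => no.
  have yz x : 0 <= x -> x <= 1 -> y x = 0.
    move=> x0 x1; apply/eqP/negPn/negP => yx; apply: no; exists x => //=.
    by rewrite in_itv /= x0 x1.
  have h01 : (2^-1 : R) \in `]0, 1[ by rewrite in_itv /=; apply/andP; split; lra.
  have z0 : z 2^-1 = 0.
    rewrite -d1// derive1E (near_eq_derive (g := fun=> 0)) ?derive_cst//.
    near=> t; have : t \in `]0, 1[ by near: t; exact: nearI.
    by rewrite in_itv /= => /andP[/ltW ? /ltW ?]; exact: yz.
  have := r0 2^-1; rewrite z0 yz ?expr0n ?addr0 ?ltxx; [|lra|lra].
  by move=> H; have : false by apply: H; lra.
Unshelve. all: by end_near.
Qed.

(** At lam = - t^2, that is, wave number i t, energy + flux is (z + t y)^2. Its lower bound is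
    positive as soon as t exceeds [M], so z + t y keeps its initial sign. *)
Lemma no_low_eigenvalue q : L1_01 q -> exists2 t : R, 1 <= t & forall y z : R -> R,
  ac 0 1 y z -> ac 0 1 z (fun x => (q x - - t ^+ 2) * y x) -> y 0 = 0 -> z 0 = 1 ->
  forall x : R, 0 <= x -> x <= 1 -> 0 < z x + t * y x.
Proof.
move=> iq; pose N := L1norm q; pose M := 3 * N * expR N.
have N0 : 0 <= N := L1norm_ge0 iq.
have M0 : 0 <= M by apply: mulr_ge0; [exact: mulr_ge0|exact: expR_ge0].
exists (2 * M + 1); first by rewrite lerDr mulr_ge0.
set t := 2 * M + 1.
have t1 : 1 <= t by rewrite lerDr mulr_ge0.
have t0 : 0 < t by exact: lt_le_trans t1.
move=> y z hy hz y0 z0; apply: (ac_pos (acD hz (acZ t hy))).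
  by rewrite z0 y0 mulr0 addr0.
move=> x x0 x1; apply/negP => /eqP v0.
have C0 : ac 0 1 (fun=> 0 : R) (fun=> 0 : R) := ac_cst 0 1 0.
have hz' : ac 0 1 z (fun x => (q x - (0 ^+ 2 - t ^+ 2)) * y x + 2 * 0 * t * 0).
  by apply: ac_eq_deriv hz => s _; ring.
have hi : ac 0 1 (fun=> 0 : R) (fun x => (q x - (0 ^+ 2 - t ^+ 2)) * 0 - 2 * 0 * t * y x).
  by apply: ac_eq_deriv C0 => s _; ring.
have t2 : t ^+ 2 = 0 ^+ 2 + t ^+ 2 by rewrite expr0n add0r.
have := energy_flux_lower iq hy C0 hz' hi (ltW t0) t0 t2 t1 y0 (erefl _) z0 (erefl _) x0 x1.
have -> : energy y (fun=> 0) z (fun=> 0) t x + flux y (fun=> 0) z (fun=> 0) 0 t x = (z x + t * y x) ^+ 2.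
  by rewrite /energy /flux; ring.
rewrite v0 expr0n leNgt => /negP; apply; apply: mulr_gt0; first exact: expR_gt0.
rewrite subr_gt0 -[_ * expR _]/M ltr_pdivrMr// mul1r /t; lra.
Qed.

(* The angle at 1 is below pi for la very negative and at least pi n at la = ka^2,
   so it takes the n values pi, ..., pi n, each at an eigenvalue below ka^2. *)
Theorem spectrum_bound q (lam : nat -> R) : L1_01 q -> dirichlet_spectrum q lam ->
  exists2 C0 : R, 0 <= C0 & forall n, (0 < n)%N -> `|lam n| <= (pi * n%:R) ^+ 2 + C0.
Proof.
move=> iq [lamS lamE]; pose N := L1norm q.
have N0 : 0 <= N := L1norm_ge0 iq.
(* The last term takes care of negative eigenvalues; 2 N + N^2 is the excess of ka^2 over (pi
   n)^2. *)
exists (2 * N + N ^+ 2 + `|lam 1%N|).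
  by apply: addr_ge0 => //; apply: addr_ge0; [exact: mulr_ge0|exact: sqr_ge0].
move=> n n0.
have lam_mono i j : (0 < i)%N -> (i <= j)%N -> lam i <= lam j.
  by move=> i0; rewrite leq_eqVlt => /orP[/eqP->//|ij]; apply: ltW; exact: lamS.
have low : lam 1%N <= lam n by exact: lam_mono.
suff up : lam n <= (pi * n%:R) ^+ 2 + (2 * N + N ^+ 2).
  have P : 0 <= (pi * n%:R : R) ^+ 2 by exact: sqr_ge0.
  have Q : 0 <= N ^+ 2 by exact: sqr_ge0.
  have h1 := ler_norm (lam 1%N); have h2 := ler_norm (- lam 1%N); rewrite normrN in h2.
  rewrite ler_norml; apply/andP; split; lra.
pose p : R := pi * n%:R.
have p1 : 1 <= p.
  have : (1 : R) <= n%:R by rewrite ler1n.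
  have := pi_ge2 R; rewrite /p; nra.
have p0 : 0 < p by exact: lt_le_trans p1.
have Np : 0 <= N / p by apply: divr_ge0 => //; exact: ltW.
(* Just enough above p = pi n for the guaranteed angle ka - N / ka to reach p. *)
pose ka := p + N / p.
have ka1 : 1 <= ka by rewrite /ka; lra.
have ka0 : 0 < ka by exact: lt_le_trans ka1.
have kap : p <= ka - N / ka.
  rewrite lerBrDl -lerBrDr; apply: le_trans (_ : N / p <= _); last by rewrite /ka; lra.
  by rewrite ler_wpM2l// lef_pV2 ?posrE// /ka lerDl.
have ka2 : ka ^+ 2 <= p ^+ 2 + (2 * N + N ^+ 2).
  have -> : ka ^+ 2 = p ^+ 2 + (2 * N + (N / p) ^+ 2) by rewrite /ka; field; rewrite gt_eqF.
  rewrite !lerD2l ler_sqr ?nnegrE// ler_pdivrMr// ler_peMr//.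
apply: le_trans ka2.
have [y [z [hy hz h0 r0 cyz]]] := real_shooting iq.
have r0' la x : 0 <= x -> x <= 1 -> 0 < ka ^+ 2 * y la x ^+ 2 + z la x ^+ 2.
  move=> x0 x1; apply: lt_le_trans (r0 la x x0 x1) _; rewrite lerD2r ler_peMl ?sqr_ge0//.
  exact: exprn_ege1.
pose th la := prufer_angle q (y la) (z la) la ka 1.
have cth : continuous th by exact: prufer_angle_continuous.
have [t t1 Ht] := no_low_eigenvalue iq.
have t0 : 0 < t by exact: lt_le_trans t1.
have thl : th (- t ^+ 2) < pi.
  have [y0 z0] := h0 (- t ^+ 2).
  apply: (prufer_angle_upper iq (hy _) (hz _) ka1 (r0' _) y0 z0 t0).
  exact: Ht (hy _) (hz _) y0 z0.
have thu : p <= th (ka ^+ 2).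
  have [y0 z0] := h0 (ka ^+ 2).
  apply: le_trans kap _.
  exact: (prufer_angle_lower iq (hy _) (hz _) ka1 (r0' _)).
have ex i : (i < n)%N -> exists k, [/\ (0 < k)%N, lam k <= ka ^+ 2 & th (lam k) = pi * i.+1%:R].
  move=> ni.
  have ip : (pi : R) <= pi * i.+1%:R by rewrite ler_peMr ?pi_ge0// ler1n.
  have ip' : pi * i.+1%:R <= p by rewrite /p ler_wpM2l ?pi_ge0// ler_nat.
  have tk : - t ^+ 2 <= ka ^+ 2.
    by apply: le_trans (sqr_ge0 ka); rewrite oppr_le0 sqr_ge0.
  have [|la] := IVT tk (continuous_subspaceT cth) (v := pi * i.+1%:R).
    rewrite ge_min le_max (le_trans (ltW thl) ip)/=.
    by rewrite (le_trans ip' thu) orbT.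
  rewrite in_itv /= => /andP[_ lak] thla.
  have [y0 z0] := h0 la.
  have y1 : y la 1 = 0.
    apply: (prufer_zero iq (hy la) (hz la) ka1 (r0' la) y0) => //.
    rewrite -/(th la) thla.
    elim: (i.+1) => [|k IH]; first by rewrite mulr0 sin0.
    by rewrite -natr1 mulrDr mulr1 sinD IH sinpi mul0r mulr0 addr0.
  have : [set mu | dirichlet_eigenvalue q mu] la.
    exists (y la); apply: (shooting_eigenfunction (hy la) (hz la)) => //; exact: r0.
  by rewrite lamE => -[k /= k0 klam]; exists k; rewrite klam.
have ex' i : exists k, (i < n)%N -> [/\ (0 < k)%N, lam k <= ka ^+ 2 & th (lam k) = pi * i.+1%:R].
  by case: (ltnP i n) => [/ex [k]|_]; [exists k|exists 0%N].
have [idx idxP] := boolp.choice ex'.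
(* Were lam n above ka^2, the n eigenvalues found, distinct because their angles are, would have
   their indices among 1, ..., n - 1. *)
rewrite leNgt; apply/negP => big.
have idx_lt i : (i < n)%N -> (idx i < n)%N.
  move=> /idxP [_ le _]; rewrite ltnNge; apply/negP => /(lam_mono _ _ n0) h.
  by move: big; rewrite ltNge (le_trans h le).
have : (size [seq idx i | i <- iota 0 n] <= size (iota 1 n.-1))%N.
  apply: uniq_leq_size.
    rewrite map_inj_in_uniq ?iota_uniq// => i j; rewrite !mem_iota /= add0n => hi hj ij.
    have [_ _ ti] := idxP i hi; have [_ _] := idxP j hj; rewrite -ij ti => /eqP.
    rewrite (inj_eq (mulfI _)); last by rewrite gt_eqF// pi_gt0.
    by rewrite eqr_nat eqSS => /eqP.
  move=> k /seq.mapP [i ii ->]; move: ii; rewrite mem_iota /= add0n => hi.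
  have [h _ _] := idxP i hi; rewrite mem_iota h /= add1n prednK//; exact: idx_lt.
by rewrite size_map !size_iota -ltnS prednK// ltnn.
Qed.

End Eigenvalues.

(** * Vanishing of the Wronskian *)

Section EigenfunctionSolution.
Variable R : realType.
Implicit Types (q : R -> R).
Local Notation C := R[i]%C.
Local Notation "x %:C" := (Complex x 0 : C).

(** The open interval is not compact, but each point is joined to 1/2 by steps shorter than [d]
    whose number depends on [d] alone. *)
Lemma abs_cont_oo_bounded (g : R -> R) : abs_continuous_on `]0, 1[ g ->
  exists2 M : R, 0 <= M & forall x : R, x \in `]0, 1[ -> `|g x| <= M.
Proof.
move=> ag; have [d d0 H] := ag 1 ltr01.
have step (u v : R) : u \in `]0, 1[ -> v \in `]0, 1[ -> u <= v -> v - u < d -> `|g v - g u| <= 1.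
  rewrite !in_itv /= => /andP[u0 _] /andP[_ v1] uv vu; apply: ltW.
  have := H 1%N (fun=> u) (fun=> v); rewrite !big_ord_recl !big_ord0 !addr0; apply => //.
    move=> _ t /=; rewrite !in_itv /= => /andP[ut tv].
    by rewrite (lt_le_trans u0 ut) (le_lt_trans tv v1).
  by apply/trivIsetP => i j _ _; rewrite !ord1 eqxx.
have step' (u v : R) : u \in `]0, 1[ -> v \in `]0, 1[ -> `|v - u| < d -> `|g v - g u| <= 1.
  move=> u0 v0 h; case: (lerP u v) => [uv|/ltW vu].
    by apply: step => //; apply: le_lt_trans h; exact: ler_norm.
  by rewrite distrC; apply: step => //; apply: le_lt_trans h; rewrite distrC; exact: ler_norm.
have h0 : (2^-1 : R) \in `]0, 1[ by rewrite in_itv /=; apply/andP; split; lra.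
have ind n x : x \in `]0, 1[ -> `|x - 2^-1| < n%:R * d -> `|g x - g 2^-1| <= n%:R.
  elim: n x => [|n IH] x xI; first by rewrite mul0r normr_lt0.
  move=> xd; pose t : R := n%:R / n.+1%:R.
  have n1 : (0 : R) < n.+1%:R by rewrite ltr0n.
  have t0 : 0 <= t by rewrite divr_ge0.
  have t1 : 1 - t = n.+1%:R^-1 by rewrite /t -natr1; field; rewrite natr1 gt_eqF.
  have t2 : t < 1 by rewrite -subr_gt0 t1 invr_gt0.
  pose x' := 2^-1 + t * (x - 2^-1).
  have x'I : x' \in `]0, 1[.
    by move: xI; rewrite !in_itv /= /x' => /andP[a b]; apply/andP; split; nra.
  case: n IH xd @t n1 t0 t1 t2 @x' x'I => [|n] IH xd t n1 t0 t1 t2 x' x'I.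
    by move: xd; rewrite mul1r => xd; apply: step'.
  apply: le_trans (ler_distD (g x') _ _) _.
  have -> : n.+2%:R = 1 + n.+1%:R :> R by rewrite -[LHS]natr1 addrC.
  apply: lerD; last first.
    apply: IH => //; have -> : x' - 2^-1 = t * (x - 2^-1) by rewrite /x'; ring.
    by rewrite normrM (ger0_norm t0) /t mulrAC ltr_pdivrMr// -mulrA ltr_pM2l// mulrC.
  apply: step' => //; have -> : x - x' = n.+2%:R^-1 * (x - 2^-1) by rewrite -t1 /x'; ring.
  by rewrite normrM normfV (gtr0_norm n1) ltr_pdivrMl.
pose n := (Num.truncn d^-1).+1.
exists (`|g 2^-1| + n%:R); first by rewrite addr_ge0.
move=> x xI; rewrite -[g x](subrK (g 2^-1)) addrC; apply: le_trans (ler_normD _ _) _.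
rewrite lerD2l; apply: ind => //.
have nd : 1 < n%:R * d by rewrite -ltr_pdivrMr// div1r; exact: truncnS_gt.
apply: lt_trans nd; move: xI; rewrite in_itv /= ltr_norml => /andP[a b]; apply/andP; split; lra.
Qed.

(** A bounded derivative makes phi Lipschitz. Integrating (q - la) phi gives psi on the closed
    interval, normalized at 1/2; it agrees with phi' inside and supplies its boundary values. *)
Lemma eigenfunction_solution q la phi : L1_01 q -> dirichlet_eigenfunction q la phi ->
  exists psi : R -> R, ac 0 1 phi psi /\ ac 0 1 psi (fun x => (q x - la) * phi x).
Proof.
move=> iq [dphi apsi eqn _ _].
have [M M0 HM] := abs_cont_oo_bounded apsi.
have cphi := derivable_oo_LRcontinuous_within dphi.
have dphi' (x : R) : x \in `]0, 1[ -> is_derive x (1 : R) phi (derive1 phi x).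
  by move=> xI; rewrite derive1E; apply: derivableP; have [h _ _] := dphi; exact: (h x xI).
have lip (u v : R) : 0 <= u -> u <= v -> v <= 1 -> `|phi v - phi u| <= M * `|v - u|.
  move=> u0 uv v1; move: uv; rewrite le_eqVlt => /orP[/eqP ->|uv].
    by rewrite !subrr normr0 mulr0.
  have sub : `[u, v]%classic `<=` (`[0, 1]%classic : set R).
    move=> t /=; rewrite !in_itv /= => /andP[a b].
    by rewrite (le_trans u0 a) (le_trans b v1).
  have duv (x : R) : x \in `]u, v[ -> is_derive x (1 : R) phi (derive1 phi x).
    rewrite in_itv /= => /andP[a b]; apply: dphi'.
    by rewrite in_itv /= (le_lt_trans u0 a) (lt_le_trans b v1).
  have [x] := @MVT R phi (derive1 phi) u v uv duv (continuous_subspaceW sub cphi).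
  rewrite in_itv /= => /andP[a b] ->; rewrite normrM; apply: ler_wpM2r => //.
  by apply: HM; rewrite in_itv /= (le_lt_trans u0 a) (lt_le_trans b v1).
have aphi : abs_continuous_on `[0, 1] phi.
  apply: (abs_cont_lip2 (f := id) (g := fun=> 0) (L := M)) => //.
  - by move=> u v u0 uv v1; rewrite subrr normr0 addr0; exact: lip.
  - exact: (ac_id 0 1).1.
  - exact: (ac_cst 0 1 0).1.
have Aphi : ac 0 1 phi (derive1 phi) by split=> //; apply: aeW => x; exact: dphi'.
pose u x := (q x - la) * phi x.
have iu : L1_01 u.
  have := L1_acM Aphi (L1D iq (L1_cst (- la))); congr (L1_01 _).
  by apply/funext => x; rewrite /u mulrC.
have Au := ac_prim iu.
pose psi x := derive1 phi 2^-1 + (prim u x - prim u 2^-1).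
have Apsi : ac 0 1 psi u.
  have := acD (ac_cst 0 1 (derive1 phi 2^-1)) (acB Au (ac_cst 0 1 (prim u 2^-1))).
  by apply: ac_eq_deriv => x _; rewrite add0r subr0.
exists psi; split => //; apply: ac_eq_deriv Aphi => x xI.
(* On this closed interval inside []0, 1[], phi' - psi is absolutely continuous with derivative zero
   almost everywhere. *)
pose a := Num.min x 2^-1; pose b := Num.max x 2^-1.
move: (xI); rewrite in_itv /= => /andP[x0 x1].
have a0 : 0 < a by rewrite lt_min x0 invr_gt0 /=.
have b1 : b < 1 by rewrite gt_max x1 /=; lra.
have Aab : ac a b (derive1 phi) u.
  split.
    move=> e e0; have [d d0 H] := apsi e e0; exists d => // n l r lr sub tri len.
    apply: H => // i t ti; have := sub i t ti; rewrite /= !in_itv /= => /andP[h1 h2].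
    by rewrite (lt_le_trans a0 h1) (le_lt_trans h2 b1).
  apply: ae_impl eqn => t H; rewrite in_itv /= => /andP[h1 h2].
  have tI : `]0, 1[%classic t by rewrite /= in_itv /= (lt_trans a0 h1) (lt_trans h2 b1).
  have [h3 h4] := H tI; apply: DeriveDef => //.
  by rewrite -derive1E /u mulrBl -h4; ring.
have := ac_const_ae (acB Aab (ac_sub (ltW a0) (ltW b1) Apsi)) => H.
have {}H : derive1 phi x - psi x = derive1 phi 2^-1 - psi 2^-1.
  apply: H; rewrite ?le_max ?ge_min ?lexx ?orbT//.
  by apply: aeW => t _; rewrite subrr.
by move: H; rewrite {2}/psi subrr addr0 subrr => /eqP; rewrite subr_eq0 => /eqP.
Qed.

Lemma csolZ q lam k y z : csol q lam y z -> csol q lam (fun x => k * y x) (fun x => k * z x).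
Proof.
move=> [h1 h2]; split; first exact: cacZ.
by apply: cac_eq_deriv (cacZ k h2) => x _; ring.
Qed.

(** By uniqueness an eigenfunction is a multiple of y, and the factor is not 0 since the
    eigenfunction does not vanish identically. *)
Lemma eigenvalue_zero q (la : R) y z : L1_01 q -> dirichlet_eigenvalue q la ->
  csol q la%:C y z -> y 0 = 0 -> z 0 = 1 -> y 1 = 0.
Proof.
move=> iq [phi Hphi] hy y0 z0.
have [psi [h1 h2]] := eigenfunction_solution iq Hphi.
have [_ _ _ [phi0 phi1] [x xI phix]] := Hphi.
move: xI; rewrite /= in_itv /= => /andP[x0 x1].
have E t : 0 <= t -> t <= 1 -> (phi t)%:C = (psi 0)%:C * y t.
  move=> t0 t1.
  have [] := csol_unique iq (csol_real h1 h2) (csolZ (psi 0)%:C hy) _ _ t0 t1 => //.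
    by rewrite phi0 y0 mulr0.
  by rewrite z0 mulr1.
have := E 1 ler01 (lexx _); rewrite phi1 => /eqP; rewrite eq_sym mulf_eq0 => /orP[|/eqP//].
move=> /eqP k0; have := E x x0 x1; rewrite k0 mul0r => -[] /eqP.
by rewrite (negbTE phix).
Qed.

End EigenfunctionSolution.

Section Wronskian.
Variable R : realType.
Implicit Types (q : R -> R).
Local Notation C := R[i]%C.
Local Notation "x %:C" := (Complex x 0 : C).

Lemma poly_approx_bounded (f : C -> C) (rho : R) : poly_approx f ->
  exists2 M : R, 0 < M & forall lam, normc lam <= rho -> normc (f lam) <= M.
Proof.
move=> fa; have [P HP] := fa rho 1 ltr01.
pose S := \sum_(i < size P) normc P`_i * `|rho| ^+ i.
have S0 : 0 <= S by apply: sumr_ge0 => i _; apply: mulr_ge0; [exact: normc_ge0|exact: exprn_ge0].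
exists (1 + S); first by rewrite ltr_pwDl.
move=> lam lr; rewrite -[f lam](subrK P.[lam]); apply: le_trans (le_normcD _ _) _.
apply: lerD; first exact: HP.
rewrite horner_coef; apply: le_trans (normc_sum _ _) _; apply: ler_sum => i _.
rewrite normcM normcX; apply: ler_wpM2l; first exact: normc_ge0.
rewrite lerXn2r ?nnegrE ?normc_ge0//; apply: le_trans lr _; exact: ler_norm.
Qed.

Lemma poly_approxD (f g : C -> C) : poly_approx f -> poly_approx g ->
  poly_approx (fun lam => f lam + g lam).
Proof.
move=> fa ga rho e e0; have e2 : 0 < e / 2 by rewrite divr_gt0.
have [P HP] := fa rho _ e2; have [Q HQ] := ga rho _ e2.
exists (P + Q) => lam lr; rewrite hornerD opprD addrACA.
apply: le_trans (le_normcD _ _) _; rewrite [leRHS](splitr e).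
by apply: lerD; [exact: HP|exact: HQ].
Qed.

Lemma poly_approxM (f g : C -> C) : poly_approx f -> poly_approx g ->
  poly_approx (fun lam => f lam * g lam).
Proof.
move=> fa ga rho e e0.
have [M M0 HM] := poly_approx_bounded rho fa; have [N N0 HN] := poly_approx_bounded rho ga.
have eQ : 0 < Num.min 1 (e / (2 * M)) by rewrite lt_min ltr01 divr_gt0// mulr_gt0.
have N1 : 0 < N + 1 by rewrite addr_gt0.
have eP : 0 < e / (2 * (N + 1)) by rewrite divr_gt0// mulr_gt0.
have [P HP] := fa rho _ eP; have [Q HQ] := ga rho _ eQ.
exists (P * Q) => lam lr; rewrite hornerM.
have -> : f lam * g lam - P.[lam] * Q.[lam] =
   f lam * (g lam - Q.[lam]) + (f lam - P.[lam]) * Q.[lam] by ring.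
have := HQ lam lr; rewrite le_min => /andP[q1 q2].
apply: le_trans (le_normcD _ _) _; rewrite !normcM [leRHS](splitr e); apply: lerD.
  apply: le_trans (ler_pM (normc_ge0 _) (normc_ge0 _) (HM lam lr) q2) _.
  by rewrite le_eqVlt; apply/orP; left; apply/eqP; field; rewrite gt_eqF.
have Qn : normc Q.[lam] <= N + 1.
  rewrite -[Q.[lam]](subKr (g lam)); apply: le_trans (le_normcD _ _) _.
  by apply: lerD; [exact: HN|rewrite normcN].
apply: le_trans (ler_pM (normc_ge0 _) (normc_ge0 _) (HP lam lr) Qn) _.
by rewrite le_eqVlt; apply/orP; left; apply/eqP; field; rewrite gt_eqF.
Qed.

Lemma poly_approx_cst (c : C) : poly_approx (fun=> c).
Proof.
move=> rho e e0; exists c%:P => lam _; rewrite hornerC subrr.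
by rewrite normc0 ltW.
Qed.

Lemma poly_approxB (f g : C -> C) : poly_approx f -> poly_approx g ->
  poly_approx (fun lam => f lam - g lam).
Proof.
move=> fa ga; have := poly_approxD fa (poly_approxM (poly_approx_cst (-1)) ga).
by congr poly_approx; apply/funext => lam; rewrite mulN1r.
Qed.

Lemma wronskian_at_eigenvalue q1 q2 (b la : R) y1 z1 y2 z2 : L1_01 q1 -> L1_01 q2 ->
  0 <= b -> b <= 1 -> ae_eq_on `[b, 1] q1 q2 ->
  dirichlet_eigenvalue q1 la -> dirichlet_eigenvalue q2 la ->
  csol q1 la%:C y1 z1 -> csol q2 la%:C y2 z2 ->
  y1 0 = 0 -> z1 0 = 1 -> y2 0 = 0 -> z2 0 = 1 ->
  y1 b * z2 b - z1 b * y2 b = 0.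
Proof.
move=> i1 i2 b0 b1 eq12 e1 e2 h1 h2 y10 z10 y20 z20.
have H := cac_sub b0 (lexx 1) (wronskian_deriv h1 h2).
rewrite (cac_const H _ (lexx b) b1 b1 (lexx 1)).
  by rewrite (eigenvalue_zero i1 e1 h1)// (eigenvalue_zero i2 e2 h2)// mul0r mulr0 subr0.
apply: ae_impl eq12 => x hx; rewrite in_itv /= => /andP[/ltW x1 /ltW x2].
by rewrite hx ?subrr ?mul0r//= in_itv /= x1 x2.
Qed.

Lemma spectrum_eigenvalue q (lam : nat -> R) n : dirichlet_spectrum q lam -> (0 < n)%N ->
  dirichlet_eigenvalue q (lam n).
Proof.
move=> [_ E] n0; have : (lam @` [set n | (0 < n)%N]) (lam n) by exists n.
by rewrite -E.
Qed.

Theorem wronskian_vanishes q1 q2 (lam1 lam2 : nat -> R) (b sigma C1 : R)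
    (m : nat -> nat) (eps : nat -> R) (s1 s1' s2 s2' : C -> R -> C) :
  0 < b -> b < 1 -> 0 < sigma ->
  (forall i j : nat, (0 < i)%N -> (0 < j)%N -> m i = m j -> i = j) ->
  (forall j : nat, (0 < j)%N -> (m j)%:R = j%:R / sigma * (1 + eps j) :> R) ->
  (forall j : nat, (0 < j)%N -> `|eps j| < 1) ->
  (forall n, \sum_(j < n) `|eps j.+1| <= (1 - 2 * b / sigma) * n%:R + C1) ->
  L1_01 q1 -> L1_01 q2 -> dirichlet_spectrum q1 lam1 -> dirichlet_spectrum q2 lam2 ->
  ae_eq_on `[b, 1] q1 q2 ->
  (forall j : nat, (0 < j)%N -> lam1 (m j) = lam2 (m j)) ->
  (forall lam, csol q1 lam (s1 lam) (s1' lam)) -> (forall lam, csol q2 lam (s2 lam) (s2' lam)) ->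
  (forall lam, s1 lam 0 = 0 /\ s1' lam 0 = 1) -> (forall lam, s2 lam 0 = 0 /\ s2' lam 0 = 1) ->
  poly_approx (s1 ^~ b) -> poly_approx (s1' ^~ b) ->
  poly_approx (s2 ^~ b) -> poly_approx (s2' ^~ b) ->
  forall lam, s1 lam b * s2' lam b - s1' lam b * s2 lam b = 0.
Proof.
move=> b0 b1 sg0 minj hm heps hsum i1 i2 sp1 sp2 eq12 elam h1 h2 h10 h20 p1 p1' p2 p2'.
have m0 j : (0 < j)%N -> (0 < m j)%N.
  move=> j0; rewrite -(ltr_nat R) hm//; apply: mulr_gt0; first by rewrite divr_gt0// ltr0n.
  by have := heps j j0; rewrite ltr_norml => /andP[h _]; lra.
have [C0 C00 HC] := spectrum_bound i1 sp1.
have [K [K0 HK]] := wronskian_bound i1 i2.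
apply: (@jensen_vanish R _ b sigma K C0 C1 (fun j => lam1 (m j.+1)) (fun j => eps j.+1)) => //.
- by apply: poly_approxB; apply: poly_approxM.
- move=> k k1 t0; have [? ?] := h10 (k ^+ 2); have [? ?] := h20 (k ^+ 2).
  exact: (HK k _ _ _ _ b k1 t0 (ltW b0) (ltW b1) (h1 _) (h2 _)).
- have mono i j : (0 < i)%N -> (0 < j)%N -> lam1 i = lam1 j -> i = j.
    move=> i0 j0 e; apply/eqP; rewrite eqn_leq; apply/andP; split; rewrite leqNgt; apply/negP => h.
      by have := sp1.1 j i j0 h; rewrite e ltxx.
    by have := sp1.1 i j i0 h; rewrite e ltxx.
  move=> i j e; have := mono (m i.+1) (m j.+1) (m0 i.+1 isT) (m0 j.+1 isT) e.
  by move/(minj i.+1 j.+1 isT isT) => -[].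
- move=> j; have [? ?] := h10 (lam1 (m j.+1))%:C; have [? ?] := h20 (lam1 (m j.+1))%:C.
  apply: (wronskian_at_eigenvalue i1 i2 (ltW b0) (ltW b1) eq12 _ _ (h1 _) (h2 _)) => //.
    exact: spectrum_eigenvalue sp1 (m0 j.+1 isT).
  by rewrite elam//; exact: spectrum_eigenvalue sp2 (m0 j.+1 isT).
(* The inequality 1 + eps <= exp |eps| brings (pi m(j))^2 into the exponential form of the bound on
   the zeros. *)
- move=> j; apply: le_trans (HC _ (m0 j.+1 isT)) _; rewrite lerD2r hm//.
  have -> : pi * (j.+1%:R / sigma * (1 + eps j.+1)) = (pi / sigma * j.+1%:R) * (1 + eps j.+1) by ring.
  rewrite exprMn; apply: ler_wpM2l; first exact: sqr_ge0.
  rewrite expRM_natl lerXn2r ?nnegrE ?expR_ge0//.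
    by have := heps j.+1 isT; rewrite ltr_norml => /andP[h _]; lra.
  by apply: le_trans (expR_ge1Dx _); rewrite lerD2l; exact: ler_norm.
Qed.

End Wronskian.

(** * Recovering the potential *)

Section Liouville.
Variable R : realType.
Implicit Types (q : R -> R).
Local Notation C := R[i]%C.
Local Notation "x %:C" := (Complex x 0 : C).

(** The mean value bound on the circle |lam| = r^2, where each lam has a root of modulus r in the
    closed upper half-plane. The value at 0 is all that the comparison of the potentials needs. *)
Lemma liouville_at0 (f : C -> C) (K r0 : R) : poly_approx f ->
  (forall k : C, r0 <= normc k -> 0 <= Im k -> normc (f (k ^+ 2)) <= K / normc k) -> f 0 = 0.
Proof.
move=> fa H; apply/eqP; rewrite -normc_eq0; apply/eqP/le_anti; rewrite normc_ge0 andbT.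
apply/ler_addgt0Pr => e e0; rewrite add0r.
have e4 : 0 < e / 4 by rewrite divr_gt0.
pose r := `|r0| + `|K| / (e / 4) + 1.
have Ke : 0 <= `|K| / (e / 4) by rewrite divr_ge0// ltW.
have rp : 0 < r by have := normr_ge0 r0; rewrite /r; lra.
have rr0 : r0 <= r by have := ler_norm r0; rewrite /r; lra.
have Kr : K / r <= e / 4.
  rewrite ler_pdivrMr//; apply: le_trans (ler_norm _) _.
  by rewrite mulrC -ler_pdivrMr// /r; have := normr_ge0 r0; lra.
have [P HP] := fa (r ^+ 2) _ e4.
have cen : normc P.[0] <= e / 4 + e / 4.
  apply: (poly_center (rho := r ^+ 2)) => a.
  have nr : normc ((r ^+ 2)%:C * cis a) = r ^+ 2.
    by rewrite normcM normc_real normc_cis mulr1 ger0_norm ?sqr_ge0.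
  have [k [k2 k0]] := csqrt_exists ((r ^+ 2)%:C * cis a).
  have nk : normc k = r.
    apply/eqP; rewrite -(eqrXn2 (n := 2)) ?normc_ge0 ?(ltW rp)//.
    by rewrite -normcX k2 nr.
  have fk := H k; rewrite nk k2 in fk.
  have Pk := HP ((r ^+ 2)%:C * cis a); rewrite nr in Pk.
  rewrite -[P.[_]](subKr (f ((r ^+ 2)%:C * cis a))); apply: le_trans (le_normcD _ _) _.
  apply: lerD; first by apply: le_trans Kr; exact: fk.
  by rewrite normcN; exact: Pk.
have P0 : normc (f 0 - P.[0]) <= e / 4 by apply: HP; rewrite normc0 sqr_ge0.
rewrite -[f 0](subrK P.[0]); apply: le_trans (le_normcD _ _) _; lra.
Qed.

(** The solutions normalized at [b] are combinations of those normalized at 0. Because the Wronskian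
    is 1 no division occurs, and they remain entire in lam. *)
Lemma backward_solutions q (b : R) : L1_01 q -> 0 <= b -> b <= 1 ->
  exists s s' c c' d d' : C -> R -> C, [/\
    [/\ forall lam, csol q lam (s lam) (s' lam), forall lam, csol q lam (c lam) (c' lam) &
        forall lam, csol q lam (d lam) (d' lam)],
    forall lam, s lam 0 = 0 /\ s' lam 0 = 1,
    forall lam, [/\ c lam b = 1, c' lam b = 0, d lam b = 0 & d' lam b = 1],
    forall lam x, s lam x = s lam b * c lam x + s' lam b * d lam x &
    forall x, 0 <= x -> x <= 1 -> [/\ poly_approx (s ^~ x), poly_approx (s' ^~ x),
       poly_approx (c ^~ x) & poly_approx (d ^~ x)]].
Proof.
move=> iq b0 b1; have [u [u' [s [s' [hu hs h0 hp]]]]] := fundamental_system iq.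
have w lam : u lam b * s' lam b - u' lam b * s lam b = 1.
  have [a1 a2 a3 a4] := h0 lam.
  by rewrite (wronskian_const (hu lam) (hs lam) b0 b1 (lexx 0) ler01) a1 a2 a3 a4 mul1r mul0r subr0.
exists s, s'.
exists (fun lam x => s' lam b * u lam x - u' lam b * s lam x).
exists (fun lam x => s' lam b * u' lam x - u' lam b * s' lam x).
exists (fun lam x => u lam b * s lam x - s lam b * u lam x).
exists (fun lam x => u lam b * s' lam x - s lam b * u' lam x).
have csolB lam y1 z1 y2 z2 : csol q lam y1 z1 -> csol q lam y2 z2 ->
    csol q lam (fun x => y1 x - y2 x) (fun x => z1 x - z2 x).
  move=> [f1 f2] [g1 g2]; split; first exact: cacB.
  by apply: cac_eq_deriv (cacB f2 g2) => x _; rewrite mulrBr.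
split.
- by split => // lam; apply: csolB; apply: csolZ.
- by move=> lam; have [] := h0 lam.
- by move=> lam; split; rewrite -?(w lam) //; ring.
- by move=> lam x; rewrite -[LHS]mulr1 -(w lam); ring.
- move=> x x0 x1; have [? ? ? ?] := hp x x0 x1; have [? ? ? ?] := hp b b0 b1.
  by split => //; apply: poly_approxB; apply: poly_approxM.
Qed.

(* For large Im k, s1 b and s2 b are nonzero and, since the Wronskian of s1 and s2
   vanishes at b, the left-hand side is s1 x / s1 b * d2 x - s2 x / s2 b * d1 x,
   where the exponential factors cancel; for bounded Im k the bounds on c1, c2, d1
   and d2 suffice. *)
Lemma cross_bound q1 q2 (b x : R) : L1_01 q1 -> L1_01 q2 -> 0 < b -> b <= 1 ->
  0 <= x -> x <= b -> exists K r0 : R, forall k (s1 s1' c1 c1' d1 d1' s2 s2' c2 c2' d2 d2' : R -> C),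
  r0 <= normc k -> 0 <= Im k ->
  csol q1 (k ^+ 2) s1 s1' -> csol q1 (k ^+ 2) c1 c1' -> csol q1 (k ^+ 2) d1 d1' ->
  csol q2 (k ^+ 2) s2 s2' -> csol q2 (k ^+ 2) c2 c2' -> csol q2 (k ^+ 2) d2 d2' ->
  s1 0 = 0 -> s1' 0 = 1 -> s2 0 = 0 -> s2' 0 = 1 ->
  [/\ c1 b = 1, c1' b = 0, d1 b = 0 & d1' b = 1] ->
  [/\ c2 b = 1, c2' b = 0, d2 b = 0 & d2' b = 1] ->
  s1 x = s1 b * c1 x + s1' b * d1 x -> s2 x = s2 b * c2 x + s2' b * d2 x ->
  s1 b * s2' b - s1' b * s2 b = 0 ->
  normc (c1 x * d2 x - c2 x * d1 x) <= K / normc k.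
Proof.
move=> i1 i2 b0 b1 x0 xb.
pose N := L1norm q1 + L1norm q2.
have N1 : L1norm q1 <= N by rewrite lerDl L1norm_ge0.
have N2 : L1norm q2 <= N by rewrite lerDr L1norm_ge0.
have N0 : 0 <= N by apply: addr_ge0; exact: L1norm_ge0.
(* Beyond this threshold t b >= 1, so that exp (- 4 t b) is at most 1/4 and the lower bound for s(b)
   applies. *)
pose T := b^-1; have T0 : 0 < T by rewrite invr_gt0.
(* The first term serves the strip t <= T; the second is twice the bound 8 exp (3 N) for one
   quotient. *)
pose K := 2 * expR (2 * (T + N)) + 16 * expR (3 * N).
(* Makes 3 N exp N / |k| at most 1/8. *)
pose r0 := 1 + 24 * N * expR N.
exists K, r0 => k s1 s1' c1 c1' d1 d1' s2 s2' c2 c2' d2 d2' kr t0 hs1 hc1 hd1 hs2 hc2 hd2.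
move=> s10 s10' s20 s20' [c1b c1b' d1b d1b'] [c2b c2b' d2b d2b'] E1 E2 W.
have NE : 0 <= N * expR N by apply: mulr_ge0 => //; exact: expR_ge0.
have k1 : 1 <= normc k by apply: le_trans kr; rewrite /r0 lerDl -mulrA mulr_ge0.
have kp : 0 < normc k by exact: lt_le_trans k1.
have x1 : x <= 1 by exact: le_trans xb b1.
set t := Im k in t0; set m := normc k in kr k1 kp *.
have up (a M : R) : M <= N -> expR (a + M) <= expR (a + N) by move=> MN; rewrite ler_expR lerD2l.
have [bd1 _] := sol_to_bound i1 hd1 kp t0 k1 x0 xb b1 d1b d1b'.
have [bd2 _] := sol_to_bound i2 hd2 kp t0 k1 x0 xb b1 d2b d2b'.
have bc1 := cosol_to_bound i1 hc1 kp t0 k1 x0 xb b1 c1b c1b'.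
have bc2 := cosol_to_bound i2 hc2 kp t0 k1 x0 xb b1 c2b c2b'.
have {}bd1 : normc (d1 x) <= expR (t * (b - x) + N) / m.
  by rewrite ler_pdivlMr// mulrC; apply: le_trans bd1 (up _ _ N1).
have {}bd2 : normc (d2 x) <= expR (t * (b - x) + N) / m.
  by rewrite ler_pdivlMr// mulrC; apply: le_trans bd2 (up _ _ N2).
have {}bc1 := le_trans bc1 (up (t * (b - x)) _ N1).
have {}bc2 := le_trans bc2 (up (t * (b - x)) _ N2).
have g0 (z : C) : 0 <= normc z := normc_ge0 z.
have [tT|/ltW Tt] := leP t T.
  have e1 : expR (t * (b - x) + N) <= expR (T + N).
    rewrite ler_expR lerD2r; apply: le_trans tT; rewrite ler_piMr//; lra.
  have prod (u v : C) : normc u <= expR (t * (b - x) + N) -> normc v <= expR (t * (b - x) + N) / m ->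
      normc (u * v) <= expR (2 * (T + N)) / m.
    move=> hu hv; rewrite normcM; apply: le_trans (ler_pM (g0 _) (g0 _) hu hv) _.
    rewrite mulrA ler_pM2r ?invr_gt0// (_ : 2 * (T + N) = (T + N) + (T + N)); last by ring.
    rewrite [leRHS]expRD.
    by apply: ler_pM => //; exact: expR_ge0.
  apply: le_trans (le_normcD _ _) _; rewrite normcN.
  apply: le_trans (lerD (prod _ _ bc1 bd2) (prod _ _ bc2 bd1)) _.
  rewrite -mulrDl ler_pM2r ?invr_gt0// /K.
  have := expR_ge0 (3 * N); have := expR_ge0 (2 * (T + N)); lra.
have low (q : R -> R) s s' : L1_01 q -> L1norm q <= N -> csol q (k ^+ 2) s s' -> s 0 = 0 -> s' 0 = 1 ->
    expR (t * b - N) / 8 <= m * normc (s b) /\ m * normc (s x) <= expR (t * x + N).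
  move=> iq qN hs z0 z1; split.
    apply: le_trans (_ : expR (t * b - L1norm q) / 8 <= _).
      by rewrite ler_pM2r ?invr_gt0// ler_expR lerD2l lerN2.
    apply: (sol_from0_lower iq hs kp t0 k1 (ltW b0) b1 z0 z1).
      have tb : 1 <= t * b by rewrite -ler_pdivrMr// div1r.
      rewrite expRN lef_pV2 ?posrE ?expR_gt0//; apply: le_trans (expR_ge1Dx _); lra.
    rewrite -/m ler_pdivrMr//; apply: le_trans (_ : 3 * (N * expR N) <= _).
      rewrite -(mulrA 3 (L1norm q)) ler_pM2l//; apply: ler_pM => //; [exact: L1norm_ge0|by rewrite ler_expR].
    have := kr; rewrite /r0 -mulrA; lra.
  have [h _] := sol_from_bound iq hs kp t0 k1 (lexx 0) x0 x1 z0 z1.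
  by apply: le_trans h _; rewrite subr0; exact: up.
have [l1 u1] := low _ _ _ i1 N1 hs1 s10 s10'.
have [l2 u2] := low _ _ _ i2 N2 hs2 s20 s20'.
have quot (s d : R -> C) : expR (t * b - N) / 8 <= m * normc (s b) -> m * normc (s x) <= expR (t * x + N) ->
    normc (d x) <= expR (t * (b - x) + N) / m ->
    s b != 0 /\ normc (s x * d x / s b) <= 8 * expR (3 * N) / m.
  move=> l u hd.
  have P : 0 < normc (s b).
    rewrite -(pmulr_rgt0 _ kp); apply: lt_le_trans l; apply: divr_gt0 => //; exact: expR_gt0.
  have sb : s b != 0 by rewrite -normc_eq0 gt_eqF.
  split => //.
  have -> : normc (s x * d x / s b) = normc (s x) * normc (d x) / normc (s b).
    have Pn : normc (s b) != 0 by rewrite gt_eqF.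
    by apply: (mulIf Pn); rewrite (divfK Pn) -!normcM (divfK sb).
  rewrite ler_pdivrMr//; apply: le_trans (_ : (expR (t * x + N) / m) * (expR (t * (b - x) + N) / m) <= _).
    by apply: ler_pM => //; rewrite ler_pdivlMr// mulrC.
  rewrite -(ler_pM2l kp) -(ler_pM2l kp).
  have -> : m * (m * (expR (t * x + N) / m * (expR (t * (b - x) + N) / m))) = expR (t * b + 2 * N).
    transitivity (expR (t * x + N) * expR (t * (b - x) + N)); last by rewrite -expRD; congr expR; ring.
    by field; rewrite gt_eqF.
  have -> : m * (m * (8 * expR (3 * N) / m * normc (s b))) = 8 * expR (3 * N) * (m * normc (s b)).
    by field; rewrite gt_eqF.
  apply: le_trans (ler_wpM2l _ l); last by apply: mulr_ge0 => //; exact: expR_ge0.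
  have -> : expR (t * b + 2 * N) = expR (3 * N) * expR (t * b - N) by rewrite -expRD; congr expR; ring.
  by rewrite le_eqVlt; apply/orP; left; apply/eqP; field.
have [n1 Q1] := quot _ d2 l1 u1 bd2.
have [n2 Q2] := quot _ d1 l2 u2 bd1.
have -> : c1 x * d2 x - c2 x * d1 x = s1 x * d2 x / s1 b - s2 x * d1 x / s2 b.
  apply: (mulfI n1); apply: (mulfI n2).
  have -> : s2 b * (s1 b * (s1 x * d2 x / s1 b - s2 x * d1 x / s2 b)) =
     s2 b * s1 x * d2 x - s1 b * s2 x * d1 x by field; rewrite n1 n2.
  rewrite E1 E2; apply/eqP; rewrite -subr_eq0; apply/eqP.
  transitivity (d1 x * d2 x * (s1 b * s2' b - s1' b * s2 b)); last by rewrite W mulr0.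
  ring.
apply: le_trans (le_normcD _ _) _; rewrite normcN.
apply: le_trans (lerD Q1 Q2) _.
rewrite -mulrDl ler_pM2r ?invr_gt0// /K.
have := expR_ge0 (3 * N); have := expR_ge0 (2 * (T + N)); lra.
Qed.

End Liouville.

(** * Comparison of the potentials at lam = 0 *)

Section Uniqueness.
Variable R : realType.
Implicit Types (q : R -> R).
Local Notation mu := (@lebesgue_measure R).
Local Notation C := R[i]%C.
Local Notation "x %:C" := (Complex x 0 : C).

Lemma is_derive_eq0 (a b x d : R) (f : R -> R) : (forall t, t \in `]a, b[ -> f t = 0) ->
  x \in `]a, b[ -> is_derive x (1 : R) f d -> d = 0.
Proof.
move=> f0 xI h; rewrite -(@derive_val _ _ _ _ _ _ _ h) (near_eq_derive (g := fun=> 0)) ?derive_cst//.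
by near=> t; apply: f0; near: t; exact: near_in_itvoo.
Unshelve. all: by end_near.
Qed.

Lemma cac_eq0 (a b : R) (f g : R -> C) : cac a b f g -> (forall t, t \in `]a, b[ -> f t = 0) ->
  {ae mu, forall x, x \in `]a, b[ -> g x = 0}.
Proof.
move=> [h1 h2] f0; apply: ae_impl2 h1.2 h2.2 => x d1 d2 xI.
apply/eqP; rewrite eq_complex /=; apply/andP; split; apply/eqP.
  by apply: (is_derive_eq0 _ xI (d1 xI)) => t /f0 ->.
by apply: (is_derive_eq0 _ xI (d2 xI)) => t /f0 ->.
Qed.

Lemma cac_C1_eq0 (a b : R) (f g h : R -> C) : cac a b f g -> cac a b g h ->
  (forall t, t \in `]a, b[ -> f t = 0) -> forall x, x \in `]a, b[ -> g x = 0.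
Proof.
move=> [f1 f2] [g1 g2] f0 x xI.
apply/eqP; rewrite eq_complex /=; apply/andP; split; apply/eqP.
  by apply: (is_derive_eq0 _ xI (ac_C1 f1 g1 xI)) => t /f0 ->.
by apply: (is_derive_eq0 _ xI (ac_C1 f2 g2 xI)) => t /f0 ->.
Qed.

Lemma ae_neq (a : R) : {ae mu, forall x, x <> a}.
Proof.
exists [set a]; split => //; first exact: lebesgue_measure_set1.
by move=> x /=; apply: contra_notP.
Qed.

(** Equal solutions have equal derivatives, and subtracting the two equations leaves (q1 - q2) y. *)
Lemma potential_difference_eq0 q1 q2 (b : R) y1 z1 y2 z2 : b <= 1 ->
  csol q1 0 y1 z1 -> csol q2 0 y2 z2 -> (forall x, x \in `]0, b[ -> y1 x = y2 x) ->
  {ae mu, forall x, x \in `]0, b[ -> (q1 x - q2 x)%:C * y1 x = 0}.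
Proof.
move=> b1 [h1 h1'] [h2 h2'] e.
have F := cac_sub (lexx 0) b1 (cacB h1 h2); have G := cac_sub (lexx 0) b1 (cacB h1' h2').
have z0 : forall x, x \in `]0, b[ -> z1 x - z2 x = 0.
  by apply: (cac_C1_eq0 F G) => t tI; rewrite e// subrr.
apply: ae_impl (cac_eq0 G z0) => x H xI; rewrite -(H xI) -(e x xI) !subr0 -mulrBl.
by congr (_ * _); apply/eqP; rewrite eq_complex /= subrr !eqxx.
Qed.

(* A = c1 d2' - c2' d1 satisfies c1 = A c2 and d1 = A d2, A^2 = 1 and A b = 1. *)
Theorem potentials_equal q1 q2 (b : R) c1 c1' d1 d1' c2 c2' d2 d2' : 0 < b -> b <= 1 ->
  csol q1 0 c1 c1' -> csol q1 0 d1 d1' -> csol q2 0 c2 c2' -> csol q2 0 d2 d2' ->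
  [/\ c1 b = 1, c1' b = 0, d1 b = 0 & d1' b = 1] ->
  [/\ c2 b = 1, c2' b = 0, d2 b = 0 & d2' b = 1] ->
  (forall x, 0 <= x -> x <= b -> c1 x * d2 x - c2 x * d1 x = 0) ->
  ae_eq_on `[0, b] q1 q2.
Proof.
move=> b0 b1 hc1 hd1 hc2 hd2 [c1b c1b' d1b d1b'] [c2b c2b' d2b d2b'] D0.
have bb := ltW b0.
have w1 x : 0 <= x -> x <= 1 -> c1 x * d1' x - c1' x * d1 x = 1.
  by move=> x0 x1; rewrite (wronskian_const hc1 hd1 x0 x1 bb b1) c1b c1b' d1b d1b' mul0r mulr1 subr0.
have w2 x : 0 <= x -> x <= 1 -> c2 x * d2' x - c2' x * d2 x = 1.
  by move=> x0 x1; rewrite (wronskian_const hc2 hd2 x0 x1 bb b1) c2b c2b' d2b d2b' mul0r mulr1 subr0.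
pose A x := c1 x * d2' x - c2' x * d1 x.
pose B x := c2 x * d1' x - c1' x * d2 x.
have inI x : x \in `]0, b[ -> [/\ 0 <= x, x <= b & x <= 1].
  rewrite in_itv /= => /andP[/ltW x0 /ltW xb]; split => //; exact: le_trans xb b1.
(* A - B is the derivative of c1 d2 - c2 d1, which is identically zero. *)
have AB x : x \in `]0, b[ -> A x = B x.
  move=> xI; apply/eqP; rewrite -subr_eq0; apply/eqP.
  have F := cacB (cacM hc1.1 hd2.1) (cacM hc2.1 hd1.1).
  have G := cacB (cacD (cacM hc1.2 hd2.1) (cacM hc1.1 hd2.2)) (cacD (cacM hc2.2 hd1.1) (cacM hc2.1 hd1.2)).
  have := cac_C1_eq0 (cac_sub (lexx 0) b1 F) (cac_sub (lexx 0) b1 G) _ xI.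
  move=> H; transitivity (c1' x * d2 x + c1 x * d2' x - (c2' x * d1 x + c2 x * d1' x)).
    by rewrite /A /B; ring.
  by apply: H => t /inI [t0 tb _]; exact: D0.
have A2 x : x \in `]0, b[ -> A x = 1 \/ A x = -1.
  move=> xI; have [x0 xb x1] := inI x xI.
  (* The product of the two Wronskians equals A B up to a multiple of c1 d2 - c2 d1. *)
  have : A x * B x = 1.
    transitivity ((c1 x * d1' x - c1' x * d1 x) * (c2 x * d2' x - c2' x * d2 x) +
       (c1 x * d2 x - c2 x * d1 x) * (c2' x * d1' x - c1' x * d2' x)).
      by rewrite /A /B; ring.
    by rewrite w1// w2// D0// mul0r addr0 mulr1.
  rewrite -AB// => /eqP; rewrite -expr2 sqrf_eq1 => /orP[] /eqP ->; [by left|by right].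
(* The real part of A is continuous and equals 1 at [b]; a value -1 would force a zero in
   between. *)
have A1 x : x \in `]0, b[ -> A x = 1.
  move=> xI; have [//|Am] := A2 x xI; exfalso.
  have [x0 xb x1] := inI x xI; move: (xI); rewrite in_itv /= => /andP[xp _].
  have [RA _] := cac_sub x0 b1 (cacB (cacM hc1.1 hd2.2) (cacM hc2.2 hd1.1)).
  have Ab : A b = 1 by rewrite /A c1b d2b' d1b mulr0 mulr1 subr0.
  have [|t] := IVT xb (ac_continuous RA) (v := 0).
    by rewrite -/(A x) -/(A b) Am Ab /= ge_min le_max lerN10 ler01 orbT.
  rewrite in_itv /= -/(A t) => /andP[xt tb] At.
  have [tb'|tb'] := eqVneq t b; first by move: At; rewrite tb' Ab /= => /eqP; rewrite oner_eq0.
  have tI : t \in `]0, b[ by rewrite in_itv /= (lt_le_trans xp xt) lt_neqAle tb' tb.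
  by move: At; have [] := A2 t tI => -> /= /eqP; rewrite ?oppr_eq0 oner_eq0.
have cc x : x \in `]0, b[ -> c1 x = c2 x.
  move=> xI; have [x0 xb x1] := inI x xI; rewrite -[RHS]mul1r -(A1 x xI) -[LHS]mulr1 -(w2 x x0 x1).
  apply/eqP; rewrite -subr_eq0; apply/eqP.
  transitivity (- c2' x * (c1 x * d2 x - c2 x * d1 x)); last by rewrite D0// mulr0.
  by rewrite /A; ring.
have dd x : x \in `]0, b[ -> d1 x = d2 x.
  move=> xI; have [x0 xb x1] := inI x xI; rewrite -[RHS]mul1r -(A1 x xI) -[LHS]mulr1 -(w2 x x0 x1).
  apply/eqP; rewrite -subr_eq0; apply/eqP.
  transitivity (- d2' x * (c1 x * d2 x - c2 x * d1 x)); last by rewrite D0// mulr0.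
  by rewrite /A; ring.
have Pc := potential_difference_eq0 b1 hc1 hc2 cc.
have Pd := potential_difference_eq0 b1 hd1 hd2 dd.
have P : {ae mu, forall x, x \in `]0, b[ -> q1 x = q2 x}.
  apply: ae_impl2 Pc Pd => x hc hd xI; have [x0 xb x1] := inI x xI.
  (* The difference annihilates both c1 and d1, hence also their Wronskian, which is 1. *)
  have : (q1 x - q2 x)%:C = 0.
    rewrite -[LHS]mulr1 -(w1 x x0 x1) mulrBr mulrA hc// mul0r [c1' x * _]mulrC mulrA hd// mul0r.
    by rewrite subrr.
  by move=> -[] /eqP; rewrite subr_eq0 => /eqP.
have P0 : {ae mu, forall x, x <> b -> x \in `[0, b] -> q1 x = q2 x}.
  apply: ae_impl2 P (ae_neq 0) => x h xn0 xnb; rewrite in_itv /= => /andP[x0 xb].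
  by apply: h; rewrite in_itv /= !lt_neqAle x0 xb !andbT; apply/andP; split; apply/eqP; auto.
apply: ae_impl2 P0 (ae_neq b) => x h xnb xI; exact: h.
Qed.

End Uniqueness.

Section Determination.
Variable R : realType.

(** The bound on the sums of |eps| is the common form of the two cases: convergence to 0 yields it
    when the slope 1 - 2 b / sigma is positive, summability as soon as the slope is nonnegative. *)
Lemma potential_determined (b sigma C1 : R) (m : nat -> nat) (eps : nat -> R) :
  0 < b -> b < 1 -> 0 < sigma ->
  (forall i j : nat, (0 < i)%N -> (0 < j)%N -> m i = m j -> i = j) ->
  (forall j : nat, (0 < j)%N -> (m j)%:R = j%:R / sigma * (1 + eps j) :> R) ->
  (forall j : nat, (0 < j)%N -> `|eps j| < 1) ->
  (forall n, \sum_(j < n) `|eps j.+1| <= (1 - 2 * b / sigma) * n%:R + C1) ->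
  data_determine_potential b m.
Proof.
move=> b0 b1 sg0 minj hm heps hsum q1 q2 lam1 lam2 i1 i2 sp1 sp2 eq12 elam.
have [s1 [s1' [c1 [c1' [d1 [d1' [[hs1 hc1 hd1] s10 cd1 E1 p1]]]]]]] := backward_solutions i1 (ltW b0) (ltW b1).
have [s2 [s2' [c2 [c2' [d2 [d2' [[hs2 hc2 hd2] s20 cd2 E2 p2]]]]]]] := backward_solutions i2 (ltW b0) (ltW b1).
have [p1b p1b' _ _] := p1 b (ltW b0) (ltW b1).
have [p2b p2b' _ _] := p2 b (ltW b0) (ltW b1).
have W := wronskian_vanishes b0 b1 sg0 minj hm heps hsum i1 i2 sp1 sp2 eq12 elam
  hs1 hs2 s10 s20 p1b p1b' p2b p2b'.
apply: (potentials_equal b0 (ltW b1) (hc1 0) (hd1 0) (hc2 0) (hd2 0) (cd1 0) (cd2 0)) => x x0 xb.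
have x1 : x <= 1 by apply: le_trans xb (ltW b1).
have [_ _ pc1 pd1] := p1 x x0 x1; have [_ _ pc2 pd2] := p2 x x0 x1.
have [K [r0 H]] := cross_bound i1 i2 b0 (ltW b1) x0 xb.
apply: (liouville_at0 (f := fun lam => c1 lam x * d2 lam x - c2 lam x * d1 lam x) (K := K) (r0 := r0)).
  by apply: poly_approxB; apply: poly_approxM.
move=> k kr t0; have [? ?] := s10 (k ^+ 2); have [? ?] := s20 (k ^+ 2).
exact: (H k _ _ _ _ _ _ _ _ _ _ _ _ kr t0 (hs1 _) (hc1 _) (hd1 _) (hs2 _) (hc2 _) (hd2 _)).
Qed.

(** Beyond some index N the terms are at most [eta]; each of the first N contributes less than 1. *)
Lemma sum_le_of_cvg0 (u : nat -> R) (eta : R) : 0 < eta -> u @ \oo --> (0 : R) ->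
  (forall j : nat, (0 < j)%N -> `|u j| < 1) ->
  exists N : nat, forall n, \sum_(j < n) `|u j.+1| <= eta * n%:R + N%:R.
Proof.
move=> eta0 cu u1; have /cvgrPdist_le /(_ _ eta0) [N _ HN] := cu.
exists N => n; apply: le_trans (_ : eta * n%:R + (minn n N)%:R <= _); last first.
  by rewrite lerD2l ler_nat geq_minr.
elim: n => [|n IH]; first by rewrite big_ord0 mulr0 min0n addr0.
rewrite big_ord_recr /=; case: (ltnP n N) => nN.
  rewrite (minn_idPl nN); rewrite (minn_idPl (ltnW nN)) in IH.
  apply: le_trans (lerD IH (ltW (u1 n.+1 isT))) _.
  by rewrite -(natr1 n) mulrDr mulr1; lra.
rewrite (minn_idPr (leqW nN)); rewrite (minn_idPr nN) in IH.
have h : `|u n.+1| <= eta by have := HN n.+1 (leqW nN); rewrite /= sub0r normrN.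
by apply: le_trans (lerD IH h) _; rewrite -(natr1 n) mulrDr mulr1; lra.
Qed.

Lemma sum_le_of_nneseries (u : nat -> R) : (\sum_(1 <= j <oo) (`|u j|)%:E < +oo)%E ->
  exists M : R, forall n, \sum_(j < n) `|u j.+1| <= M.
Proof.
set S := (X in (X < _)%E) => Sfin.
have S0 : (0 <= S)%E by apply: nneseries_ge0 => j _ _; rewrite lee_fin.
exists (fine S) => n; rewrite -lee_fin fineK ?ge0_fin_numE//.
have -> : \sum_(j < n) `|u j.+1| = \sum_(1 <= j < n.+1) `|u j|.
  by rewrite big_add1 big_mkord.
rewrite -sumEFin; apply: nneseries_lim_ge => j _ _; by rewrite lee_fin.
Qed.

End Determination.

Theorem theorem1p5p1 (R : realType) (b sigma : R)
    (m : nat -> nat) (eps : nat -> R)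
    (hb0 : 0 < b) (hb1 : b < 1)
    (hsigma0 : 0 < sigma) (hsigma2 : sigma <= 2)
    (* the given eigenvalues are distinct *)
    (hinj : forall i j : nat, (0 < i)%N -> (0 < j)%N -> m i = m j -> i = j)
    (hm : forall j : nat, (0 < j)%N ->
       (m j)%:R = j%:R / sigma * (1 + eps j) :> R)
    (heps1 : forall j : nat, (0 < j)%N -> `|eps j| < 1)
    (heps0 : eps @ \oo --> (0 : R)) :
  (2 * b < sigma -> data_determine_potential b m)
  /\
  ((\sum_(1 <= j <oo) (`|eps j|)%:E < +oo)%E ->
   2 * b <= sigma -> data_determine_potential b m).
Proof.
split=> [bs|sfin bs].
  have eta0 : 0 < 1 - 2 * b / sigma by rewrite subr_gt0 ltr_pdivrMr// mul1r.
  have [N HN] := sum_le_of_cvg0 eta0 heps0 heps1.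
  exact: potential_determined HN.
have [M HM] := sum_le_of_nneseries sfin.
have eta0 : 0 <= 1 - 2 * b / sigma by rewrite subr_ge0 ler_pdivrMr// mul1r.
apply: (@potential_determined _ _ sigma M m eps) => // n.
by apply: le_trans (HM n) _; rewrite lerDr mulr_ge0.
Qed.
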